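(* Let $n\geq 1$, $s>\frac n2$, $\omega>0$ and $\sigma>0$. Then the waves $e^{i\omega t}\phi_\omega$ are spectrally stable if and only if $$0<\sigma<\frac{2s}{n}-1.$$ That is, the waves are stable for all $0<\sigma<\frac{2s}{n}-1$ and unstable when $\sigma>\frac{2s}{n}-1$. Moreover, the instability is due to the presence of a single and simple real mode in the eigenvalue problem $\mathcal J\mathcal L\vec v=\lambda\vec v$.
   Context: Fourier transform: $\hat f(\xi)=\int_{\mathbb R^n} f(x)e^{-2\pi i x\cdot\xi}dx$; $\widehat{(-\Delta)^s f}(\xi)=(2\pi|\xi|)^{2s}\hat f(\xi)$. For $\lambda>0$, $\mathcal G_s^\lambda$ is defined by $\widehat{\mathcal G_s^\lambda}(\xi)=\frac{1}{(2\pi|\xi|)^{2s}+\lambda}$ (for $s>n/2$ it lies in $H^s(\mathbb R^n)\subset C(\mathbb R^n)$). The function $\phi_\omega(x)=\mathcal G_s^\omega(x)/(\mathcal G_s^\omega(0))^{1+\frac1{2\sigma}}$ solves $(-\Delta)^s\phi+\omega\phi-|\phi(0)|^{2\sigma}\phi(0)\delta_0=0$, so that $e^{i\omega t}\phi_\omega$ is a standing wave of the concentrated NLS $iu_t=((-\Delta)^s-|u|^{2\sigma}\delta_0)u$ on $\mathbb R^n$. For $\lambda>0$, $c>0$, $s>n/2$, the operator on $L^2(\mathbb R^n)$ denoted $(-\Delta)^s+\lambda-c\delta_0$ is the self-adjoint operator with domain $\{\psi\in H^s(\mathbb R^n):\ \psi=g+c\,\psi(0)\,\mathcal G_s^\lambda,\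 g\in H^{2s}(\mathbb R^n)\}$ acting by $\psi\mapsto((-\Delta)^s+\lambda)g$. Set $$\mathcal L_+=(-\Delta)^s+\omega-(2\sigma+1)|\phi_\omega(0)|^{2\sigma}\delta_0,\qquad \mathcal L_-=(-\Delta)^s+\omega-|\phi_\omega(0)|^{2\sigma}\delta_0,$$ $$\mathcal J=\begin{pmatrix}0&-1\\1&0\end{pmatrix},\qquad \mathcal L=\begin{pmatrix}\mathcal L_-&0\\0&\mathcal L_+\end{pmatrix},\qquad D(\mathcal L)=D(\mathcal L_-)\times D(\mathcal L_+).$$ The wave $e^{i\omega t}\phi_\omega$ is spectrally unstable if the eigenvalue problem $\mathcal J\mathcal L\vec v=\lambda\vec v$ has a solution $(\lambda,\vec v)$ with $\Re\lambda>0$, $\vec v\ne0$, $\vec v\in D(\mathcal L)$; otherwise it is spectrally stable.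
   Formalization: The equivalence is stated for σ ≠ 2s/n − 1: at σ = 2s/n − 1 (e.g. n = s = ω = σ = 1) the wave is spectrally stable under the given definition, so the literal ''if and only if'' fails there; both implications of the ''That is'' sentence are kept. *)

(* Defs.v *)
From HB Require Import structures.
From mathcomp Require Import all_boot all_order all_algebra.
From mathcomp Require Import all_classical all_reals all_analysis.
From mathcomp Require Import complex.

Set Implicit Arguments.
Unset Strict Implicit.
Unset Printing Implicit Defensive.

Import Order.TTheory GRing.Theory Num.Theory.
Import numFieldNormedType.Exports.

Local Open Scope classical_set_scope.
Local Open Scope ring_scope.
Local Open Scope complex_scope.

Notation Rn R n := (n.-tuple (measurableTypeR R)).

Section lebesgue_measure_step.
Context (R : realType) (n : nat)
  (m : {sigma_finite_measure set (Rn R n) -> \bar R}).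

Definition tuple_consp (p : measurableTypeR R * Rn R n) : Rn R n.+1 :=
  [the n.+1.-tuple _ of p.1 :: p.2].

Lemma measurable_tuple_consp : measurable_fun setT tuple_consp.
Proof. exact: measurable_cons. Qed.

Definition lebesgue_step : set (Rn R n.+1) -> \bar R :=
  pushforward (@lebesgue_measure R \x m)%E tuple_consp.

Let lebesgue_step0 : lebesgue_step set0 = 0%E.
Proof. by rewrite /lebesgue_step /pushforward preimage_set0 measure0. Qed.

Let lebesgue_step_ge0 A : (0 <= lebesgue_step A)%E.
Proof. by rewrite /lebesgue_step /pushforward; apply: measure_ge0. Qed.

Let lebesgue_step_sigma_additive : semi_sigma_additive lebesgue_step.
Proof.
exact: (@measure_semi_sigma_additive _ _ _
  (measure_function_pushforward__canonical__measure_function_Measure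
     (@lebesgue_measure R \x m)%E measurable_tuple_consp)).
Qed.

HB.instance Definition _ := isMeasure.Build _ _ _ lebesgue_step
  lebesgue_step0 lebesgue_step_ge0 lebesgue_step_sigma_additive.

Lemma lebesgue_step_sigma_finite : sigma_finite setT lebesgue_step.
Proof.
have /sigma_finiteP[F [TF ndF Foo]] := sigma_finiteT (@lebesgue_measure R).
have /sigma_finiteP[G [TG ndG Goo]] := sigma_finiteT m.
pose g (t : Rn R n.+1) : measurableTypeR R * Rn R n :=
  (thead t, [tuple of behead t]).
have mg : measurable_fun setT g.
  apply: measurable_fun_pair; first exact: measurable_tnth.
  exact: measurable_behead.
have gK : g \o tuple_consp = id.
  by apply/funext => -[x t]; congr pair; apply: val_inj.
exists (fun k => g @^-1` (F k `*` G k)) => [|k].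
  rewrite -preimage_bigcup (_ : \bigcup_k _ = setT) ?preimage_setT//.
  apply/seteqP; split => // -[x y] _.
  have [i _ Fi] : (\bigcup_k F k) x by rewrite -TF.
  have [j _ Gj] : (\bigcup_k G k) y by rewrite -TG.
  exists (maxn i j) => //; split.
  - by move: x Fi; exact/subsetPset/ndF/leq_maxl.
  - by move: y Gj; exact/subsetPset/ndG/leq_maxr.
have [mF Fk] := Foo k; have [mG Gk] := Goo k.
have mFG : measurable (F k `*` G k) by exact: measurableX.
split; first by rewrite -[X in measurable X]setTI; exact: mg.
rewrite /lebesgue_step /pushforward -comp_preimage gK preimage_id.
by rewrite product_measure1E// lte_mul_pinfty// ge0_fin_numE.
Qed.

HB.instance Definition _ :=
  Measure_isSigmaFinite.Build _ _ _ lebesgue_step lebesgue_step_sigma_finite.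

End lebesgue_measure_step.

Fixpoint lebesgue_Rn (R : realType) (n : nat) :
    {sigma_finite_measure set (Rn R n) -> \bar R} :=
  if n is k.+1 then lebesgue_step (lebesgue_Rn R k)
  else \d_([tuple] : Rn R 0).

Arguments lebesgue_Rn {R n}.

Section fourier.
Context {R : realType} {n : nat}.
Local Notation X := (Rn R n).
Local Notation mu := (@lebesgue_Rn R n).
Implicit Types (f g h : X -> R[i]) (x xi : X).

Definition dot x xi : R := \sum_(i < n) (tnth x i : R) * (tnth xi i : R).

Definition enorm x : R := Num.sqrt (dot x x).

Definition origin : X := [tuple (0 : R) | i < n].

Definition aeq f g := f = g %[ae mu].

Definition LpC (p : \bar R) f :=
  (@complex.Re R \o f \in Lfun mu p) && (@complex.Im R \o f \in Lfun mu p).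

Definition distC (p : \bar R) f g : \bar R :=
  Lnorm mu p (fun x => (Normc.normc (f x - g x))%:E).

(* Transports the topology of row vectors, as tuples carry none. *)
Definition continuousC f :=
  let F := fun v : 'rV[R]_n => f [tuple v ord0 i | i < n] in
  continuous (@complex.Re R \o F) /\ continuous (@complex.Im R \o F).

Definition CRintegral f : R[i] :=
  (\int[mu]_x complex.Re (f x)) +i* (\int[mu]_x complex.Im (f x)).

(* exp(- i t) *)
Definition expNi (t : R) : R[i] := cos t -i* sin t.

Definition fourier1 f : X -> R[i] := fun xi =>
  CRintegral (fun x => f x * expNi (2 * pi * dot x xi)).

(* Graph of the L^2 Fourier transform: the closure in L^2 x L^2 of the graph
   of [fourier1] on L^1 /\ L^2. *)
Definition is_fourier f g := [/\ LpC 2%:E f, LpC 2%:E g &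
  exists u : nat -> X -> R[i], [/\ forall k, LpC 1%E (u k) /\ LpC 2%:E (u k),
    distC 2%:E (u k) f @[k --> \oo] --> 0%E &
    distC 2%:E (fourier1 (u k)) g @[k --> \oo] --> 0%E]].

(* A representative; it is determined up to a null set. *)
Definition fourier f : X -> R[i] := xget (cst 0) [set g | is_fourier f g].

Definition Hsob (s : R) f := LpC 2%:E f /\
  (\int[mu]_xi (((1 + enorm xi ^+ 2) `^ s * Normc.normc (fourier f xi) ^+ 2)%:E)
     < +oo)%E.

(* Symbol of (- Delta)^s. *)
Definition fsymb (s : R) xi : R := (2 * pi * enorm xi) `^ (2 * s).

Definition fraclap (s : R) f : X -> R[i] := xget (cst 0)
  [set h | LpC 2%:E h /\
     aeq (fourier h) (fun xi => (fsymb s xi)%:C * fourier f xi)].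

(* The continuous representative of an element of H^s, s > n / 2; point values
   are always those of this representative. *)
Definition cont_rep f : X -> R[i] :=
  xget f [set g | continuousC g /\ aeq f g].

Definition at0 f : R[i] := cont_rep f origin.

Definition green (s lambda : R) : X -> R[i] := xget (cst 0)
  [set G | [/\ continuousC G, LpC 2%:E G &
     aeq (fourier G) (fun xi => ((fsymb s xi + lambda)^-1)%:C)]].

(* The operator (- Delta)^s + lambda - c delta_0. On its domain g is
   psi - c psi(0) green, so the action can be written in terms of psi. *)
Definition delta_dom (s lambda c : R) (psi : X -> R[i]) :=
  Hsob s psi /\ exists g, Hsob (2 * s) g /\
    aeq psi (fun x => g x + c%:C * at0 psi * green s lambda x).

Definition delta_op (s lambda c : R) (psi : X -> R[i]) : X -> R[i] :=
  let g := fun x => psi x - c%:C * at0 psi * green s lambda x in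
  fun x => fraclap s g x + lambda%:C * g x.

End fourier.

Section spectral_stability.
Context {R : realType}.
Variables (n : nat) (s omega sigma : R).
Local Notation X := (Rn R n).
Local Notation vec := ((X -> R[i]) * (X -> R[i]))%type.
Implicit Types (lambda : R[i]) (v w : vec).

(* The value green(0) is a positive real, and only its real power is needed. *)
Definition phi : X -> R[i] := fun x => green s omega x /
  ((complex.Re (green s omega (@origin R n))) `^ (1 + (2 * sigma)^-1))%:C.

Definition coefm : R := Normc.normc (phi origin) `^ (2 * sigma).
Definition coefp : R := (2 * sigma + 1) * coefm.

Definition domL v := delta_dom s omega coefm v.1 /\ delta_dom s omega coefp v.2.
Definition opL v : vec :=
  (delta_op s omega coefm v.1, delta_op s omega coefp v.2).
Definition opJ v : vec := (fun x => - v.2 x, v.1).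

Definition vaeq v w := aeq v.1 w.1 /\ aeq v.2 w.2.
Definition vzero : vec := (cst 0, cst 0).
Definition vscale lambda v : vec :=
  (fun x => lambda * v.1 x, fun x => lambda * v.2 x).
Definition vsub v w : vec := (fun x => v.1 x - w.1 x, fun x => v.2 x - w.2 x).

Definition eigenpair lambda v :=
  [/\ domL v, ~ vaeq v vzero & vaeq (opJ (opL v)) (vscale lambda v)].

Definition spectrally_unstable :=
  exists lambda v, 0 < complex.Re lambda /\ eigenpair lambda v.

Definition spectrally_stable := ~ spectrally_unstable.

(* v lies in the kernel of (J L - lambda)^k, on the natural domain. *)
Fixpoint gen_kernel (k : nat) lambda v : Prop :=
  if k is j.+1 then
    domL v /\ gen_kernel j lambda (vsub (opJ (opL v)) (vscale lambda v))
  else vaeq v vzero.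

(* An eigenvalue of algebraic multiplicity one. *)
Definition simple_eigenvalue lambda := exists v, eigenpair lambda v /\
  forall k w, gen_kernel k lambda w -> exists z, vaeq w (vscale z v).

(* The eigenvalues of J L in the open right half-plane reduce to a single one,
   which is real and simple. *)
Definition single_simple_real_mode := exists lambda0 : R,
  [/\ 0 < lambda0, simple_eigenvalue lambda0%:C &
    forall lambda v, 0 < complex.Re lambda -> eigenpair lambda v ->
      lambda = lambda0%:C].

End spectral_stability.

(* Main.v *)
Require Import Defs.
From mathcomp Require Import all_boot all_order all_algebra.
From mathcomp Require Import all_classical all_reals all_analysis.
From mathcomp Require Import measurable_realfun complex.
From mathcomp Require Import ring lra.

(**
On the Fourier side, with m(xi) = (2 pi |xi|)^(2s) + omega and M_k the integral
of m^-k, L_- and L_+ become p |-> m p - c (int p) with c = 1/M_1 and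
c = (2 sigma + 1)/M_1 respectively; 1/m is the transform of G_s^omega. By
Cauchy-Schwarz L_- >= 0 with kernel spanned by 1/m, whereas the form of L_+ is
nonnegative on the hyperplane int q = 0, so that it admits no plane of negative
directions. If J L v = lambda v with Re lambda > 0 and v has transform (p, q),
then pairing the two equations makes lambda real and <L_+ q, q> negative, hence
int q <> 0: the eigenspace is a line. Eigenvectors of distinct eigenvalues have
L_+-orthogonal components q, which codimension one forbids, and a Jordan chain
is excluded by symmetry.

The combination psi of 1/m and 1/m^2 with L_+ psi = 1/m is L_+-orthogonal to q,
because q is orthogonal to ker L_-. When (2 sigma + 1) M_2^2 >= 2 sigma M_1 M_3,
<L_+ psi, psi> <= 0 and there is no room left for q, which gives stability.
Otherwise the positive eigenvalues are the square roots of the zeros of an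
explicit continuous function that changes sign on (0, oo). Scaling in omega gives
omega M_2 = a M_1 and 2 omega M_3 = (a + 1) M_2 with a = 1 - n/(2s), which turns
the criterion into sigma <= 2s/n - 1.

Plancherel's identity and Fourier inversion in L^2 rest on the approximate
identity formed by the Poisson kernel.
*)

Set Implicit Arguments.
Unset Strict Implicit.
Unset Printing Implicit Defensive.

Import Order.TTheory GRing.Theory Num.Theory.
Import numFieldNormedType.Exports.
Import Normc.
Import HBNNSimple.

Local Open Scope classical_set_scope.
Local Open Scope ring_scope.
Local Open Scope complex_scope.

Local Notation "z ^*" := (conjc z) : ring_scope.

(** * Complex-valued integrals *)

(** Three of the definitions, [green], [fraclap] and [cont_rep], pick a function by its
    specification and fall back on a default. Nothing can be computed from them until the
    specification is known to be inhabited, and an eigenvector found on the Fourier side must be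
    carried back to a function on [R^n]. Both require surjectivity of the transform on [L^2], so
    inversion cannot be avoided. Of Plancherel's theorem, on the other hand, only boundedness is
    used.

    The Poisson kernel is chosen as approximate identity because it is elementary on both sides: it
    is the transform of [exp (-e |t|)], its antiderivative is an arctangent, and in [R^n] both
    functions can be taken as products over the coordinates.

    The spectral argument lives on an arbitrary measure space of positive mass with a measurable
    [m >= w > 0] such that [1/m] is integrable. The Laplacian and the dimension return only when the
    first three moments of [1/m] have to be compared. *)

Section complex_arith.
Context {R : realType}.
Implicit Types z w : R[i].

Lemma ReD z w : complex.Re (z + w) = complex.Re z + complex.Re w.
Proof. by case: z; case: w. Qed.

Lemma ImD z w : complex.Im (z + w) = complex.Im z + complex.Im w.
Proof. by case: z; case: w. Qed.

Lemma ReN z : complex.Re (- z) = - complex.Re z.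
Proof. by case: z. Qed.

Lemma ImN z : complex.Im (- z) = - complex.Im z.
Proof. by case: z. Qed.

Lemma ReM z w :
  complex.Re (z * w) = complex.Re z * complex.Re w - complex.Im z * complex.Im w.
Proof. by case: z; case: w. Qed.

Lemma ImM z w :
  complex.Im (z * w) = complex.Re z * complex.Im w + complex.Im z * complex.Re w.
Proof. by case: z => a b; case: w => c e /=; rewrite addrC. Qed.

Lemma ReJ z : complex.Re z^* = complex.Re z. Proof. by case: z. Qed.

Lemma ImJ z : complex.Im z^* = - complex.Im z. Proof. by case: z. Qed.

Lemma complex_eqP z w :
  complex.Re z = complex.Re w -> complex.Im z = complex.Im w -> z = w.
Proof. by case: z; case: w => ? ? ? ? /= -> ->. Qed.

Lemma sqr_normcE z : normc z ^+ 2 = complex.Re z ^+ 2 + complex.Im z ^+ 2.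
Proof. by case: z => a b /=; rewrite sqr_sqrtr// addr_ge0// sqr_ge0. Qed.

Lemma normc_ge0 z : 0 <= normc z.
Proof. by case: z => a b /=; rewrite sqrtr_ge0. Qed.

Lemma normc_real (x : R) : normc x%:C = `|x|.
Proof. by rewrite /= expr0n /= addr0 sqrtr_sqr. Qed.

Lemma normc_conj z : normc z^* = normc z.
Proof. by case: z => a b /=; rewrite sqrrN. Qed.

Lemma mulc_conj z : z * z^* = (normc z ^+ 2)%:C.
Proof. by rewrite sqr_normcE; case: z => a b; apply: complex_eqP => /=; ring. Qed.

Lemma normr_Re_le z : `|complex.Re z| <= normc z.
Proof.
rewrite -(@ler_pXn2r _ 2) ?nnegrE ?normc_ge0// sqr_normcE real_normK ?num_real//.
by rewrite lerDl sqr_ge0.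
Qed.

Lemma normr_Im_le z : `|complex.Im z| <= normc z.
Proof.
rewrite -(@ler_pXn2r _ 2) ?nnegrE ?normc_ge0// sqr_normcE real_normK ?num_real//.
by rewrite lerDr sqr_ge0.
Qed.

Lemma normc_le_ReIm z : normc z <= `|complex.Re z| + `|complex.Im z|.
Proof.
rewrite -(@ler_pXn2r _ 2) ?nnegrE ?normc_ge0 ?addr_ge0//.
rewrite sqr_normcE sqrrD !real_normK ?num_real//.
by rewrite -addrA lerD2l lerDr mulrn_wge0// mulr_ge0.
Qed.

Lemma sqr_normcD z w : normc (z + w) ^+ 2 <= 2 * normc z ^+ 2 + 2 * normc w ^+ 2.
Proof.
rewrite !sqr_normcE ReD ImD.
have := sqr_ge0 (complex.Re z - complex.Re w).
have := sqr_ge0 (complex.Im z - complex.Im w).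
by rewrite !sqrrB !sqrrD; lra.
Qed.

Lemma normc_distrC z w : normc (z - w) = normc (w - z).
Proof. by rewrite -normcN opprB. Qed.

Lemma conjcM z w : (z * w)^* = z^* * w^*.
Proof. by rewrite (rmorphM (@conjc R)). Qed.

Lemma conjcD z w : (z + w)^* = z^* + w^*.
Proof. by rewrite (rmorphD (@conjc R)). Qed.

Lemma conjcB z w : (z - w)^* = z^* - w^*.
Proof. by rewrite (rmorphB (@conjc R)). Qed.

Lemma normc_eq0P z : normc z = 0 -> z = 0.
Proof. exact: Normc.eq0_normc. Qed.

Lemma realcD (x y : R) : (x + y)%:C = x%:C + y%:C.
Proof. exact: rmorphD. Qed.

Lemma realcB (x y : R) : (x - y)%:C = x%:C - y%:C.
Proof. exact: rmorphB. Qed.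

Lemma realcM (x y : R) : (x * y)%:C = x%:C * y%:C.
Proof. exact: rmorphM. Qed.

Lemma realc_eq0 (x : R) : (x%:C == 0) = (x == 0).
Proof. by rewrite eq_complex /= eqxx andbT. Qed.

End complex_arith.

Section complex_measurable.
Context d (T : measurableType d) {R : realType}.
Implicit Types f g : T -> R[i].

Definition cmeas f := measurable_fun setT (@complex.Re R \o f) /\
  measurable_fun setT (@complex.Im R \o f).

Lemma cmeasD f g : cmeas f -> cmeas g -> cmeas (fun x => f x + g x).
Proof.
move=> [f1 f2] [g1 g2]; split.
- rewrite (_ : _ \o _ = (@complex.Re R \o f) \+ (@complex.Re R \o g)).
    exact: measurable_funD.
  by apply/funext => x /=; rewrite ReD.
- rewrite (_ : _ \o _ = (@complex.Im R \o f) \+ (@complex.Im R \o g)).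
    exact: measurable_funD.
  by apply/funext => x /=; rewrite ImD.
Qed.

Lemma cmeasM f g : cmeas f -> cmeas g -> cmeas (fun x => f x * g x).
Proof.
move=> [f1 f2] [g1 g2]; split.
- rewrite (_ : _ \o _ = ((@complex.Re R \o f) \* (@complex.Re R \o g)) \-
     ((@complex.Im R \o f) \* (@complex.Im R \o g))).
    by apply: measurable_funB; apply: measurable_funM.
  by apply/funext => x /=; rewrite ReM.
- rewrite (_ : _ \o _ = ((@complex.Re R \o f) \* (@complex.Im R \o g)) \+
     ((@complex.Im R \o f) \* (@complex.Re R \o g))).
    by apply: measurable_funD; apply: measurable_funM.
  by apply/funext => x /=; rewrite ImM.
Qed.

Lemma cmeas_real (g : T -> R) : measurable_fun setT g -> cmeas (fun x => (g x)%:C).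
Proof. by move=> mg; split => //=; exact: measurable_cst. Qed.

Lemma cmeas_cst (c : R[i]) : cmeas (fun=> c).
Proof. by split; exact: measurable_cst. Qed.

Lemma cmeasN f : cmeas f -> cmeas (fun x => - f x).
Proof.
move=> mf; under eq_fun do rewrite -mulN1r.
exact/cmeasM/mf/cmeas_cst.
Qed.

Lemma cmeasB f g : cmeas f -> cmeas g -> cmeas (fun x => f x - g x).
Proof. by move=> mf mg; apply/cmeasD/cmeasN. Qed.

Lemma cmeasJ f : cmeas f -> cmeas (fun x => (f x)^*).
Proof.
move=> [f1 f2]; split.
  by rewrite (_ : _ \o _ = @complex.Re R \o f)//; apply/funext => x /=; rewrite ReJ.
rewrite (_ : _ \o _ = \- (@complex.Im R \o f)).
  exact: measurableT_comp.
by apply/funext => x /=; rewrite ImJ.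
Qed.

Lemma measurable_sqr_normc f :
  cmeas f -> measurable_fun setT (fun x => normc (f x) ^+ 2).
Proof.
move=> [f1 f2]; under eq_fun do rewrite sqr_normcE.
by apply: measurable_funD; apply: measurable_funX.
Qed.

Lemma measurable_normc f : cmeas f -> measurable_fun setT (fun x => normc (f x)).
Proof.
move=> mf; rewrite (_ : (fun _ => _) = Num.sqrt \o (fun x => normc (f x) ^+ 2)).
  apply: measurableT_comp; last exact: measurable_sqr_normc.
  exact: (continuous_measurable_fun (@sqrt_continuous R)).
by apply/funext => x /=; rewrite sqrtr_sqr ger0_norm// normc_ge0.
Qed.

End complex_measurable.

Lemma cmeas_comp d d' (T : measurableType d) (T' : measurableType d') (R : realType)
  (f : T -> R[i]) (h : T' -> T) :
  cmeas f -> measurable_fun setT h -> cmeas (f \o h).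
Proof.
by move=> [f1 f2] mh; split; rewrite compA; apply: measurableT_comp.
Qed.

Section complex_integral.
Context d (T : measurableType d) {R : realType} (mu : {measure set T -> \bar R}).
Implicit Types f g : T -> R[i].

Definition cintegrable f := mu.-integrable setT (EFin \o (@complex.Re R \o f)) /\
  mu.-integrable setT (EFin \o (@complex.Im R \o f)).

(** The expression of [CRintegral] over an arbitrary measure, so that the same lemmas serve on the
    line, on [R^n] and on products. *)
Definition cint f : R[i] :=
  (\int[mu]_x complex.Re (f x)) +i* (\int[mu]_x complex.Im (f x)).

Lemma cintegrable_meas f : cintegrable f -> cmeas f.
Proof.
by move=> [/measurable_int/measurable_EFinP f1 /measurable_int/measurable_EFinP f2].
Qed.

Lemma cintegrable_le f (g : T -> R) : cmeas f -> (forall x, normc (f x) <= g x) ->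
  mu.-integrable setT (EFin \o g) -> cintegrable f.
Proof.
move=> [f1 f2] fg ig; split.
- apply: le_integrable ig => //; first exact/measurable_EFinP.
  move=> x _ /=; rewrite lee_fin (le_trans (normr_Re_le _))//.
  by rewrite (le_trans (fg x))// ler_norm.
- apply: le_integrable ig => //; first exact/measurable_EFinP.
  move=> x _ /=; rewrite lee_fin (le_trans (normr_Im_le _))//.
  by rewrite (le_trans (fg x))// ler_norm.
Qed.

Lemma integrable_normc f : cintegrable f ->
  mu.-integrable setT (EFin \o (fun x => normc (f x))).
Proof.
move=> fi; have mf := cintegrable_meas fi; case: fi => f1 f2.
have := integrableD measurableT (integrable_abse f1) (integrable_abse f2).
apply: le_integrable => //; first exact/measurable_EFinP/measurable_normc.
move=> x _ /=; rewrite lee_fin ger0_norm ?normc_ge0//.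
by rewrite (le_trans (normc_le_ReIm _))// ler_norm.
Qed.

Lemma cintegrableP f : cmeas f ->
  (\int[mu]_x (normc (f x))%:E < +oo)%E -> cintegrable f.
Proof.
move=> mf fo; apply: (@cintegrable_le _ (fun x => normc (f x))) => //.
apply/integrableP; split; first exact/measurable_EFinP/measurable_normc.
rewrite (eq_integral (fun x => (normc (f x))%:E))// => x _ /=.
by rewrite ger0_norm// normc_ge0.
Qed.

Lemma cintegrable_normc_lty f : cintegrable f ->
  (\int[mu]_x (normc (f x))%:E < +oo)%E.
Proof. by move/integrable_normc/(@integrable_lty _ _ _ _ _ measurableT). Qed.

Lemma cintegrableD f g : cintegrable f -> cintegrable g ->
  cintegrable (fun x => f x + g x).
Proof.
move=> [f1 f2] [g1 g2]; split.
- apply: eq_integrable (integrableD measurableT f1 g1) => // x _ /=.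
  by rewrite ReD EFinD.
- apply: eq_integrable (integrableD measurableT f2 g2) => // x _ /=.
  by rewrite ImD EFinD.
Qed.

Lemma cintD f g : cintegrable f -> cintegrable g ->
  cint (fun x => f x + g x) = cint f + cint g.
Proof.
move=> [f1 f2] [g1 g2]; rewrite /cint; apply: complex_eqP => /=.
- by under eq_Rintegral do rewrite ReD; rewrite RintegralD.
- by under eq_Rintegral do rewrite ImD; rewrite RintegralD.
Qed.

Lemma cintegrableZ (c : R[i]) f : cintegrable f -> cintegrable (fun x => c * f x).
Proof.
move=> fi; have mf := cintegrable_meas fi.
apply: (@cintegrable_le _ (fun x => normc c * normc (f x))).
- exact/cmeasM/mf/cmeas_cst.
- by move=> x; rewrite normcM.
- apply: eq_integrable (integrableZl measurableT (normc c) (integrable_normc fi)) => //.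
Qed.

Lemma cintZ (c : R[i]) f : cintegrable f -> cint (fun x => c * f x) = c * cint f.
Proof.
move=> [f1 f2]; rewrite /cint; apply: complex_eqP => /=.
- under eq_Rintegral do rewrite ReM.
  rewrite RintegralB//.
  + by rewrite !RintegralZl//; case: c.
  + exact: eq_integrable (integrableZl measurableT (complex.Re c) f1).
  + exact: eq_integrable (integrableZl measurableT (complex.Im c) f2).
- under eq_Rintegral do rewrite ImM.
  rewrite RintegralD//.
  + by rewrite !RintegralZl//; case: c => a b /=; rewrite addrC.
  + exact: eq_integrable (integrableZl measurableT (complex.Re c) f2).
  + exact: eq_integrable (integrableZl measurableT (complex.Im c) f1).
Qed.

Lemma cintZr (c : R[i]) f : cintegrable f -> cint (fun x => f x * c) = cint f * c.
Proof.
move=> fi; rewrite mulrC -cintZ//; congr cint.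
by apply/funext => x; rewrite mulrC.
Qed.

Lemma cintegrableZr (c : R[i]) f : cintegrable f -> cintegrable (fun x => f x * c).
Proof. by move=> fi; under eq_fun do rewrite mulrC; exact: cintegrableZ. Qed.

Lemma cintegrableN f : cintegrable f -> cintegrable (fun x => - f x).
Proof. by move=> fi; under eq_fun do rewrite -mulN1r; exact: cintegrableZ. Qed.

Lemma cintN f : cintegrable f -> cint (fun x => - f x) = - cint f.
Proof. by move=> fi; under eq_fun do rewrite -mulN1r; rewrite cintZ// mulN1r. Qed.

Lemma cintegrableB f g : cintegrable f -> cintegrable g ->
  cintegrable (fun x => f x - g x).
Proof. by move=> fi gi; apply/cintegrableD/cintegrableN. Qed.

Lemma cintB f g : cintegrable f -> cintegrable g ->
  cint (fun x => f x - g x) = cint f - cint g.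
Proof. by move=> fi gi; rewrite cintD ?cintN//; exact: cintegrableN. Qed.

Lemma cintegrableJ f : cintegrable f -> cintegrable (fun x => (f x)^*).
Proof.
move=> fi; apply: cintegrable_le (integrable_normc fi).
- exact/cmeasJ/cintegrable_meas.
- by move=> x; rewrite normc_conj.
Qed.

Lemma cintJ f : cintegrable f -> cint (fun x => (f x)^*) = (cint f)^*.
Proof.
move=> [f1 f2]; apply: complex_eqP => /=.
  by under eq_Rintegral do rewrite ReJ.
under eq_Rintegral do rewrite ImJ -mulN1r.
by rewrite RintegralZl// mulN1r.
Qed.

Lemma cint_real (g : T -> R) : cint (fun x => (g x)%:C) = (\int[mu]_x g x)%:C.
Proof. by apply: complex_eqP => //=; rewrite Rintegral_cst// mul0r. Qed.

Lemma cintegrable_real (g : T -> R) :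
  mu.-integrable setT (EFin \o g) -> cintegrable (fun x => (g x)%:C).
Proof. by move=> ig; split => //=; exact: integrable0. Qed.

Lemma cint0 : cint (fun=> 0) = 0.
Proof. by rewrite (cint_real (fun=> 0)) Rintegral_cst// mul0r. Qed.

Lemma aeq_cint f g : cmeas f -> cmeas g -> f = g %[ae mu] -> cint f = cint g.
Proof.
move=> [f1 f2] [g1 g2] fg; apply: complex_eqP => /=; congr fine.
- apply: ae_eq_integral => //; [exact/measurable_EFinP|exact/measurable_EFinP|].
  by apply: filterS fg => x /= /(_ Logic.I) ->.
- apply: ae_eq_integral => //; [exact/measurable_EFinP|exact/measurable_EFinP|].
  by apply: filterS fg => x /= /(_ Logic.I) ->.
Qed.

(* Rotate [cint f] onto the positive real axis before taking real parts. *)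
Lemma le_normc_cint f : cintegrable f ->
  ((normc (cint f))%:E <= \int[mu]_x (normc (f x))%:E)%E.
Proof.
move=> fi; have [f0|f0] := eqVneq (cint f) 0.
  by rewrite f0 normc0; apply: integral_ge0 => x _; rewrite lee_fin normc_ge0.
have n0 : normc (cint f) != 0.
  by apply: contra f0 => /eqP/normc_eq0P ->.
pose c := (cint f)^* / (normc (cint f))%:C.
have nc : normc c = 1.
  by rewrite normcM normcV normc_conj normc_real ger0_norm ?normc_ge0// mulfV.
have cE : c * cint f = (normc (cint f))%:C.
  rewrite /c mulrAC [_ * cint f]mulrC mulc_conj expr2 realcM mulfK//.
  by rewrite realc_eq0.
have : complex.Re (cint (fun x => c * f x)) = normc (cint f) by rewrite cintZ// cE.
move=> <-; have cfi := cintegrableZ c fi; rewrite /cint /=.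
rewrite /Rintegral fineK; last by apply: integrable_fin_num => //; case: cfi.
apply: le_integral => //.
- by case: cfi.
- exact: integrable_normc.
- move=> x _; rewrite lee_fin (le_trans (ler_norm _))//.
  by rewrite (le_trans (normr_Re_le _))// normcM nc mul1r.
Qed.

Lemma normc_cint_le f : cintegrable f -> normc (cint f) <= \int[mu]_x normc (f x).
Proof.
move=> fi; rewrite -lee_fin /Rintegral fineK; first exact: le_normc_cint.
by apply: integrable_fin_num => //; exact: integrable_normc.
Qed.

End complex_integral.

Section indicators.
Context d (T : measurableType d) {R : realType}.
Implicit Types (A B : set T) (x : T).

Lemma normc_indic A x : normc (\1_A x : R)%:C = \1_A x.
Proof. by rewrite normc_real ger0_norm. Qed.

Lemma indic01 A x : (\1_A x : R) = 0 \/ (\1_A x : R) = 1.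
Proof. by rewrite indicE; case: (_ \in _); [right|left]. Qed.

Lemma indicT A x : A x -> (\1_A x : R) = 1.
Proof. by move=> Ax; rewrite indicE mem_set. Qed.

Lemma indicF A x : ~ A x -> (\1_A x : R) = 0.
Proof. by move=> Ax; rewrite indicE memNset. Qed.

Lemma indicIE A B x : (\1_(A `&` B) x : R) = \1_A x * \1_B x.
Proof. by rewrite indicI. Qed.

Lemma sqr_indic A x : (\1_A x : R) ^+ 2 = \1_A x.
Proof. by have [->|->] := indic01 A x; rewrite ?expr0n ?expr1n. Qed.

Lemma cmeas_indicM (g : T -> R) A : measurable_fun setT g -> measurable A ->
  cmeas (fun x => (g x * \1_A x : R)%:C).
Proof.
by move=> mg mA; apply/cmeas_real/measurable_funM => //; exact: measurable_indic.
Qed.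

End indicators.

Arguments indic01 {d T} R A x.

(** * Square-integrable functions *)

Section square_integrable.
Context d (T : measurableType d) {R : realType} (mu : {measure set T -> \bar R}).
Implicit Types f g : T -> R[i].

(** The squared norm, kept in the extended reals to avoid roots and finiteness conditions. The price
    is a factor 2 in each triangle inequality, harmless since these estimates only establish
    finiteness and limits. *)
Definition sq2 f : \bar R := (\int[mu]_x (normc (f x) ^+ 2)%:E)%E.

Definition inL2 f := cmeas f /\ (sq2 f < +oo)%E.

Lemma sq2_ge0 f : (0 <= sq2 f)%E.
Proof. by apply: integral_ge0 => x _; rewrite lee_fin sqr_ge0. Qed.

Lemma emeasurable_sqr_normc f :
  cmeas f -> measurable_fun setT (fun x => (normc (f x) ^+ 2)%:E).
Proof. by move=> mf; exact/measurable_EFinP/measurable_sqr_normc. Qed.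

Lemma sq2Z (c : R[i]) f : cmeas f ->
  sq2 (fun x => c * f x) = ((normc c ^+ 2)%:E * sq2 f)%E.
Proof.
move=> mf; rewrite /sq2; under eq_integral do rewrite normcM exprMn EFinM.
rewrite ge0_integralZl//; first exact: emeasurable_sqr_normc.
- by move=> x _; rewrite lee_fin sqr_ge0.
- by rewrite lee_fin sqr_ge0.
Qed.

Lemma sq2D f g : cmeas f -> cmeas g ->
  (sq2 (fun x => (f x + g x)%R) <= 2%:E * sq2 f + 2%:E * sq2 g)%E.
Proof.
move=> mf mg; rewrite /sq2.
have [mf2 mg2] := (emeasurable_sqr_normc mf, emeasurable_sqr_normc mg).
rewrite -!ge0_integralZl//; try by move=> x _; rewrite lee_fin sqr_ge0.
rewrite -ge0_integralD//; last 4 first.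
- by move=> x _; rewrite mule_ge0// lee_fin sqr_ge0.
- exact: measurable_funeM.
- by move=> x _; rewrite mule_ge0// lee_fin sqr_ge0.
- exact: measurable_funeM.
apply: ge0_le_integral => //.
- by move=> x _; rewrite lee_fin sqr_ge0.
- exact/emeasurable_sqr_normc/cmeasD.
- by apply: emeasurable_funD; apply: measurable_funeM.
- by move=> x _; rewrite -!EFinM -EFinD lee_fin sqr_normcD.
Qed.

Lemma sq2_split f g h : cmeas g -> cmeas h -> (forall x, f x = g x + h x) ->
  (sq2 f <= 2%:E * sq2 g + 2%:E * sq2 h)%E.
Proof. by move=> mg mh /funext ->; exact: sq2D. Qed.

Lemma sq2N f : sq2 (fun x => - f x) = sq2 f.
Proof. by apply: eq_integral => x _; rewrite normcN. Qed.

Lemma sq2J f : sq2 (fun x => (f x)^*) = sq2 f.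
Proof. by apply: eq_integral => x _; rewrite normc_conj. Qed.

Lemma sq2BJ f g : sq2 (fun x => (f x)^* - (g x)^*) = sq2 (fun x => f x - g x).
Proof. by apply: eq_integral => x _; rewrite -conjcB normc_conj. Qed.

Lemma sq2BC f g : sq2 (fun x => f x - g x) = sq2 (fun x => g x - f x).
Proof. by apply: eq_integral => x _; rewrite normc_distrC. Qed.

Lemma sq2_triangle f g h : cmeas f -> cmeas g -> cmeas h ->
  (sq2 (fun x => (f x - h x)%R) <=
   2%:E * sq2 (fun x => (f x - g x)%R) + 2%:E * sq2 (fun x => (g x - h x)%R))%E.
Proof.
move=> mf mg mh; apply: le_trans (sq2D (cmeasB mf mg) (cmeasB mg mh)).
rewrite le_eqVlt; apply/orP; left; apply/eqP; apply: eq_integral => x _.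
by congr (_ ^+ 2)%:E; congr normc; ring.
Qed.

Lemma aeq_sq2 f g : cmeas f -> cmeas g -> f = g %[ae mu] -> sq2 f = sq2 g.
Proof.
move=> mf mg fg; apply: ae_eq_integral => //; try exact: emeasurable_sqr_normc.
by apply: filterS fg => x /= /(_ Logic.I) ->.
Qed.

Lemma sq2_eq0 f : cmeas f -> sq2 f = 0%E -> f = (fun=> 0) %[ae mu].
Proof.
move=> mf f0.
have : ae_eq mu setT (fun x => (normc (f x) ^+ 2)%:E) (cst 0%E).
  apply/(ae_eq_integral_abs mu measurableT); first exact: emeasurable_sqr_normc.
  by rewrite -[RHS]f0; apply: eq_integral => x _; rewrite gee0_abs// lee_fin sqr_ge0.
apply: filterS => x /= /(_ Logic.I) [] /eqP.
by rewrite sqrf_eq0 => /eqP/normc_eq0P.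
Qed.

Lemma sq2B_eq0 f g : cmeas f -> cmeas g -> sq2 (fun x => f x - g x) = 0%E ->
  f = g %[ae mu].
Proof.
move=> mf mg /(sq2_eq0 (cmeasB mf mg)); apply: filterS => x /= /(_ Logic.I) /eqP.
by rewrite subr_eq0 => /eqP.
Qed.

Lemma inL2D f g : inL2 f -> inL2 g -> inL2 (fun x => f x + g x).
Proof.
move=> [mf f2] [mg g2]; split; first exact: cmeasD.
apply: le_lt_trans (sq2D mf mg) _.
by apply: lte_add_pinfty; rewrite lte_mul_pinfty.
Qed.

Lemma inL2Z (c : R[i]) f : inL2 f -> inL2 (fun x => c * f x).
Proof.
move=> [mf f2]; split; first exact/cmeasM/mf/cmeas_cst.
by rewrite sq2Z// lte_mul_pinfty// lee_fin sqr_ge0.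
Qed.

Lemma inL2N f : inL2 f -> inL2 (fun x => - f x).
Proof. by move=> [mf f2]; split; [exact: cmeasN|rewrite sq2N]. Qed.

Lemma inL2B f g : inL2 f -> inL2 g -> inL2 (fun x => f x - g x).
Proof. by move=> Lf Lg; apply/inL2D/inL2N. Qed.

Lemma inL2J f : inL2 f -> inL2 (fun x => (f x)^*).
Proof. by move=> [mf f2]; split; [exact: cmeasJ|rewrite sq2J]. Qed.

Lemma inL2_0 : inL2 (fun=> 0).
Proof.
split; first exact: cmeas_cst.
rewrite /sq2; under eq_integral do rewrite normc0 expr0n /=.
by rewrite integral0.
Qed.

Lemma inL2_le f g : cmeas f -> (forall x, normc (f x) <= normc (g x)) -> inL2 g ->
  inL2 f.
Proof.
move=> mf fg [mg g2]; split => //; apply: le_lt_trans g2.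
apply: ge0_le_integral => //; try exact: emeasurable_sqr_normc.
- by move=> x _; rewrite lee_fin sqr_ge0.
- by move=> x _; rewrite lee_fin lerXn2r ?nnegrE ?normc_ge0.
Qed.

Lemma inL2_ae f g : cmeas f -> f = g %[ae mu] -> inL2 g -> inL2 f.
Proof. by move=> mf fg [mg g2]; split => //; rewrite (aeq_sq2 mf mg fg). Qed.

Lemma inL2_integrable f : inL2 f -> mu.-integrable setT (fun x => (normc (f x) ^+ 2)%:E).
Proof.
move=> [mf f2]; apply/integrableP; split; first exact: emeasurable_sqr_normc.
by under eq_integral do rewrite gee0_abs ?lee_fin ?sqr_ge0//.
Qed.

Lemma inL2M_cintegrable f g : inL2 f -> inL2 g -> cintegrable mu (fun x => f x * g x).
Proof.
move=> Lf Lg.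
apply: (@cintegrable_le _ _ _ _ _ (fun x => normc (f x) ^+ 2 + normc (g x) ^+ 2)).
- exact: cmeasM Lf.1 Lg.1.
- move=> x; rewrite normcM.
  have := sqr_ge0 (normc (f x) - normc (g x)).
  by have := sqr_ge0 (normc (f x) + normc (g x)); rewrite sqrrB sqrrD; lra.
- exact: (integrableD measurableT (inL2_integrable Lf) (inL2_integrable Lg)).
Qed.

(** Fatou's lemma in the form in which it is applied: the limit exists almost everywhere and the
    integrals are eventually bounded. *)
Lemma fatou_le (h_ : nat -> T -> \bar R) (h : T -> \bar R) (C : \bar R) :
  (forall k, measurable_fun setT (h_ k)) -> measurable_fun setT h ->
  (forall k x, 0 <= h_ k x)%E -> (forall x, 0 <= h x)%E ->
  {ae mu, forall x, h_ k x @[k --> \oo] --> h x} ->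
  (\forall k \near \oo, (\int[mu]_x h_ k x <= C)%E) ->
  (\int[mu]_x h x <= C)%E.
Proof.
move=> mh_ mh h_0 h0 ch hC.
rewrite (_ : (\int[mu]_x h x = \int[mu]_x limn_einf (h_ ^~ x))%E); last first.
  apply: ae_eq_integral => //.
    rewrite /limn_einf; apply: measurableT_comp => //.
    by apply: measurable_fun_limn_esup => k; exact: measurableT_comp.
  by apply: filterS ch => x /cvg_limn_einf_sup[-> _].
apply: (le_trans (fatou mu measurableT mh_ (fun k x _ => h_0 k x))).
rewrite limn_einf_lim; apply: lime_le; first exact: is_cvg_einfs.
apply: filterS hC => k hk; apply: le_trans hk.
by apply: ereal_inf_lbound; exists k => /=.
Qed.

Lemma cvg_normc_sqr (u : nat -> R[i]) (l : R[i]) (a : R[i]) :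
  normc (u k - l) @[k --> \oo] --> (0 : R) ->
  ((normc (u k - a) ^+ 2)%:E @[k --> \oo] --> (normc (l - a) ^+ 2)%:E).
Proof.
move=> ul; suff h : normc (u k - a) @[k --> \oo] --> normc (l - a).
  apply/fine_cvgP; split; first by near=> k.
  by rewrite expr2; under eq_fun do rewrite /= expr2; apply: cvgM.
apply/cvgrPdist_le => e e0; move/cvgrPdist_le: ul => /(_ e e0).
apply: filterS => k; rewrite sub0r normrN ger0_norm ?normc_ge0// => h.
apply: le_trans h; rewrite ler_norml; apply/andP; split.
  rewrite lerNl opprB lerBlDr.
  by rewrite (_ : u k - a = (u k - l) + (l - a)) ?le_normcD//; ring.
rewrite lerBlDr (normc_distrC (u k)).
by rewrite (_ : l - a = (l - u k) + (u k - a)) ?le_normcD//; ring.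
Unshelve. all: by end_near. Qed.

Lemma sq2_fatou (f_ : nat -> T -> R[i]) f g (C : \bar R) : (forall k, cmeas (f_ k)) ->
  cmeas f -> cmeas g ->
  {ae mu, forall x, normc (f_ k x - f x) @[k --> \oo] --> (0 : R)} ->
  (\forall k \near \oo, (sq2 (fun x => (f_ k x - g x)%R) <= C)%E) ->
  (sq2 (fun x => f x - g x)%R <= C)%E.
Proof.
move=> mf_ mf mg cf cg.
apply: (fatou_le (h_ := fun k x => (normc (f_ k x - g x) ^+ 2)%:E)) => //.
- by move=> k; exact/emeasurable_sqr_normc/cmeasB.
- exact/emeasurable_sqr_normc/cmeasB.
- by move=> k x; rewrite lee_fin sqr_ge0.
- by move=> x; rewrite lee_fin sqr_ge0.
- by apply: filterS cf => x; exact: cvg_normc_sqr.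
Qed.

Lemma sq2_lim_unique (f_ : nat -> T -> R[i]) f g : (forall k, cmeas (f_ k)) ->
  cmeas f -> cmeas g ->
  sq2 (fun x => f_ k x - f x) @[k --> \oo] --> 0%E ->
  sq2 (fun x => f_ k x - g x) @[k --> \oo] --> 0%E ->
  f = g %[ae mu].
Proof.
move=> mf_ mf mg cf cg; apply: sq2B_eq0 => //.
apply/eqP; rewrite eq_le sq2_ge0 andbT.
have h : (2%:E * sq2 (fun x => (f_ k x - f x)%R) +
    2%:E * sq2 (fun x => (f_ k x - g x)%R))%E @[k --> \oo] --> (2%:E * 0 + 2%:E * 0)%E.
  apply: cvgeD; [by rewrite mule0|exact: cvgeZl|exact: cvgeZl].
rewrite mule0 adde0 in h.
apply: (cvge_to_ge h); near=> k.
by rewrite (sq2BC (f_ k) f); exact: sq2_triangle.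
Unshelve. all: by end_near. Qed.

Lemma sq2_ae_lim_unique (f_ : nat -> T -> R[i]) f g : (forall k, cmeas (f_ k)) ->
  cmeas f -> cmeas g ->
  {ae mu, forall x, normc (f_ k x - f x) @[k --> \oo] --> (0 : R)} ->
  sq2 (fun x => f_ k x - g x) @[k --> \oo] --> 0%E ->
  f = g %[ae mu].
Proof.
move=> mf_ mf mg cf cg; apply: sq2B_eq0 => //.
apply/eqP; rewrite eq_le sq2_ge0 andbT.
apply/lee_addgt0Pr => e e0; rewrite add0e.
apply: (sq2_fatou mf_ mf mg cf).
move/fine_cvgP: cg => [fg /cvgrPdist_le/(_ e e0)].
move: fg; apply: filterS2 => k /fineK <-; rewrite sub0r normrN => h.
by rewrite lee_fin (le_trans (ler_norm _)).
Qed.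

Lemma sq2_dominated (f_ : nat -> T -> R[i]) f g : (forall k, cmeas (f_ k)) -> cmeas f ->
  {ae mu, forall x, normc (f_ k x - f x) @[k --> \oo] --> (0 : R)} ->
  inL2 g -> (forall k x, normc (f_ k x - f x) <= normc (g x)) ->
  sq2 (fun x => f_ k x - f x) @[k --> \oo] --> 0%E.
Proof.
move=> mf_ mf cf Lg fg.
have [|||||_ _] := @dominated_convergence _ _ _ mu setT measurableT
  (fun k x => (normc (f_ k x - f x) ^+ 2)%:E) (cst 0%E) (fun x => (normc (g x) ^+ 2)%:E) => //.
- by move=> k; exact/emeasurable_sqr_normc/cmeasB.
- apply: filterS cf => x cfx _.
  have := cvg_normc_sqr (a := f x) cfx; rewrite subrr normc0 expr0n /=; exact.
- exact: inL2_integrable.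
- by apply: aeW => x k _; rewrite gee0_abs ?lee_fin ?sqr_ge0// lerXn2r ?nnegrE ?normc_ge0.
by rewrite integral0.
Qed.

(** The sum [S] of [4^k |d_k|^2] has integral at most the sum of [(4/8)^k], hence is finite almost
    everywhere. Each term is at most [S x], which gives [M = sqrt (S x)]. *)
Lemma summable_differences (d_ : nat -> T -> R[i]) : (forall k, cmeas (d_ k)) ->
  (forall k, sq2 (d_ k) <= (8^-1 ^+ k)%:E)%E ->
  {ae mu, forall x, exists M : R, forall k, normc (d_ k x) <= M * 2^-1 ^+ k}.
Proof.
move=> md hd.
pose S x := (\sum_(k <oo) (4 ^+ k * normc (d_ k x) ^+ 2)%:E)%E.
have mS k : measurable_fun setT (fun x => (4 ^+ k * normc (d_ k x) ^+ 2)%:E).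
  by apply/measurable_EFinP/measurable_funM => //; exact: measurable_sqr_normc.
have S0 k x : (0 <= (4 ^+ k * normc (d_ k x) ^+ 2)%:E)%E.
  by rewrite lee_fin; apply: mulr_ge0; [exact: exprn_ge0|exact: sqr_ge0].
have iS : (\int[mu]_x S x <= 2%:E)%E.
  rewrite /S integral_nneseries//.
  apply: lime_le; first by apply: is_cvg_nneseries => k _ _; exact: integral_ge0.
  apply: nearW => n; apply: (@le_trans _ _ (\sum_(0 <= k < n) (2^-1 ^+ k)%:E)%E).
    apply: lee_sum => k _; under eq_integral do rewrite EFinM.
    rewrite ge0_integralZl//; last 2 first.
    - exact: emeasurable_sqr_normc.
    - by move=> x _; rewrite lee_fin sqr_ge0.
    apply: (@le_trans _ _ ((4 ^+ k)%:E * (8^-1 ^+ k)%:E)%E).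
      by rewrite lee_pmul2l ?lte_fin ?exprn_gt0//; exact: hd.
    by rewrite -EFinM lee_fin -exprMn (_ : 4 * 8^-1 = 2^-1 :> R)//; lra.
  rewrite sumEFin lee_fin; suff -> : \sum_(0 <= k < n) 2^-1 ^+ k = 2 - 2 * 2^-1 ^+ n :> R.
    by rewrite gerBl mulr_ge0// exprn_ge0.
  elim: n => [|n ih]; first by rewrite big_nil expr0 mulr1 subrr.
  by rewrite big_nat_recr//= ih exprS; lra.
have mSS : measurable_fun setT S.
  by apply: ge0_emeasurable_sum => // k; exact: S0.
have iS' : mu.-integrable setT S.
  apply/integrableP; split => //.
  under eq_integral do rewrite gee0_abs ?nneseries_ge0//.
  by apply: le_lt_trans iS _; rewrite ltry.
have := integrable_ae measurableT iS'; apply: filterS => x /(_ Logic.I) fS.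
exists (Num.sqrt (fine (S x))) => k.
rewrite -(@ler_pXn2r _ 2) ?nnegrE ?normc_ge0 ?mulr_ge0 ?sqrtr_ge0 ?exprn_ge0//.
rewrite exprMn sqr_sqrtr; last by rewrite fine_ge0// nneseries_ge0.
have : ((4 ^+ k * normc (d_ k x) ^+ 2)%:E <= S x)%E.
  rewrite /S (nneseriesD1 (n := k))//.
  by rewrite leeDl// nneseries_ge0.
rewrite -(fineK fS) lee_fin -exprM mulnC exprM (_ : 2^-1 ^+ 2 = 4^-1 :> R); last by lra.
by rewrite exprVn ler_pdivlMr ?exprn_gt0// mulrC.
Qed.

Lemma cvg_geometric_differences (u : nat -> R) (M : R) :
  (forall k, `|u k.+1 - u k| <= M * 2^-1 ^+ k) -> cvgn u.
Proof.
move=> hu.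
have : cvgn (series (fun k => u k.+1 - u k)).
  apply: normed_cvg; apply: (@series_le_cvg _ _ (geometric M 2^-1)) => //=.
  - by move=> k; rewrite (le_trans _ (hu k)).
  - by apply: is_cvg_geometric_series; rewrite ger0_norm//; lra.
move=> /cvg_ex[/= l hl]; apply/cvg_ex; exists (l + u 0%N).
have : (fun k => series (fun k => u k.+1 - u k) k + u 0%N) @ \oo --> l + u 0%N.
  by apply: cvgD => //; exact: cvg_cst.
rewrite (_ : (fun k => _) = u)//; apply/funext => k /=.
by rewrite seriesEnat /= telescope_sumr// subrK.
Qed.

(** Riesz-Fischer: a fast subsequence converges almost everywhere, and Fatou's lemma along it
    controls the distance of the whole sequence to the limit. *)
Lemma inL2_complete (f_ : nat -> T -> R[i]) : (forall k, inL2 (f_ k)) ->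
  (forall e : R, 0 < e -> exists N, forall i j, (N <= i)%N -> (N <= j)%N ->
    (sq2 (fun x => (f_ i x - f_ j x)%R) <= e%:E)%E) ->
  exists g, inL2 g /\ sq2 (fun x => f_ k x - g x) @[k --> \oo] --> 0%E.
Proof.
move=> Lf cf.
have mf k : cmeas (f_ k) by case: (Lf k).
have e8 k : 0 < 8^-1 ^+ k :> R by rewrite exprn_gt0.
have [N hN] := choice (fun k => cf _ (e8 k)).
(* The running maximum ensures that all indices [m j] with [j >= k] lie beyond [N k]. *)
pose m k := (\max_(i < k.+1) N i)%N.
have Nm k j : (k <= j)%N -> (N k <= m j)%N.
  by move=> kj; apply: (@leq_bigmax _ (fun i : 'I_j.+1 => N i) (Ordinal (kj : (k < j.+1)%N))).
pose h k := f_ (m k).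
have mh k : cmeas (h k) by exact: mf.
have [|Z [mZ Z0 sZ]] := @summable_differences (fun k x => h k.+1 x - h k x)
    (fun k => cmeasB (mh _) (mh _)).
  by move=> k; apply: hN; exact: Nm.
(* Putting the value 0 on the exceptional set makes the sequence converge everywhere, so that its
   limit is measurable. *)
pose h' k x := h k x * (\1_(~` Z) x)%:C.
have mh' k : cmeas (h' k).
  by apply: cmeasM => //; apply/cmeas_real/measurable_indic/measurableC.
have h'd x : exists M : R, forall k, normc (h' k.+1 x - h' k x) <= M * 2^-1 ^+ k.
  have [Zx|Zx] := pselect (Z x).
    exists 0 => k; rewrite /h' indicE memNset ?mulr0 ?subrr ?normc0 ?mul0r//.
  have [M hM] : exists M : R, forall k, normc (h k.+1 x - h k x) <= M * 2^-1 ^+ k.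
    by apply: contrapT => /(sZ x).
  by exists M => k; rewrite /h' indicE mem_set// !mulr1.
have cR x : cvgn (fun k => complex.Re (h' k x)).
  have [M hM] := h'd x; apply: (@cvg_geometric_differences _ M) => k.
  by rewrite -ReN -ReD (le_trans (normr_Re_le _)).
have cI x : cvgn (fun k => complex.Im (h' k x)).
  have [M hM] := h'd x; apply: (@cvg_geometric_differences _ M) => k.
  by rewrite -ImN -ImD (le_trans (normr_Im_le _)).
pose g x := limn (fun k => complex.Re (h' k x)) +i* limn (fun k => complex.Im (h' k x)).
have mg : cmeas g.
  split.
  - apply: (measurable_fun_cvg (fun k => (mh' k).1)) => x _; exact: cR.
  - apply: (measurable_fun_cvg (fun k => (mh' k).2)) => x _; exact: cI.
have h'g x : normc (h' k x - g x) @[k --> \oo] --> (0 : R).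
  have : `|complex.Re (h' k x) - complex.Re (g x)| +
         `|complex.Im (h' k x) - complex.Im (g x)| @[k --> \oo] --> (0 + 0 : R).
    apply: cvgD.
    - by apply/norm_cvg0P; apply/subr_cvg0; exact: cR.
    - by apply/norm_cvg0P; apply/subr_cvg0; exact: cI.
  rewrite addr0; apply: (@squeeze_cvgr _ _ _ _ (fun=> 0)) => //.
    apply: nearW => k; rewrite normc_ge0/= (le_trans (normc_le_ReIm _))//.
    by rewrite ReD ImD ReN ImN.
  exact: cvg_cst.
have hg : {ae mu, forall x, normc (h k x - g x) @[k --> \oo] --> (0 : R)}.
  exists Z; split => // x; apply: contra_notP => Zx /=.
  rewrite (_ : (fun k => normc (h k x - g x)) = (fun k => normc (h' k x - g x))).
    exact: h'g.
  by apply/funext => k; rewrite /h' indicE mem_set// mulr1.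
have fg k i : (N k <= i)%N -> (sq2 (fun x => (f_ i x - g x)%R) <= (8^-1 ^+ k)%:E)%E.
  move=> Ni; rewrite sq2BC; apply: (sq2_fatou mh mg (mf i) hg).
  by exists k => // j /= kj; apply: hN => //; exact: Nm.
exists g; split.
  rewrite (_ : g = fun x => f_ (N 0%N) x - (f_ (N 0%N) x - g x)); last first.
    by apply/funext => x; ring.
  apply: inL2B => //; split; first exact: cmeasB.
  by rewrite (le_lt_trans (fg 0%N _ (leqnn _)))// ltry.
apply/fine_cvgP; split.
  exists (N 0%N) => // i /= Ni; rewrite ge0_fin_numE ?sq2_ge0//.
  by rewrite (le_lt_trans (fg 0%N _ Ni))// ltry.
apply/cvgrPdist_le => e e0.
have [k ke] : exists k, 8^-1 ^+ k <= e :> R.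
  have : (fun k => 8^-1 ^+ k : R) @ \oo --> (0 : R).
    by apply: cvg_expr; rewrite ger0_norm//; lra.
  move=> /cvgrPdist_le/(_ e e0)[k _ /(_ k (leqnn _))].
  by rewrite sub0r normrN ger0_norm ?exprn_ge0//; exists k.
exists (N k) => // i /= Ni; rewrite sub0r normrN ger0_norm ?fine_ge0 ?sq2_ge0//.
rewrite -lee_fin fineK; last first.
  by rewrite ge0_fin_numE ?sq2_ge0// (le_lt_trans (fg k _ Ni))// ltry.
by rewrite (le_trans (fg k _ Ni)).
Qed.

End square_integrable.

(** * Fubini's theorem for real and complex integrands *)

Section real_fubini.
Context d1 d2 (T1 : measurableType d1) (T2 : measurableType d2) (R : realType).
Context (m1 : {sigma_finite_measure set T1 -> \bar R})
  (m2 : {sigma_finite_measure set T2 -> \bar R}) (f : T1 * T2 -> R).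
Context (imf : (m1 \x m2)%E.-integrable setT (EFin \o f)).

Let F x := (\int[m2]_y (f (x, y))%:E)%E.
Let G y := (\int[m1]_x (f (x, y))%:E)%E.

Let iF : m1.-integrable setT F. Proof. exact: integrable_fubini_F imf. Qed.

Let iG : m2.-integrable setT G.
Proof.
have mf : measurable_fun setT (EFin \o f) := measurable_int _ imf.
apply/integrableP; split; first exact: measurable_fubini_G imf.
apply: le_lt_trans ((integrable21ltyP m1 m2 mf).1 imf).
apply: ge0_le_integral => //.
- by apply: measurableT_comp => //; exact: measurable_fubini_G imf.
- apply: (measurable_fun_fubini_tonelli_G (m1 := m1) (abse \o (EFin \o f))) => //.
    exact: measurableT_comp.
  by move=> x; exact: abse_ge0.
- move=> y _; apply: le_abse_integral => //.
  by apply: (measurableT_comp mf); exact: measurable_pair2.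
Qed.

Let mFfine : measurable_fun setT (fun x => \int[m2]_y f (x, y)).
Proof. by apply: measurableT_comp => //; exact: measurable_int iF. Qed.

Let mGfine : measurable_fun setT (fun y => \int[m1]_x f (x, y)).
Proof. by apply: measurableT_comp => //; exact: measurable_int iG. Qed.

(** The equality is only almost everywhere: an infinite inner integral is sent to 0 by [fine]. *)
Let FE : ae_eq m1 setT (fun x => (\int[m2]_y f (x, y))%:E) F.
Proof.
have := integrable_ae measurableT iF; apply: filterS => x /(_ Logic.I) fx _.
by rewrite /Rintegral fineK.
Qed.

Let GE : ae_eq m2 setT (fun y => (\int[m1]_x f (x, y))%:E) G.
Proof.
have := integrable_ae measurableT iG; apply: filterS => y /(_ Logic.I) fy _.
by rewrite /Rintegral fineK.
Qed.

Lemma integrable_Rfubini1 :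
  m1.-integrable setT (fun x => (\int[m2]_y f (x, y))%:E).
Proof.
apply/integrableP; split; first exact/measurable_EFinP.
have /integrableP[_] := iF; congr (_ < _)%E; apply: ae_eq_integral => //.
- by apply: measurableT_comp => //; exact: measurable_int iF.
- by apply: measurableT_comp => //; exact/measurable_EFinP.
- by apply: filterS FE => x h Tx; rewrite h.
Qed.

Lemma Rfubini1 :
  \int[m1]_x \int[m2]_y f (x, y) = fine (\int[(m1 \x m2)%E]_z (f z)%:E)%E.
Proof.
congr fine; rewrite -(integral12_prod_meas1 imf).
by apply: ae_eq_integral => //; [exact/measurable_EFinP|exact: measurable_int iF].
Qed.

Lemma Rfubini2 :
  \int[m2]_y \int[m1]_x f (x, y) = fine (\int[(m1 \x m2)%E]_z (f z)%:E)%E.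
Proof.
congr fine; rewrite -(integral21_prod_meas1 imf).
by apply: ae_eq_integral => //; [exact/measurable_EFinP|exact: measurable_int iG].
Qed.

End real_fubini.

Section complex_fubini.
Context d1 d2 (T1 : measurableType d1) (T2 : measurableType d2) (R : realType).
Context (m1 : {sigma_finite_measure set T1 -> \bar R})
  (m2 : {sigma_finite_measure set T2 -> \bar R}).
Implicit Types f : T1 * T2 -> R[i].

Lemma cintegrable_fubini f : cintegrable (m1 \x m2)%E f ->
  cintegrable m1 (fun x => cint m2 (fun y => f (x, y))).
Proof.
by move=> [f1 f2]; split; [exact: integrable_Rfubini1 f1|exact: integrable_Rfubini1 f2].
Qed.

Lemma cint_prod f : cintegrable (m1 \x m2)%E f ->
  cint m1 (fun x => cint m2 (fun y => f (x, y))) = cint (m1 \x m2)%E f.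
Proof.
by move=> [f1 f2]; apply: complex_eqP; [exact: Rfubini1 f1|exact: Rfubini1 f2].
Qed.

Lemma cfubini f : cintegrable (m1 \x m2)%E f ->
  cint m1 (fun x => cint m2 (fun y => f (x, y))) =
  cint m2 (fun y => cint m1 (fun x => f (x, y))).
Proof.
move=> fi; rewrite cint_prod//; case: fi => f1 f2.
by apply: complex_eqP; apply/esym; [exact: Rfubini2 f1|exact: Rfubini2 f2].
Qed.

Lemma cmeas_fst (u : T1 -> R[i]) : cmeas u -> cmeas (fun z : T1 * T2 => u z.1).
Proof. by move=> mu; exact: (cmeas_comp mu measurable_fst). Qed.

Lemma cmeas_snd (v : T2 -> R[i]) : cmeas v -> cmeas (fun z : T1 * T2 => v z.2).
Proof. by move=> mv; exact: (cmeas_comp mv measurable_snd). Qed.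

(** The shape of the applications of Fubini to the transform: [k] is a product of plane waves, and
    [u], [v] carry the integrability. *)
Lemma cintegrable_prodM (k : T1 * T2 -> R[i]) (u : T1 -> R[i]) (v : T2 -> R[i]) :
  cmeas k -> (forall z, normc (k z) <= 1) ->
  cintegrable m1 u -> cintegrable m2 v ->
  cintegrable (m1 \x m2)%E (fun z => k z * (u z.1 * v z.2)).
Proof.
move=> mk k1 iu iv.
have [mu mv] := (cintegrable_meas iu, cintegrable_meas iv).
have muv : cmeas (fun z : T1 * T2 => u z.1 * v z.2).
  by apply: cmeasM; [exact: cmeas_fst|exact: cmeas_snd].
have muv' : measurable_fun setT (fun z : T1 * T2 => normc (u z.1 * v z.2)).
  exact: measurable_normc.
apply: (@cintegrable_le _ _ _ _ _ (fun z => normc (u z.1 * v z.2))).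
- exact: cmeasM.
- by move=> z; rewrite normcM ler_piMl// normc_ge0.
- apply/integrable12ltyP; first exact/measurable_EFinP.
  rewrite (eq_integral (fun x => (\int[m2]_y (normc (v y))%:E) * (normc (u x))%:E)%E);
      last first.
    move=> x _; rewrite muleC -ge0_integralZl//.
    + by apply: eq_integral => y _ /=; rewrite normcM ger0_norm ?mulr_ge0 ?normc_ge0.
    + exact/measurable_EFinP/measurable_normc.
    + by move=> y _; rewrite lee_fin normc_ge0.
    + by rewrite lee_fin normc_ge0.
  rewrite ge0_integralZl//.
  + by rewrite lte_mul_pinfty ?cintegrable_normc_lty//; [apply: integral_ge0 => y _;
      rewrite lee_fin normc_ge0|rewrite ge0_fin_numE ?cintegrable_normc_lty//;
      apply: integral_ge0 => y _; rewrite lee_fin normc_ge0].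
  + exact/measurable_EFinP/measurable_normc.
  + by move=> x _; rewrite lee_fin normc_ge0.
  + by apply: integral_ge0 => y _; rewrite lee_fin normc_ge0.
Qed.

End complex_fubini.

(** * Integration over [R^n], one coordinate at a time *)

Section Rn_steps.
Context {R : realType}.

Lemma ge0_integral_Rn0 (f : Rn R 0 -> \bar R) : measurable_fun setT f ->
  (\int[@lebesgue_Rn R 0]_x f x = f [tuple])%E.
Proof. by move=> mf; rewrite integral_dirac// diracT mul1e. Qed.

Lemma ge0_integral_RnS n (f : Rn R n.+1 -> \bar R) :
  measurable_fun setT f -> (forall x, 0 <= f x)%E ->
  (\int[@lebesgue_Rn R n.+1]_x f x =
   \int[@lebesgue_measure R]_t \int[@lebesgue_Rn R n]_x f [tuple of t :: x])%E.
Proof.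
move=> mf f0.
rewrite -(@fubini_tonelli1 _ _ _ _ _ _ _ (f \o @tuple_consp R n))//.
- exact: (@ge0_integral_pushforward _ _ _ _ _ _ (@measurable_tuple_consp R n) _ setT f).
- by apply: measurableT_comp => //; exact: measurable_tuple_consp.
- by move=> x; exact: f0.
Qed.

Lemma cint_Rn0 (f : Rn R 0 -> R[i]) : cmeas f ->
  cintegrable (@lebesgue_Rn R 0) f /\ cint (@lebesgue_Rn R 0) f = f [tuple].
Proof.
move=> [f1 f2]; split.
  apply: cintegrableP => //; rewrite ge0_integral_Rn0 ?ltry//.
  by apply/measurable_EFinP/measurable_normc.
by apply: complex_eqP => /=; rewrite /Rintegral integral_dirac ?diracT ?mul1e//;
  exact/measurable_EFinP.
Qed.

Lemma integrable_RnS n (f : Rn R n.+1 -> \bar R) :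
  measurable_fun setT f ->
  (@lebesgue_measure R \x @lebesgue_Rn R n)%E.-integrable setT (f \o @tuple_consp R n) ->
  (@lebesgue_Rn R n.+1).-integrable setT f.
Proof.
move=> mf /integrableP[mf' fo]; apply/integrableP; split => //.
rewrite ge0_integral_RnS//; last exact: measurableT_comp.
move: fo; rewrite (@fubini_tonelli1 _ _ _ _ _ _ _ (abse \o (f \o @tuple_consp R n)))//.
- exact: measurableT_comp.
- by move=> x; exact: abse_ge0.
Qed.

Lemma integral_RnS n (f : Rn R n.+1 -> \bar R) :
  measurable_fun setT f ->
  (@lebesgue_measure R \x @lebesgue_Rn R n)%E.-integrable setT (f \o @tuple_consp R n) ->
  (\int[@lebesgue_Rn R n.+1]_x f x =
   \int[(@lebesgue_measure R \x @lebesgue_Rn R n)%E]_x f (tuple_consp x))%E.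
Proof.
move=> mf fi.
exact: (@integral_pushforward _ _ _ _ _ _ (@measurable_tuple_consp R n) _ setT f).
Qed.

Lemma cint_RnS n (f : Rn R n.+1 -> R[i]) : cmeas f ->
  cintegrable (@lebesgue_measure R \x @lebesgue_Rn R n)%E (f \o @tuple_consp R n) ->
  cintegrable (@lebesgue_Rn R n.+1) f /\
  cint (@lebesgue_Rn R n.+1) f =
    cint (@lebesgue_measure R) (fun t => cint (@lebesgue_Rn R n)
      (fun x => f [tuple of t :: x])).
Proof.
move=> [f1 f2] fi; split.
  by case: fi => fi1 fi2; split; apply: integrable_RnS => //; exact/measurable_EFinP.
rewrite -[LHS]/(cint _ f) (cint_prod fi); case: fi => fi1 fi2.
by apply: complex_eqP; congr fine; apply: integral_RnS => //; exact/measurable_EFinP.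
Qed.

Lemma measurable_prod_tnth n (g : 'I_n -> R -> R) :
  (forall i, measurable_fun setT (g i)) ->
  measurable_fun [set: Rn R n] (fun x => \prod_(i < n) g i (tnth x i)).
Proof.
move=> mg; apply: measurable_prod => i _.
by apply: (measurableT_comp (mg i)); exact: measurable_tnth.
Qed.

Lemma cmeas_prod_tnth n (h : 'I_n -> R -> R[i]) :
  (forall i, cmeas (h i : measurableTypeR R -> _)) ->
  cmeas (fun x : Rn R n => \prod_(i < n) h i (tnth x i)).
Proof.
move=> mh; elim: (index_enum 'I_n) => [|i s ih].
  by under eq_fun do rewrite big_nil; exact: cmeas_cst.
under eq_fun do rewrite big_cons; apply: cmeasM => //.
exact: (cmeas_comp (mh i) (measurable_tnth i)).
Qed.

Lemma cint_prod_tnth n (h : 'I_n -> R -> R[i]) :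
  (forall i, cintegrable (@lebesgue_measure R) (h i)) ->
  cintegrable (@lebesgue_Rn R n) (fun x => \prod_(i < n) h i (tnth x i)) /\
  cint (@lebesgue_Rn R n) (fun x => \prod_(i < n) h i (tnth x i)) =
  \prod_(i < n) cint (@lebesgue_measure R) (h i).
Proof.
elim: n h => [|n ih] h hi.
  have [|? ->] := @cint_Rn0 (fun x => \prod_(i < 0) h i (tnth x i)).
    by under eq_fun do rewrite big_ord0; exact: cmeas_cst.
  by rewrite !big_ord0.
have [ih1 ih2] := ih (fun i => h (lift ord0 i)) (fun i => hi _).
have E t (x : Rn R n) : \prod_(i < n.+1) h i (tnth [tuple of t :: x] i) =
    h ord0 t * \prod_(i < n) h (lift ord0 i) (tnth x i).
  rewrite big_ord_recl; congr (_ * _).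
  by apply: eq_bigr => i _; rewrite tnthS.
have [||? ->] := @cint_RnS n (fun x => \prod_(i < n.+1) h i (tnth x i)).
- by apply: cmeas_prod_tnth => i; exact: cintegrable_meas (hi i).
- have := @cintegrable_prodM _ _ _ _ _ (@lebesgue_measure R) (@lebesgue_Rn R n)
    (fun=> 1) _ _ (@cmeas_cst _ _ _ 1) _ (hi ord0) ih1.
  rewrite (_ : (fun z => _) =
      (fun x : Rn R n.+1 => \prod_(i < n.+1) h i (tnth x i)) \o @tuple_consp R n).
    by apply=> z; rewrite normc1.
  by apply/funext => -[t x]; rewrite mul1r /= -E.
split => //; rewrite big_ord_recl -ih2.
under [X in cint _ X]eq_fun do under eq_fun do rewrite E.
by under [X in cint _ X]eq_fun do rewrite cintZ//; rewrite cintZr.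
Qed.

End Rn_steps.

(** * The Poisson kernel *)

Section one_dimensional_kernels.
Context {R : realType}.
Local Notation leb := (@lebesgue_measure R).

Lemma is_derive_continuous (F f : R -> R) :
  (forall x : R, is_derive x (1 : R) F (f x)) -> continuous F.
Proof.
move=> dF x; apply: differentiable_continuous.
by apply/derivable1_diffP; apply: ex_derive.
Qed.

Lemma integral_is_derive (F f : R -> R) (a b : R) : a < b -> continuous f ->
  (forall x : R, is_derive x (1 : R) F (f x)) ->
  (\int[leb]_(x in `[a, b]) (f x)%:E = (F b - F a)%:E)%E.
Proof.
move=> ab cf dF; have cF := is_derive_continuous dF.
rewrite EFinB; apply: continuous_FTC2 => //.
- exact: continuous_subspaceT.
- split; first by move=> x _; apply: ex_derive.
  + by apply: cvg_at_right_filter; exact: cF.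
  + by apply: cvg_at_left_filter; exact: cF.
- by move=> x _; rewrite derive1E; apply: derive_val.
Qed.

Lemma integral_is_derivey (F f : R -> R) (a l : R) : continuous f ->
  (forall x, a <= x -> 0 <= f x) ->
  (forall x : R, is_derive x (1 : R) F (f x)) -> F x @[x --> +oo%R] --> l ->
  (\int[leb]_(x in `[a, +oo[) (f x)%:E = (l - F a)%:E)%E.
Proof.
move=> cf f0 dF Fl; have cF := is_derive_continuous dF.
rewrite EFinB; apply: ge0_continuous_FTC2y => //.
- exact: continuous_subspaceT.
- by apply: cvg_at_right_filter; exact: cF.
- by move=> x _; rewrite derive1E; apply: derive_val.
Qed.

(** The transform of [exp (-e |t|)] at frequency [z], by [cint_expabs]. With this normalization of
    the frequency its integral in [z] is 1. *)
Definition pois1 (e z : R) : R := 2 * e / (e ^+ 2 + (2 * pi * z) ^+ 2).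

Lemma pois1_den (e z : R) : 0 < e -> 0 < e ^+ 2 + (2 * pi * z) ^+ 2.
Proof. by move=> e0; rewrite ltr_pwDl ?exprn_gt0// sqr_ge0. Qed.

Lemma pois1_ge0 (e z : R) : 0 < e -> 0 <= pois1 e z.
Proof.
by move=> e0; rewrite divr_ge0 ?mulr_ge0 ?(ltW e0)//; exact: ltW (pois1_den z e0).
Qed.

Lemma pois1N (e z : R) : pois1 e (- z) = pois1 e z.
Proof. by rewrite /pois1 mulrN sqrrN. Qed.

Lemma is_derive_pois1 (e x t : R) : 0 < e ->
  is_derive t (1 : R) (fun t => pi^-1 * atan (2 * pi / e * (t - x))) (pois1 e (x - t)).
Proof.
move=> e0; have p0 : pi != 0 :> R by rewrite gt_eqF// pi_gt0.
have D := pois1_den (x - t) e0.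
apply: is_derive_eq.
rewrite /pois1 /GRing.scale /= -opprB mulrN sqrrN.
have D1 : 1 + (2 * pi / e * (x - t)) ^+ 2 != 0.
  by rewrite gt_eqF// ltr_pwDl// sqr_ge0.
move: p0 D1 D; generalize (pi : R) => p p0 D1 D; field.
by rewrite gt_eqF//= gt_eqF.
Qed.

Lemma continuous_pois1 (e x : R) : 0 < e -> continuous (fun t => pois1 e (x - t)).
Proof.
move=> e0 t; rewrite /pois1; apply: cvgM; first exact: cvg_cst.
apply: cvgV; first by rewrite gt_eqF// pois1_den.
apply: cvgD; first exact: cvg_cst.
apply: (@cvg_comp _ _ _ (fun t => 2 * pi * (x - t)) (fun t => t ^+ 2)); last exact: exprn_continuous.
by apply: cvgM; [exact: cvg_cst|apply: cvgB; [exact: cvg_cst|exact: cvg_id]].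
Qed.

Lemma integral_pois1_itv (e x a b : R) : 0 < e -> a < b ->
  (\int[leb]_(t in `[a, b]) (pois1 e (x - t))%:E =
   (pi^-1 * (atan (2 * pi / e * (b - x)) - atan (2 * pi / e * (a - x))))%:E)%E.
Proof.
move=> e0 ab; rewrite (integral_is_derive ab (@continuous_pois1 e x e0)
  (fun t => is_derive_pois1 x t e0)).
by rewrite -mulrBr.
Qed.

Lemma cvgy_scaled_atan (e x : R) : 0 < e ->
  pi^-1 * atan (2 * pi / e * (t - x)) @[t --> +oo%R] --> (2^-1 : R).
Proof.
move=> e0; have -> : 2^-1 = pi^-1 * (pi / 2) :> R.
  by rewrite mulKf// gt_eqF// pi_gt0.
apply: cvgM; first exact: cvg_cst.
apply: (@cvg_comp _ _ _ (fun t : R => 2 * pi / e * (t - x)) atan); last exact: cvgy_atan.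
apply: gt0_cvgMry; first by rewrite divr_gt0// mulr_gt0// pi_gt0.
exact: cvg_addrr.
Qed.

Lemma integral_pois1_shifty (e x : R) : 0 < e ->
  (\int[leb]_(t in `[x, +oo[) (pois1 e (x - t))%:E = (2^-1)%:E)%E.
Proof.
move=> e0; rewrite (integral_is_derivey (@continuous_pois1 e x e0)
  (fun t _ => pois1_ge0 (x - t) e0) (fun t => is_derive_pois1 x t e0)
  (cvgy_scaled_atan x e0)).
by rewrite subrr mulr0 atan0 mulr0 subr0.
Qed.

Lemma measurable_pois1 (e x : R) : 0 < e -> measurable_fun [set: measurableTypeR R] (fun t => pois1 e (x - t)).
Proof. by move=> e0; exact: continuous_measurable_fun (@continuous_pois1 e x e0). Qed.

Lemma integral_pois1 (e x : R) : 0 < e ->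
  (\int[leb]_t (pois1 e (x - t))%:E = 1)%E.
Proof.
move=> e0; have mp := measurable_pois1 x e0.
rewrite -(setUv `[x, +oo[%classic) ge0_integral_setU//=; last 4 first.
- exact: measurableC.
- by apply/measurable_EFinP/measurable_funTS.
- by move=> t _; rewrite lee_fin pois1_ge0.
- exact/disj_setPCl.
rewrite setCitvr integral_pois1_shifty// integral_itv_bndo_bndc; last first.
  exact/measurable_EFinP/measurable_funTS.
rewrite -{1}(opprK x) ge0_integration_by_substitutionNy//; last 2 first.
- exact/continuous_subspaceT/continuous_pois1.
- by move=> t _; exact: pois1_ge0.
have -> : (fun t : R => pois1 e (x - t)) \o -%R = (fun t : R => pois1 e (- x - t)).
  by apply/funext => t /=; rewrite -pois1N; congr pois1; ring.
by rewrite integral_pois1_shifty// -EFinD; congr EFin; lra.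
Qed.

(** The summand 1 next to the cosine makes the integrand nonnegative, as the fundamental theorem on
    a half-line demands. [Rintegral_expabs_cos] subtracts it again. *)
Lemma is_derive_laplace (e a t : R) : 0 < e ->
  is_derive t (1 : R) (fun t => expR (- e * t) *
      (- e^-1 + (a * sin (a * t) - e * cos (a * t)) / (e ^+ 2 + a ^+ 2)))
    (expR (- e * t) * (1 + cos (a * t))).
Proof.
move=> e0; have D : e ^+ 2 + a ^+ 2 != 0.
  by rewrite gt_eqF// ltr_pwDl ?exprn_gt0// sqr_ge0.
apply: is_derive_eq.
by rewrite /GRing.scale /=; field; rewrite D gt_eqF.
Qed.

Definition laplace1 (e a t : R) : R := expR (- e * t) * (1 + cos (a * t)).

Lemma laplace1_ge0 e a t : 0 <= laplace1 e a t.
Proof.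
rewrite mulr_ge0 ?expR_ge0//; have := cos_geN1 (a * t); lra.
Qed.

Lemma continuous_laplace1 (e a : R) : continuous (laplace1 e a).
Proof.
move=> t; apply: cvgM.
  apply: (@cvg_comp _ _ _ (fun t : R => - e * t) expR); last exact: continuous_expR.
  by apply: cvgM; [exact: cvg_cst|exact: cvg_id].
apply: cvgD; first exact: cvg_cst.
apply: (@cvg_comp _ _ _ (fun t : R => a * t) cos); last exact: continuous_cos.
by apply: cvgM; [exact: cvg_cst|exact: cvg_id].
Qed.

Lemma cvgy_expNM (e : R) : 0 < e -> expR (- e * t) @[t --> +oo%R] --> (0 : R).
Proof.
move=> e0; rewrite (_ : (fun t => _) = (fun t => expR (- t)) \o (fun t => e * t)).
  by apply: cvg_comp (@cvgr_expR R); apply: gt0_cvgMry.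
by apply/funext => t /=; rewrite mulNr.
Qed.

Lemma integral_laplace1_itvy (e a : R) : 0 < e ->
  (\int[leb]_(t in `[0%R, +oo[) (laplace1 e a t)%:E =
   (e^-1 + e / (e ^+ 2 + a ^+ 2))%:E)%E.
Proof.
move=> e0; rewrite (integral_is_derivey (@continuous_laplace1 e a)
  (fun t _ => laplace1_ge0 e a t) (fun t => is_derive_laplace a t e0) (l := 0)).
  by rewrite !mulr0 expR0 sin0 cos0 mulr0 mulr1 !mul1r; congr EFin; ring.
pose M := e^-1 + (`|a| + e) / (e ^+ 2 + a ^+ 2).
apply/norm_cvg0P.
apply: (@squeeze_cvgr _ _ _ _ (fun=> 0) (fun t => expR (- e * t) * M)).
- apply: nearW => t; rewrite normr_ge0 /= normrM ger0_norm ?expR_ge0//.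
  rewrite ler_wpM2l ?expR_ge0//; apply: le_trans (ler_normD _ _) _.
  rewrite /M normrN normfV gtr0_norm// lerD2l normrM normfV.
  have D : 0 < e ^+ 2 + a ^+ 2 by rewrite ltr_pwDl ?exprn_gt0// sqr_ge0.
  rewrite (gtr0_norm D) ler_pM2r ?invr_gt0//.
  apply: le_trans (ler_normB _ _) _; rewrite !normrM (gtr0_norm e0).
  apply: lerD; first by rewrite ler_piMr// ler_norml sin_geN1 sin_le1.
  by rewrite ler_piMr ?(ltW e0)// ler_norml cos_geN1 cos_le1.
- exact: cvg_cst.
- by rewrite -[X in _ --> X](mul0r M); apply: cvgM; [exact: cvgy_expNM|exact: cvg_cst].
Qed.

Lemma integral_laplace1_norm (e a : R) : 0 < e ->
  (\int[leb]_t (laplace1 e a `|t|)%:E = (2 * (e^-1 + e / (e ^+ 2 + a ^+ 2)))%:E)%E.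
Proof.
move=> e0; rewrite (@ge0_symfun_integralT _ (fun t => laplace1 e a `|t|)).
- rewrite -set_itvcy EFinM -(integral_laplace1_itvy a e0); congr (_ * _)%E.
  by apply: eq_integral => t; rewrite inE/= in_itv/= andbT => t0; rewrite ger0_norm.
- by move=> t; exact: laplace1_ge0.
- move=> t; apply: (@cvg_comp _ _ _ (fun t : R => `|t|) (laplace1 e a)).
    by apply: cvg_norm; exact: cvg_id.
  exact: continuous_laplace1.
- by move=> t /=; rewrite normrN.
Qed.

Definition expabs (e t : R) : R := expR (- e * `|t|).

Lemma expabs_ge0 e t : 0 <= expabs e t. Proof. exact: expR_ge0. Qed.

Lemma measurable_expabs e : measurable_fun [set: measurableTypeR R] (expabs e).
Proof.
apply: continuous_measurable_fun => t.
apply: (@cvg_comp _ _ _ (fun t : R => - e * `|t|) expR); last exact: continuous_expR.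
by apply: cvgM; [exact: cvg_cst|apply: cvg_norm; exact: cvg_id].
Qed.

Lemma integral_expabs (e : R) : 0 < e ->
  (\int[leb]_t (expabs e t)%:E = (2 / e)%:E)%E.
Proof.
move=> e0; have h := integral_laplace1_norm 0 e0.
have : (\int[leb]_t (2%:E * (expabs e t)%:E) = 2%:E * (2 / e)%:E)%E.
  transitivity (\int[leb]_t (laplace1 e 0 `|t|)%:E)%E.
    by apply: eq_integral => t _; rewrite /laplace1 mul0r cos0 -EFinM /expabs; congr EFin; ring.
  rewrite h -EFinM; congr EFin; field.
  by rewrite gt_eqF.
rewrite ge0_integralZl//; last 2 first.
- by apply/measurable_EFinP; exact: (measurable_expabs e).
- by move=> t _; rewrite lee_fin expabs_ge0.
move=> /(congr1 (fun y => (2^-1)%:E * y)%E); rewrite !muleA -EFinM mulVf ?mul1e//.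
Qed.

Lemma integrable_expabs (e : R) : 0 < e -> leb.-integrable setT (EFin \o expabs e).
Proof.
move=> e0; apply/integrableP; split; first by apply/measurable_EFinP; exact: (measurable_expabs e).
under eq_integral do rewrite /= ger0_norm ?expabs_ge0//.
by rewrite integral_expabs// ltry.
Qed.

Lemma measurable_cosM (a : R) : measurable_fun [set: measurableTypeR R] (fun t => cos (a * t)).
Proof.
apply: continuous_measurable_fun => t.
apply: (@cvg_comp _ _ _ (fun t : R => a * t) cos); last exact: continuous_cos.
by apply: cvgM; [exact: cvg_cst|exact: cvg_id].
Qed.

Lemma measurable_sinM (a : R) : measurable_fun [set: measurableTypeR R] (fun t => sin (a * t)).
Proof.
apply: continuous_measurable_fun => t.
apply: (@cvg_comp _ _ _ (fun t : R => a * t) sin); last exact: continuous_sin.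
by apply: cvgM; [exact: cvg_cst|exact: cvg_id].
Qed.

Lemma integrable_expabs_cos (e a : R) : 0 < e ->
  leb.-integrable setT (EFin \o (fun t => expabs e t * cos (a * t))).
Proof.
move=> e0; apply: le_integrable (integrable_expabs e0) => //.
  apply/measurable_EFinP/measurable_funM; first exact: measurable_expabs.
  exact: measurable_cosM.
move=> t _ /=; rewrite lee_fin normrM ler_piMr// ler_norml.
by rewrite cos_geN1 cos_le1.
Qed.

Lemma integrable_expabs_sin (e a : R) : 0 < e ->
  leb.-integrable setT (EFin \o (fun t => expabs e t * sin (a * t))).
Proof.
move=> e0; apply: le_integrable (integrable_expabs e0) => //.
  apply/measurable_EFinP/measurable_funM; first exact: measurable_expabs.
  exact: measurable_sinM.
move=> t _ /=; rewrite lee_fin normrM ler_piMr// ler_norml.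
by rewrite sin_geN1 sin_le1.
Qed.

Lemma cos_normM (a t : R) : cos (a * `|t|) = cos (a * t).
Proof. by have [t0|t0] := leP 0 t; [rewrite ger0_norm|rewrite ltr0_norm// mulrN cosN]. Qed.

Lemma Rintegral_expabs_cos (e a : R) : 0 < e ->
  \int[leb]_t (expabs e t * cos (a * t)) = 2 * e / (e ^+ 2 + a ^+ 2).
Proof.
move=> e0.
have h : \int[leb]_t (expabs e t + expabs e t * cos (a * t)) =
    2 * (e^-1 + e / (e ^+ 2 + a ^+ 2)).
  rewrite /Rintegral (eq_integral (fun t : measurableTypeR R => (laplace1 e a `|t : R|)%:E)).
    by rewrite integral_laplace1_norm.
  move=> t _; rewrite /laplace1 mulrDr mulr1 /expabs; congr (_ + _ * _)%:E.
  exact/esym/cos_normM.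
move: h; rewrite RintegralD//; last 2 first.
- exact: integrable_expabs.
- exact: integrable_expabs_cos.
rewrite {1}/Rintegral integral_expabs//= mulrDr mulrA.
by move=> /addrI.
Qed.

Lemma integral_lebN (f : R -> \bar R) : measurable_fun [set: measurableTypeR R] f ->
  leb.-integrable setT (fun t => f (- t)) ->
  (\int[leb]_t f (- t)%R = \int[leb]_t f t)%E.
Proof.
move=> mf fi.
have mN : measurable_fun [set: measurableTypeR R] (-%R : _ -> measurableTypeR R).
  exact: oppr_measurable.
rewrite -[LHS](@integral_pushforward _ _ (measurableTypeR R) _ _ _ mN leb setT f)//.
by apply: eq_measure_integral => A mA _; exact: lebesgue_measureN.
Qed.

Lemma Rintegral_expabs_sin (e a : R) : 0 < e ->
  \int[leb]_t (expabs e t * sin (a * t)) = 0.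
Proof.
move=> e0; pose f t := (expabs e t * sin (a * t))%:E.
have fN t : f (- t) = (- 1 * (expabs e t * sin (a * t)))%:E.
  by rewrite /f /expabs normrN mulrN sinN mulrN mulN1r.
have : \int[leb]_t (- 1 * (expabs e t * sin (a * t))) =
       \int[leb]_t (expabs e t * sin (a * t)).
  congr fine; rewrite -[RHS](@integral_lebN f).
  - by apply: eq_integral => t _; rewrite fN.
  - exact: measurable_int (integrable_expabs_sin a e0).
  - by apply: eq_integrable (integrableZl measurableT (- 1) (integrable_expabs_sin a e0)) => // t _;
      rewrite fN.
rewrite RintegralZl//; last exact: integrable_expabs_sin.
lra.
Qed.

Lemma cint_expabs (e a : R) : 0 < e ->
  cintegrable leb (fun t => (expabs e t)%:C * expNi (a * t)) /\
  cint leb (fun t => (expabs e t)%:C * expNi (a * t)) =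
  (2 * e / (e ^+ 2 + a ^+ 2))%:C.
Proof.
move=> e0.
have -> : (fun t => (expabs e t)%:C * expNi (a * t)) =
    (fun t => (expabs e t * cos (a * t)) -i* (expabs e t * sin (a * t))).
  by apply/funext => t; apply: complex_eqP; rewrite /= ?ReM ?ImM /= ?mul0r ?subr0 ?addr0 ?mulrN.
split.
  split; first exact: integrable_expabs_cos.
  apply: eq_integrable (integrableN (integrable_expabs_sin a e0)) => //.
apply: complex_eqP => /=; first exact: Rintegral_expabs_cos.
under eq_Rintegral do rewrite -mulN1r.
rewrite RintegralZl//; last exact: integrable_expabs_sin.
by rewrite Rintegral_expabs_sin// mulr0.
Qed.

End one_dimensional_kernels.

Section expNi_theory.
Context {R : realType}.
Implicit Types a b t : R.

Lemma expNiD a b : expNi (a + b) = expNi a * expNi b :> R[i].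
Proof.
apply: complex_eqP; rewrite ?ReM ?ImM /= ?cosD ?sinD; ring.
Qed.

Lemma expNi0 : expNi 0 = 1 :> R[i].
Proof. by apply: complex_eqP; rewrite /= ?cos0 ?sin0 ?oppr0. Qed.

Lemma expNiN t : expNi (- t) = (expNi t)^* :> R[i].
Proof. by apply: complex_eqP; rewrite /= ?cosN ?sinN. Qed.

Lemma normc_expNi t : normc (expNi t : R[i]) = 1.
Proof. by rewrite /= sqrrN cos2Dsin2 sqrtr1. Qed.

Lemma expNi_sum n (F : 'I_n -> R) :
  expNi (\sum_(i < n) F i) = \prod_(i < n) expNi (F i) :> R[i].
Proof.
elim: (index_enum 'I_n) => [|i s ih]; first by rewrite !big_nil expNi0.
by rewrite !big_cons expNiD ih.
Qed.

Lemma cmeas_expNi d (T : measurableType d) (g : T -> R) :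
  measurable_fun setT g -> cmeas (fun x => expNi (g x) : R[i]).
Proof.
move=> mg; split.
  exact: (measurableT_comp (continuous_measurable_fun (@continuous_cos R)) mg).
apply: measurable_funN.
exact: (measurableT_comp (continuous_measurable_fun (@continuous_sin R)) mg).
Qed.

End expNi_theory.

Arguments normc : simpl never.
Arguments conjc : simpl never.
Arguments expNi : simpl never.
Arguments fourier1 : simpl never.

Section poisson_kernel.
Context {R : realType} {n : nat}.
Local Notation X := (Rn R n).
Local Notation mu := (@lebesgue_Rn R n).
Implicit Types (x y xi : X) (f g u : X -> R[i]) (e : R).

Lemma dotC x xi : dot x xi = dot xi x.
Proof. by apply: eq_bigr => i _; rewrite mulrC. Qed.

Lemma measurable_dot :
  measurable_fun setT (fun z : X * X => dot z.1 z.2).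
Proof.
apply: measurable_sum => i; apply: measurable_funM.
  exact: (measurableT_comp (measurable_tnth i) measurable_fst).
exact: (measurableT_comp (measurable_tnth i) measurable_snd).
Qed.

Lemma measurable_dotr x : measurable_fun setT (dot x : X -> R).
Proof.
apply: measurable_sum => i; apply: measurable_funM; first exact: measurable_cst.
exact: measurable_tnth.
Qed.

Lemma measurable_enorm : measurable_fun setT (@enorm R n).
Proof.
apply: (measurableT_comp (continuous_measurable_fun (@sqrt_continuous R))).
by apply: measurable_sum => i; apply: measurable_funM; exact: measurable_tnth.
Qed.

Definition wave x xi : R[i] := expNi (2 * pi * dot x xi).

Lemma normc_wave x xi : normc (wave x xi) = 1.
Proof. exact: normc_expNi. Qed.

Lemma cmeas_wave2 : cmeas (fun z : X * X => wave z.1 z.2).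
Proof.
apply: cmeas_expNi; apply: measurable_funM; first exact: measurable_cst.
exact: measurable_dot.
Qed.

Lemma cmeas_waver x : cmeas (wave x).
Proof.
apply: cmeas_expNi; apply: measurable_funM; first exact: measurable_cst.
exact: measurable_dotr.
Qed.

Lemma waveC x xi : wave x xi = wave xi x.
Proof. by rewrite /wave dotC. Qed.

Lemma cmeas_wavel xi : cmeas (wave ^~ xi).
Proof. by under eq_fun do rewrite waveC; exact: cmeas_waver. Qed.

Lemma fourier1E f xi : fourier1 f xi = cint mu (fun x => f x * wave x xi).
Proof. by []. Qed.

(** The Abel weight [exp (-e |xi|_1)]. Unlike the Euclidean norm, the [l^1] norm makes the weight
    and its transform factor over the coordinates. *)
Definition gam e xi : R := \prod_(i < n) expabs e (tnth xi i).

Definition pois e x y : R := \prod_(i < n) pois1 e (tnth x i - tnth y i).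

Lemma gamE e xi : gam e xi = expR (- e * \sum_(i < n) `|tnth xi i : R|).
Proof. by rewrite mulr_sumr expR_sum. Qed.

Lemma gam_gt0 e xi : 0 < gam e xi. Proof. by rewrite gamE expR_gt0. Qed.

Lemma gam_le1 e xi : 0 < e -> gam e xi <= 1.
Proof.
move=> e0; rewrite gamE -expR0 ler_expR mulNr oppr_le0 mulr_ge0 ?(ltW e0)//.
exact: sumr_ge0.
Qed.

Lemma measurable_gam e : measurable_fun setT (gam e).
Proof. exact: (measurable_prod_tnth (fun=> measurable_expabs e)). Qed.

Lemma pois_ge0 e x y : 0 < e -> 0 <= pois e x y.
Proof. by move=> e0; apply: prodr_ge0 => i _; exact: pois1_ge0. Qed.

Lemma poisC e x y : pois e x y = pois e y x.
Proof. by apply: eq_bigr => i _; rewrite -pois1N opprB. Qed.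

Lemma cint_gam e : 0 < e ->
  cintegrable mu (fun xi => (gam e xi)%:C) /\
  forall x y, cint mu (fun xi => (gam e xi)%:C * (wave x xi * (wave y xi)^*)) =
    (pois e x y)%:C.
Proof.
move=> e0.
have wE x y xi : (gam e xi)%:C * (wave x xi * (wave y xi)^*) =
  \prod_(i < n) ((expabs e (tnth xi i))%:C *
     expNi ((2 * pi * (tnth x i - tnth y i)) * tnth xi i)).
  rewrite big_split -(expNi_sum (fun i => 2 * pi * (tnth x i - tnth y i) * tnth xi i)) /gam (rmorph_prod (real_complex R)); congr (_ * _).
  rewrite /wave -expNiN -expNiD; congr expNi.
  rewrite -mulrN -mulrDr -sumrB mulr_sumr; apply: eq_bigr => i _.
  by rewrite mulrBr; ring.
have h (x y : X) (i : 'I_n) := cint_expabs (2 * pi * (tnth x i - tnth y i)) e0.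
split.
  have := (cint_prod_tnth (fun i => (h (@origin R n) (@origin R n) i).1)).1.
  rewrite (_ : (fun x => _) = fun xi => (gam e xi)%:C)//; apply/funext => xi.
  by rewrite -wE mulc_conj normc_wave expr1n mulr1.
move=> x y; have := (cint_prod_tnth (fun i => (h x y i).1)).2.
under eq_fun do rewrite -wE; move=> ->.
rewrite /pois (rmorph_prod (real_complex R)); apply: eq_bigr => i _.
by rewrite (h x y i).2.
Qed.

Lemma measurable_pois2 e : 0 < e ->
  measurable_fun setT (fun z : X * X => pois e z.1 z.2).
Proof.
move=> e0; apply: measurable_prod => i _.
have mp : measurable_fun [set: measurableTypeR R] (pois1 e).
  by have := measurable_pois1 0 e0; under eq_fun do rewrite sub0r pois1N.
apply: (measurableT_comp mp); apply: measurable_funB.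
  exact: (measurableT_comp (measurable_tnth i) measurable_fst).
exact: (measurableT_comp (measurable_tnth i) measurable_snd).
Qed.

Lemma measurable_poisr e x : 0 < e -> measurable_fun setT (pois e x).
Proof.
move=> e0.
exact: (measurable_prod_tnth (fun i => measurable_pois1 (tnth x i) e0)).
Qed.

Lemma measurable_poisl e y : 0 < e -> measurable_fun setT (pois e ^~ y).
Proof.
by move=> e0; under eq_fun do rewrite poisC; exact: measurable_poisr.
Qed.

Lemma integral_pois e x : 0 < e -> (\int[mu]_y (pois e x y)%:E = 1)%E.
Proof.
move=> e0.
have h (i : 'I_n) : cintegrable (@lebesgue_measure R)
    (fun t : R => (pois1 e (tnth x i - t))%:C).
  apply: cintegrable_real; apply/integrableP; split.
    by apply/measurable_EFinP; exact: (measurable_pois1 (tnth x i) e0).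
  under eq_integral do rewrite /= ger0_norm ?pois1_ge0//.
  by rewrite integral_pois1// ltry.
have [h1 h2] := cint_prod_tnth h.
have E : (fun y : X => \prod_(i < n) (pois1 e (tnth x i - tnth y i))%:C) =
    (fun y : X => (pois e x y)%:C).
  by apply/funext => y; rewrite /pois (rmorph_prod (real_complex R)).
rewrite E in h1 h2; rewrite cint_real in h2.
have fp : (\int[mu]_y (pois e x y)%:E \is a fin_num)%E.
  by apply: integrable_fin_num => //; case: h1.
rewrite -(fineK fp); congr EFin; apply: (@complexI R).
rewrite -[fine _]/(Rintegral _ _ _) h2 big1// => i _.
by rewrite cint_real /Rintegral integral_pois1.
Qed.

Lemma integral_poisl e y : 0 < e -> (\int[mu]_x (pois e x y)%:E = 1)%E.
Proof. by move=> e0; under eq_integral do rewrite poisC; exact: integral_pois. Qed.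

End poisson_kernel.

(** * The Fourier transform *)

Section fourier_L1.
Context {R : realType} {n : nat}.
Local Notation X := (Rn R n).
Local Notation mu := (@lebesgue_Rn R n).
Implicit Types (x y xi : X) (f g u : X -> R[i]) (e : R).

Lemma cintegrable_waveM u xi : cintegrable mu u -> cintegrable mu (fun x => u x * wave x xi).
Proof.
move=> iu; apply: cintegrable_le (integrable_normc iu).
- exact: cmeasM (cintegrable_meas iu) (cmeas_wavel xi).
- by move=> x; rewrite normcM normc_wave mulr1.
Qed.

Lemma normc_fourier1_le u xi : cintegrable mu u ->
  normc (fourier1 u xi) <= \int[mu]_x normc (u x).
Proof.
move=> iu; rewrite fourier1E (le_trans (normc_cint_le (cintegrable_waveM xi iu)))//.
by rewrite le_eqVlt; apply/orP; left; apply/eqP; apply: eq_Rintegral => x _;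
  rewrite normcM normc_wave mulr1.
Qed.

(** Fubini yields measurability of an inner integral only when the integrand is integrable on the
    product. The weight [gam 1] provides this, and being positive it can be divided out
    afterwards. *)
Lemma cmeas_fourier1 u : cintegrable mu u -> cmeas (fourier1 u).
Proof.
move=> iu; have [ig _] := @cint_gam R n 1 ltr01.
have h := @cintegrable_prodM _ _ _ _ _ mu mu (fun z : X * X => wave z.2 z.1) _ _ _ _ ig iu.
have k1 : cmeas (fun z : X * X => wave z.2 z.1).
  by under eq_fun do rewrite waveC; exact: cmeas_wave2.
have := cintegrable_meas (cintegrable_fubini (h k1 _)).
have -> : (fun xi => cint mu (fun x => wave x xi * ((gam 1 xi)%:C * u x))) =
    (fun xi => (gam 1 xi)%:C * fourier1 u xi).
  apply/funext => xi; rewrite fourier1E -cintZ; last exact: cintegrable_waveM.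
  by congr cint; apply/funext => x; ring.
move=> mg; have -> : fourier1 u =
    (fun xi => ((gam 1 xi)^-1)%:C * ((gam 1 xi)%:C * fourier1 u xi)).
  by apply/funext => xi; rewrite mulrA -realcM mulVf ?mul1r// gt_eqF// gam_gt0.
apply: cmeasM; last by apply: mg => z; rewrite normc_wave.
apply: cmeas_real; have -> : (fun xi => (gam 1 xi)^-1) = (@gam R n (-1)).
  by apply/funext => xi; rewrite !gamE -expRN; congr expR; ring.
exact: measurable_gam.
Qed.

Lemma cintegrable_gamM e u : 0 < e -> cintegrable mu u ->
  cintegrable mu (fun xi => (gam e xi)%:C * fourier1 u xi).
Proof.
move=> e0 iu; have [ig _] := @cint_gam R n e e0.
apply: (@cintegrable_le _ _ _ _ _ (fun xi => gam e xi * \int[mu]_x normc (u x))).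
- apply: cmeasM; last exact: cmeas_fourier1.
  exact: (cmeas_real (measurable_gam e)).
- move=> xi; rewrite normcM normc_real gtr0_norm ?gam_gt0//.
  by rewrite ler_wpM2l ?normc_fourier1_le// ltW// gam_gt0.
- by have [h _] := cintegrableZr (\int[mu]_x normc (u x))%:C ig;
    apply: eq_integrable h => // xi _; rewrite /= mulr0 subr0.
Qed.

Lemma pois_le e x y : 0 < e -> pois e x y <= (2 / e) ^+ n.
Proof.
move=> e0; rewrite -[X in _ ^+ X](card_ord n) -prodr_const; apply: ler_prod => i _.
rewrite pois1_ge0//= /pois1 ler_pdivrMr ?pois1_den// mulrDr.
have -> : 2 / e * e ^+ 2 = 2 * e by field; rewrite gt_eqF.
by rewrite lerDl mulr_ge0 ?sqr_ge0// divr_ge0// ltW.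
Qed.

Lemma cintegrable_poisM e u y : 0 < e -> cintegrable mu u ->
  cintegrable mu (fun x => u x * (pois e x y)%:C).
Proof.
move=> e0 iu; have [h _] := cintegrableZ ((2 / e) ^+ n)%:C
  (cintegrable_real (integrable_normc iu)).
apply: (@cintegrable_le _ _ _ _ _ (fun x => (2 / e) ^+ n * normc (u x))).
- exact: cmeasM (cintegrable_meas iu) (cmeas_real (measurable_poisl y e0)).
- move=> x; rewrite normcM normc_real ger0_norm ?pois_ge0// mulrC.
  by rewrite ler_wpM2r ?normc_ge0// pois_le.
- by apply: eq_integrable h => // x _; rewrite /= mul0r subr0.
Qed.

(** Abel summation of the inversion integral: exchanging the integrals turns it into the convolution
    of [u] with the Poisson kernel. *)
Lemma fourier1_gam_inv e u y : 0 < e -> cintegrable mu u ->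
  cint mu (fun xi => (gam e xi)%:C * fourier1 u xi * (wave y xi)^*) =
  cint mu (fun x => u x * (pois e x y)%:C).
Proof.
move=> e0 iu; have [ig gE] := @cint_gam R n e e0.
pose k (z : X * X) := wave z.2 z.1 * (wave y z.1)^*.
have mk : cmeas k.
  apply: cmeasM; first by under eq_fun do rewrite waveC; exact: cmeas_wave2.
  exact: (cmeas_comp (cmeasJ (cmeas_waver y)) measurable_fst).
have k1 z : normc (k z) <= 1 by rewrite normcM normc_conj !normc_wave mulr1.
have iF := cintegrable_prodM mk k1 ig iu.
transitivity (cint mu (fun xi => cint mu (fun x => k (xi, x) * ((gam e xi)%:C * u x)))).
  congr cint; apply/funext => xi; rewrite fourier1E.
  rewrite mulrAC -cintZ; last exact: cintegrable_waveM.
  by congr cint; apply/funext => x; rewrite /k /=; ring.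
rewrite (cfubini iF) /=; congr cint; apply/funext => x.
rewrite -gE -cintZ.
  by congr cint; apply/funext => xi; rewrite /k /=; ring.
apply: cintegrable_le (integrable_normc ig).
  apply: cmeasM; first exact: (cmeas_real (measurable_gam e)).
  by apply: cmeasM; [exact: cmeas_waver|apply/cmeasJ/cmeas_waver].
by move=> xi; rewrite !normcM normc_conj !normc_wave !mulr1.
Qed.

Lemma measurable_pois_conv e u : 0 < e -> cmeas u -> measurable_fun setT
  (fun y => (normc (u y))%:E * \int[mu]_x (normc (u x) * pois e x y)%:E)%E.
Proof.
move=> e0 /measurable_normc mu_.
have p0 x y : 0 <= normc (u x) * pois e x y by rewrite mulr_ge0 ?normc_ge0 ?pois_ge0.
have mx y : measurable_fun setT (fun x => (normc (u x) * pois e x y)%:E).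
  by apply/measurable_EFinP/measurable_funM => //; exact: measurable_poisl.
rewrite (_ : (fun y => _) = (fun y => \int[mu]_x
    (normc (u y) * (normc (u x) * pois e x y))%:E)%E).
  apply: (measurable_fun_fubini_tonelli_G (m1 := mu)
    (fun z : X * X => (normc (u z.2) * (normc (u z.1) * pois e z.1 z.2))%:E)) => [|z].
    apply/measurable_EFinP/measurable_funM.
      exact: (measurableT_comp mu_ measurable_snd).
    apply: measurable_funM; last exact: measurable_pois2.
    exact: (measurableT_comp mu_ measurable_fst).
  by rewrite lee_fin mulr_ge0 ?normc_ge0.
apply/funext => y; rewrite -ge0_integralZl// ?lee_fin ?normc_ge0//.
by move=> x _; rewrite lee_fin.
Qed.

(* Young's inequality for the convolution with a kernel of total mass one. *)
Lemma young_pois e u : 0 < e -> cmeas u ->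
  (\int[mu]_y ((normc (u y))%:E * \int[mu]_x (normc (u x) * pois e x y)%:E) <=
   sq2 mu u)%E.
Proof.
move=> e0 mcu; have mnu := measurable_normc mcu.
have mx y : measurable_fun setT (fun x => (normc (u x) * pois e x y)%:E).
  by apply/measurable_EFinP/measurable_funM => //; exact: measurable_poisl.
have nu0 y : (0 <= (normc (u y))%:E)%E by rewrite lee_fin normc_ge0.
have p0 x y := @pois_ge0 R n e x y e0.
(* By [2ab <= a^2 + b^2] the integrand is at most [F + G]. Integrating first the variable that is
   absent from the square uses up the mass of the kernel and leaves half of [sq2 mu u] for each. *)
pose F (z : X * X) := (2^-1 * normc (u z.1) ^+ 2 * pois e z.1 z.2)%:E.
pose G (z : X * X) := (2^-1 * normc (u z.2) ^+ 2 * pois e z.1 z.2)%:E.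
have mF : measurable_fun setT F.
  apply/measurable_EFinP/measurable_funM; last exact: measurable_pois2.
  apply: measurable_funM; first exact: measurable_cst.
  exact: (measurableT_comp (measurable_sqr_normc mcu) measurable_fst).
have mG : measurable_fun setT G.
  apply/measurable_EFinP/measurable_funM; last exact: measurable_pois2.
  apply: measurable_funM; first exact: measurable_cst.
  exact: (measurableT_comp (measurable_sqr_normc mcu) measurable_snd).
have F0 z : (0 <= F z)%E by rewrite lee_fin mulr_ge0// mulr_ge0// sqr_ge0.
have G0 z : (0 <= G z)%E by rewrite lee_fin mulr_ge0// mulr_ge0// sqr_ge0.
have mFy y : measurable_fun setT (fun x => F (x, y)).
  by apply: (measurableT_comp mF); exact: measurable_pair2.
have mGy y : measurable_fun setT (fun x => G (x, y)).
  by apply: (measurableT_comp mG); exact: measurable_pair2.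
have mIF : measurable_fun setT (fun y => \int[mu]_x F (x, y))%E.
  exact: (measurable_fun_fubini_tonelli_G (m1 := mu) F).
have mIG : measurable_fun setT (fun y => \int[mu]_x G (x, y))%E.
  exact: (measurable_fun_fubini_tonelli_G (m1 := mu) G).
have IF0 y : (0 <= \int[mu]_x F (x, y))%E by apply: integral_ge0.
have IG0 y : (0 <= \int[mu]_x G (x, y))%E by apply: integral_ge0.
apply: (@le_trans _ _ (\int[mu]_y (\int[mu]_x F (x, y) + \int[mu]_x G (x, y)))%E).
  apply: ge0_le_integral => //.
  - by move=> y _; apply: mule_ge0 => //; apply: integral_ge0 => x _;
      rewrite lee_fin mulr_ge0// normc_ge0.
  - exact: measurable_pois_conv.
  - exact: emeasurable_funD.
  - move=> y _; rewrite -ge0_integralZl//; last first.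
      by move=> x _; rewrite lee_fin mulr_ge0 ?normc_ge0.
    rewrite -ge0_integralD//; apply: ge0_le_integral => //.
    + by move=> x _; rewrite mule_ge0// lee_fin mulr_ge0// normc_ge0.
    + exact: measurable_funeM.
    + exact: emeasurable_funD.
    + move=> x _; rewrite /F /G /= -EFinM -EFinD lee_fin mulrA -mulrDl.
      apply: ler_wpM2r => //.
      have := sqr_ge0 (normc (u x) - normc (u y)).
      by rewrite sqrrB; lra.
have h2 : (\int[mu]_y (2^-1 * normc (u y) ^+ 2)%:E = (2^-1)%:E * sq2 mu u)%E.
  under eq_integral do rewrite EFinM; rewrite ge0_integralZl//.
  - exact: emeasurable_sqr_normc.
  - by move=> x _; rewrite lee_fin sqr_ge0.
rewrite ge0_integralD//.
have -> : (\int[mu]_y \int[mu]_x F (x, y) = (2^-1)%:E * sq2 mu u)%E.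
  rewrite -(fubini_tonelli F)// -h2; apply: eq_integral => x _.
  rewrite /F /=; under eq_integral do rewrite EFinM.
  rewrite ge0_integralZl//.
  - by rewrite integral_pois// mule1.
  - by apply/measurable_EFinP; exact: (measurable_poisr x e0).
  - by move=> y _; rewrite lee_fin.
  - by rewrite lee_fin mulr_ge0// sqr_ge0.
have -> : (\int[mu]_y \int[mu]_x G (x, y) = (2^-1)%:E * sq2 mu u)%E.
  rewrite -h2; apply: eq_integral => y _.
  rewrite /G /=; under eq_integral do rewrite EFinM.
  rewrite ge0_integralZl//.
  - by rewrite integral_poisl// mule1.
  - by apply/measurable_EFinP; exact: (measurable_poisl y e0).
  - by move=> x _; rewrite lee_fin.
  - by rewrite lee_fin mulr_ge0// sqr_ge0.
rewrite -ge0_muleDl ?lee_fin// -EFinD (_ : 2^-1 + 2^-1 = 1 :> R); last by lra.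
by rewrite mul1e.
Qed.

Lemma cvg_gam xi : gam k.+1%:R^-1 xi @[k --> \oo] --> (1 : R).
Proof.
have h : (- k.+1%:R^-1 * \sum_(i < n) `|tnth xi i : R|) @[k --> \oo] --> (- 0 * \sum_(i < n) `|tnth xi i : R|).
  apply: cvgM; last exact: cvg_cst.
  by apply: cvgN; exact: cvg_harmonic.
have := cvg_comp _ _ h (@continuous_expR R _).
rewrite oppr0 mul0r expR0 (_ : _ \o _ = (fun k : nat => gam k.+1%:R^-1 xi))//.
by apply/funext => k /=; rewrite gamE.
Qed.

(** The half of Plancherel's identity that is needed. The integral of [gam e |u^|^2] is the pairing
    of [u] with its Poisson average, which [young_pois] bounds by [sq2 mu u] uniformly in [e].
    Fatou's lemma then removes the weight. *)
Lemma sq2_fourier1_le u : cintegrable mu u -> cmeas u ->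
  (sq2 mu (fourier1 u) <= sq2 mu u)%E.
Proof.
move=> iu mcu; have mF := cmeas_fourier1 iu.
apply: (fatou_le (h_ := fun k xi => (gam k.+1%:R^-1 xi * normc (fourier1 u xi) ^+ 2)%:E)).
- move=> k; apply/measurable_EFinP/measurable_funM; first exact: measurable_gam.
  exact: measurable_sqr_normc.
- exact: emeasurable_sqr_normc.
- by move=> k xi; rewrite lee_fin mulr_ge0 ?sqr_ge0// ltW// gam_gt0.
- by move=> xi; rewrite lee_fin sqr_ge0.
- apply: aeW => xi; apply/fine_cvgP; split; first exact: nearW.
  rewrite -[X in _ --> X]mul1r; apply: cvgM; last exact: cvg_cst.
  exact: cvg_gam.
apply: nearW => k; set e := k.+1%:R^-1.
have e0 : 0 < e by rewrite invr_gt0.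
apply: le_trans (young_pois e0 mcu).
have ig := cintegrable_gamM e0 iu.
have iJ := cintegrableJ iu.
have mk : cmeas (fun z : X * X => (wave z.1 z.2)^*) by exact: cmeasJ cmeas_wave2.
have k1 (z : X * X) : normc ((wave z.1 z.2)^*) <= 1 by rewrite normc_conj normc_wave.
have iF := cintegrable_prodM mk k1 iJ ig.
have inner y : cint mu (fun xi => (wave y xi)^* * ((u y)^* * ((gam e xi)%:C * fourier1 u xi))) =
    (u y)^* * cint mu (fun x => u x * (pois e x y)%:C).
  rewrite -(fourier1_gam_inv _ e0 iu) -cintZ; first by congr cint; apply/funext => xi; ring.
  apply: cintegrable_le (integrable_normc ig).
    exact: cmeasM (cintegrable_meas ig) (cmeasJ (cmeas_waver _)).
  by move=> xi; rewrite normcM normc_conj normc_wave mulr1.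
have AE : cint mu (fun xi => (gam e xi * normc (fourier1 u xi) ^+ 2)%:C) =
    cint mu (fun y => (u y)^* * cint mu (fun x => u x * (pois e x y)%:C)).
  transitivity (cint mu (fun y => cint mu (fun xi =>
      (wave y xi)^* * ((u y)^* * ((gam e xi)%:C * fourier1 u xi))))); last first.
    by congr cint; apply/funext => y; exact: inner.
  rewrite (cfubini iF) /=; congr cint; apply/funext => xi.
  rewrite realcM -mulc_conj [X in conjc X]fourier1E -cintJ; last exact: cintegrable_waveM.
  rewrite mulrA -cintZ; last exact/cintegrableJ/cintegrable_waveM.
  by congr cint; apply/funext => y; rewrite conjcM; ring.
have iA : cintegrable mu (fun y => (u y)^* * cint mu (fun x => u x * (pois e x y)%:C)).
  by have := cintegrable_fubini iF; congr cintegrable; apply/funext => y; exact: inner.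
have inn : mu.-integrable setT (EFin \o (fun xi => gam e xi * normc (fourier1 u xi) ^+ 2)).
  (* The transform of an integrable function is bounded, so [gam e |u^|^2] is dominated by a
     multiple of the integrable [gam e |u^|]. *)
  have [B hB] : exists B : R, forall xi, normc (fourier1 u xi) <= B.
    by exists (\int[mu]_x normc (u x)) => xi; exact: normc_fourier1_le.
  have [ih _] := cintegrableZ B%:C (cintegrable_real (integrable_normc ig)).
  apply: le_integrable ih => //.
    apply/measurable_EFinP/measurable_funM; first exact: measurable_gam.
    exact: measurable_sqr_normc.
  move=> xi _ /=; rewrite lee_fin mul0r subr0 normcM normc_real.
  have B0 : 0 <= B by apply: le_trans (hB xi); exact: normc_ge0.
  have g0 := gam_gt0 e xi.
  rewrite !normrM !normr_id (ger0_norm B0) (ger0_norm (normc_ge0 _)) (ger0_norm (ltW g0)).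
  by rewrite [leLHS]mulrCA ler_wpM2r// mulr_ge0 ?normc_ge0// ltW.
have -> : (\int[mu]_xi (gam e xi * normc (fourier1 u xi) ^+ 2)%:E =
   (normc (cint mu (fun y => ((u y)^* * cint mu (fun x => u x * (pois e x y)%:C))%R)))%:E)%E.
  rewrite -AE cint_real normc_real ger0_norm.
    by rewrite /Rintegral fineK// integrable_fin_num.
  by apply: Rintegral_ge0 => xi _; rewrite mulr_ge0 ?sqr_ge0// ltW// gam_gt0.
apply: le_trans (le_normc_cint iA) _.
apply: ge0_le_integral => //.
- by move=> y _; rewrite lee_fin normc_ge0.
- by apply/measurable_EFinP; exact: measurable_normc (cintegrable_meas iA).
- exact: measurable_pois_conv.
- move=> y _; rewrite normcM normc_conj EFinM; apply: lee_pmul => //.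
  + by rewrite lee_fin normc_ge0.
  + by rewrite lee_fin normc_ge0.
  apply: le_trans (le_normc_cint (cintegrable_poisM y e0 iu)) _.
  apply: ge0_le_integral => //.
  + by move=> x _; rewrite lee_fin normc_ge0.
  + apply/measurable_EFinP.
    exact: measurable_normc (cintegrable_meas (cintegrable_poisM y e0 iu)).
  + apply/measurable_EFinP/measurable_funM; last exact: measurable_poisl.
    exact: measurable_normc.
  + by move=> x _; rewrite normcM normc_real ger0_norm// pois_ge0.
Qed.

End fourier_L1.

Section ereal_limits.
Context {R : realType}.
Implicit Types u v : nat -> \bar R.

Lemma ge0_cvge0P u : (forall k, 0 <= u k)%E ->
  u @ \oo --> 0%E <-> forall e : R, 0 < e -> \forall k \near \oo, (u k <= e%:E)%E.
Proof.
move=> u0; split=> [/fine_cvgP[fu /cvgrPdist_le cu] e e0|h].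
  move: fu (cu e e0); apply: filterS2 => k /fineK <-.
  by rewrite sub0r normrN lee_fin; apply: le_trans; exact: ler_norm.
apply/fine_cvgP; split.
  apply: filterS (h 1 ltr01) => k uk1.
  by rewrite ge0_fin_numE// (le_lt_trans uk1)// ltry.
apply/cvgrPdist_le => e e0; apply: filterS (h e e0) => k uke.
rewrite sub0r normrN ger0_norm ?fine_ge0// -lee_fin fineK//.
by rewrite ge0_fin_numE// (le_lt_trans uke)// ltry.
Qed.

Lemma squeeze_cvge0 u v : (forall k, 0 <= u k)%E -> (forall k, u k <= v k)%E ->
  v @ \oo --> 0%E -> u @ \oo --> 0%E.
Proof.
move=> u0 uv cv; apply: (@squeeze_cvge _ _ _ _ (fun=> 0%E) _ v) => //.
- by apply: nearW => k; rewrite u0 uv.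
- exact: cvg_cst.
Qed.

Lemma cvge0Z (c : R) u : u @ \oo --> 0%E -> (fun k => c%:E * u k)%E @ \oo --> 0%E.
Proof. by move=> cu; rewrite -[X in _ --> X](mule0 c%:E); exact: cvgeZl. Qed.

Lemma cvge0D u v : u @ \oo --> 0%E -> v @ \oo --> 0%E ->
  (fun k => u k + v k)%E @ \oo --> 0%E.
Proof. by move=> cu cv; rewrite -[X in _ --> X](adde0 0%E); exact: cvgeD. Qed.

End ereal_limits.

(** * The [L^p] norms of the definitions in terms of squared norms *)

Section bridge.
Context {R : realType} {n : nat}.
Local Notation X := (Rn R n).
Local Notation mu := (@lebesgue_Rn R n).
Implicit Types (f g : X -> R[i]) (h : X -> R).

Lemma Lfun2P h : h \in Lfun mu 2%:E <->
  measurable_fun setT h /\ (\int[mu]_x (h x ^+ 2)%:E < +oo)%E.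
Proof.
have E : ('N[mu]_2%:E[EFin \o h] `^ 2 = \int[mu]_x (h x ^+ 2)%:E)%E.
  rewrite powR_Lnorm//; apply: eq_integral => x _ /=.
  by rewrite powR_mulrn// real_normK ?num_real.
have E' : ('N[mu]_2%:E[EFin \o h] < +oo)%E <-> (\int[mu]_x (h x ^+ 2)%:E < +oo)%E.
  rewrite -E; split=> [|h2]; first exact: poweR_lty.
  by apply: (@lty_poweRy _ _ 2).
split=> [|[mh /E' h2]].
  by rewrite inE => /andP[]; rewrite !inE => mh /E'.
by rewrite inE; apply/andP; split; rewrite !inE.
Qed.

Lemma LpC2P f : LpC 2%:E f <-> inL2 mu f.
Proof.
split.
  move=> /andP[/Lfun2P[mf1 f1] /Lfun2P[mf2 f2]]; split => //.
  rewrite /sq2; under eq_integral do rewrite sqr_normcE EFinD.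
  rewrite ge0_integralD//; try by move=> x _; rewrite lee_fin sqr_ge0.
  - exact: lte_add_pinfty.
  - exact/measurable_EFinP/measurable_funX.
  - exact/measurable_EFinP/measurable_funX.
move=> [mf f2]; have mn := emeasurable_sqr_normc mf; case: mf => mf1 mf2.
apply/andP; split; apply/Lfun2P; split => //; apply: le_lt_trans f2.
- apply: ge0_le_integral => //.
  + by move=> x _; rewrite lee_fin sqr_ge0.
  + exact/measurable_EFinP/measurable_funX.
  + by move=> x _; rewrite lee_fin sqr_normcE lerDl sqr_ge0.
- apply: ge0_le_integral => //.
  + by move=> x _; rewrite lee_fin sqr_ge0.
  + exact/measurable_EFinP/measurable_funX.
  + by move=> x _; rewrite lee_fin sqr_normcE lerDr sqr_ge0.
Qed.

Lemma LpC1P f : LpC 1%E f <-> cintegrable mu f.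
Proof.
split=> [/andP[/Lfun1_integrable f1 /Lfun1_integrable f2]//|[f1 f2]].
by apply/andP; split; apply/Lfun1_integrable.
Qed.

Lemma cvg_distC (u : nat -> X -> R[i]) g :
  distC 2%:E (u k) g @[k --> \oo] --> 0%E <->
  sq2 mu (fun x => u k x - g x) @[k --> \oo] --> 0%E.
Proof.
have E k : (distC 2%:E (u k) g `^ 2 = sq2 mu (fun x => (u k x - g x)%R))%E.
  rewrite /distC powR_Lnorm//; apply: eq_integral => x _ /=.
  by rewrite powR_mulrn ?normr_ge0// ger0_norm// normc_ge0.
have d0 k : (0 <= distC 2%:E (u k) g)%E by exact: Lnorm_ge0.
split=> /ge0_cvge0P h; apply/ge0_cvge0P => //.
- by move=> k; exact: sq2_ge0.
- move=> e e0.
  have se0 : 0 < Num.sqrt e by rewrite sqrtr_gt0.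
  apply: filterS (h d0 _ se0) => k hk; rewrite -E.
  have -> : e = Num.sqrt e `^ 2 by rewrite powR_mulrn ?sqrtr_ge0// sqr_sqrtr// ltW.
  by rewrite -poweR_EFin; apply: gt0_ler_poweR => //; rewrite in_itv/= leey ?andbT.
- move=> e e0; have e2 : 0 < e ^+ 2 by rewrite exprn_gt0.
  apply: filterS (h (fun k => sq2_ge0 _ _) _ e2) => k hk.
  have -> : distC 2%:E (u k) g = (sq2 mu (fun x => (u k x - g x)%R) `^ 2^-1)%E.
    by rewrite -E -poweRrM mulfV// poweRe1.
  have -> : e = (e ^+ 2) `^ 2^-1 by rewrite powR12_sqrt ?sqr_ge0// sqrtr_sqr gtr0_norm.
  rewrite -poweR_EFin; apply: gt0_ler_poweR => //; rewrite in_itv/= leey andbT.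
    exact: sq2_ge0.
  by rewrite lee_fin sqr_ge0.
Qed.

Lemma is_fourierP f g : is_fourier f g <->
  [/\ inL2 mu f, inL2 mu g & exists u : nat -> X -> R[i],
   [/\ forall k, cintegrable mu (u k) /\ inL2 mu (u k),
     sq2 mu (fun x => u k x - f x) @[k --> \oo] --> 0%E &
     sq2 mu (fun x => fourier1 (u k) x - g x) @[k --> \oo] --> 0%E]].
Proof.
split=> [[/LpC2P Lf /LpC2P Lg [u [uk uf ug]]]|[Lf Lg [u [uk uf ug]]]].
  split => //; exists u; split; [|exact/cvg_distC|exact/cvg_distC].
  by move=> k; have [/LpC1P ? /LpC2P ?] := uk k.
split; [exact/LpC2P|exact/LpC2P|].
exists u; split; [|exact/cvg_distC|exact/cvg_distC].
by move=> k; have [? ?] := uk k; split; [exact/LpC1P|exact/LpC2P].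
Qed.

End bridge.

(** * The Fourier transform on [L^2] *)

Section fourier_L2.
Context {R : realType} {n : nat}.
Local Notation X := (Rn R n).
Local Notation mu := (@lebesgue_Rn R n).
Implicit Types (f g u : X -> R[i]).

Lemma fourier1_lin (c : R[i]) f g : cintegrable mu f -> cintegrable mu g ->
  fourier1 (fun x => c * f x + g x) = fun xi => c * fourier1 f xi + fourier1 g xi.
Proof.
move=> fi gi; apply/funext => xi; rewrite !fourier1E.
rewrite -cintZ; last exact: cintegrable_waveM.
rewrite -cintD; last 2 first.
- exact/cintegrableZ/cintegrable_waveM.
- exact: cintegrable_waveM.
by congr cint; apply/funext => x; rewrite mulrDl mulrA.
Qed.

Lemma fourier1B f g : cintegrable mu f -> cintegrable mu g ->
  fourier1 (fun x => f x - g x) = fun xi => fourier1 f xi - fourier1 g xi.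
Proof.
move=> fi gi; have := fourier1_lin (- 1) gi fi.
rewrite (_ : (fun x => _) = (fun x => f x - g x)).
  by move=> ->; apply/funext => xi; rewrite mulN1r addrC.
by apply/funext => xi; rewrite mulN1r addrC.
Qed.

Lemma inL2_fourier1 u : cintegrable mu u -> inL2 mu u -> inL2 mu (fourier1 u).
Proof.
move=> iu [mu2 u2]; split; first exact: cmeas_fourier1.
exact: le_lt_trans (sq2_fourier1_le iu mu2) u2.
Qed.

Lemma is_fourier_L2l f g : is_fourier f g -> inL2 mu f.
Proof. by case/is_fourierP. Qed.

Lemma is_fourier_L2r f g : is_fourier f g -> inL2 mu g.
Proof. by case/is_fourierP. Qed.

Lemma is_fourier_lin (c : R[i]) f g f' g' : is_fourier f g -> is_fourier f' g' ->
  is_fourier (fun x => c * f x + f' x) (fun x => c * g x + g' x).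
Proof.
move=> /is_fourierP[Lf Lg [u [uk uf ug]]] /is_fourierP[Lf' Lg' [u' [uk' uf' ug']]].
apply/is_fourierP; split; [exact/inL2D/Lf'/inL2Z|exact/inL2D/Lg'/inL2Z|].
exists (fun k x => c * u k x + u' k x); split.
- move=> k; have [iu Lu] := uk k; have [iu' Lu'] := uk' k; split.
    exact/cintegrableD/iu'/cintegrableZ.
  exact/inL2D/Lu'/inL2Z.
- apply: (squeeze_cvge0 (v := fun k => (2%:E * ((normc c ^+ 2)%:E *
      sq2 mu (fun x => (u k x - f x)%R)) + 2%:E * sq2 mu (fun x => (u' k x - f' x)%R))%E)).
  + by move=> k; exact: sq2_ge0.
  + move=> k; have [mk mk'] := ((uk k).2.1, (uk' k).2.1).
    have mf : cmeas (fun x => u k x - f x) by exact: cmeasB mk Lf.1.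
    rewrite -sq2Z//; apply: sq2_split => [||x]; last by ring.
    * exact/cmeasM/mf/cmeas_cst.
    * exact: cmeasB mk' Lf'.1.
  + by apply: cvge0D; apply: cvge0Z => //; apply: cvge0Z.
- apply: (squeeze_cvge0 (v := fun k => (2%:E * ((normc c ^+ 2)%:E *
      sq2 mu (fun x => (fourier1 (u k) x - g x)%R)) +
      2%:E * sq2 mu (fun x => (fourier1 (u' k) x - g' x)%R))%E)).
  + by move=> k; exact: sq2_ge0.
  + move=> k; have [mk mk'] := ((uk k).1, (uk' k).1).
    have mf : cmeas (fun x => fourier1 (u k) x - g x).
      exact: cmeasB (cmeas_fourier1 mk) Lg.1.
    rewrite -sq2Z// fourier1_lin//; apply: sq2_split => [||x]; last by ring.
    * exact/cmeasM/mf/cmeas_cst.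
    * exact: cmeasB (cmeas_fourier1 mk') Lg'.1.
  + by apply: cvge0D; apply: cvge0Z => //; apply: cvge0Z.
Qed.

Lemma is_fourierB f g f' g' : is_fourier f g -> is_fourier f' g' ->
  is_fourier (fun x => f x - f' x) (fun x => g x - g' x).
Proof.
move=> fg fg'; have := is_fourier_lin (- 1) fg' fg.
by congr is_fourier; apply/funext => x; rewrite mulN1r addrC.
Qed.

(** The constant 4 comes from two uses of the crude inequality [sq2_split]. Any constant will do,
    since the bound serves to carry null functions and null sequences through the transform. *)
Lemma is_fourier_sq2_le f g : is_fourier f g -> (sq2 mu g <= 4%:E * sq2 mu f)%E.
Proof.
move=> /is_fourierP[[mf f2] [mg g2] [u [uk uf ug]]].
have [mu_ mFu] : (forall k, cmeas (u k)) /\ (forall k, cmeas (fourier1 (u k))).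
  by split=> k; have [iu _] := uk k; [exact: cintegrable_meas iu|exact: cmeas_fourier1].
rewrite -[leRHS]add0e.
have h : (fun k => (2%:E * sq2 mu (fun x => (fourier1 (u k) x - g x)%R) +
   4%:E * sq2 mu (fun x => (u k x - f x)%R)) + 4%:E * sq2 mu f)%E @ \oo -->
   (0 + 4%:E * sq2 mu f)%E.
  apply: cvgeD; last exact: cvg_cst.
  - by rewrite fin_num_adde_defr.
  - by apply: cvge0D; apply: cvge0Z.
apply: (cvge_to_ge h); apply: nearW => k.
have e1 : (sq2 mu g <= 2%:E * sq2 mu (fun x => (fourier1 (u k) x - g x)%R) +
    2%:E * sq2 mu (fourier1 (u k)))%E.
  rewrite (sq2BC mu (fourier1 (u k)) g).
  by apply: sq2_split => // [|x]; [exact: cmeasB|ring].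
have e2 : (sq2 mu (fourier1 (u k)) <=
    2%:E * sq2 mu (fun x => (u k x - f x)%R) + 2%:E * sq2 mu f)%E.
  apply: le_trans (sq2_fourier1_le (uk k).1 (mu_ k)) _.
  by apply: sq2_split => // [|x]; [exact: cmeasB|ring].
apply: le_trans e1 _; rewrite -addeA leeD2l//.
apply: (@le_trans _ _ (2%:E * (2%:E * sq2 mu (fun x => (u k x - f x)%R) + 2%:E * sq2 mu f))%E).
  by rewrite lee_pmul2l.
rewrite ge0_muleDr ?mule_ge0 ?sq2_ge0// !muleA -EFinM.
by rewrite (_ : 2 * 2 = 4 :> R)//; lra.
Qed.

Lemma is_fourier_unique f g f' g' : is_fourier f g -> is_fourier f' g' ->
  aeq f f' -> aeq g g'.
Proof.
move=> fg fg' ff'; have [mf mf'] := ((is_fourier_L2l fg).1, (is_fourier_L2l fg').1).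
have [mg mg'] := ((is_fourier_L2r fg).1, (is_fourier_L2r fg').1).
apply: sq2B_eq0 => //; apply/eqP; rewrite eq_le sq2_ge0 andbT.
apply: le_trans (is_fourier_sq2_le (is_fourierB fg fg')) _.
rewrite (aeq_sq2 (g := fun=> 0) (cmeasB mf mf') (@cmeas_cst _ _ _ 0)).
  rewrite /sq2; under eq_integral do rewrite normc0 expr0n.
  by rewrite integral0 mule0.
by apply: filterS ff' => x /= h Tx; rewrite h// subrr.
Qed.

Lemma aeq_cvg_sq2 (v : nat -> X -> R[i]) f f' : (forall k, cmeas (v k)) ->
  cmeas f -> cmeas f' -> aeq f f' ->
  sq2 mu (fun x => v k x - f x) @[k --> \oo] --> 0%E ->
  sq2 mu (fun x => v k x - f' x) @[k --> \oo] --> 0%E.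
Proof.
move=> mv mf mf' ff'; apply: cvg_trans; apply: near_eq_cvg; apply: nearW => k.
apply: aeq_sq2; [exact: cmeasB|exact: cmeasB|].
by apply: filterS ff' => x /= h Tx; rewrite h.
Qed.

Lemma is_fourier_aeq f g f' g' : is_fourier f g -> cmeas f' -> cmeas g' ->
  aeq f f' -> aeq g g' -> is_fourier f' g'.
Proof.
move=> /is_fourierP[Lf Lg [u [uk uf ug]]] mf' mg' ff' gg'; apply/is_fourierP.
have sym (h h' : X -> R[i]) : aeq h h' -> aeq h' h.
  by apply: filterS => x /= hx Tx; rewrite hx.
split; [exact: inL2_ae (sym _ _ ff') Lf|exact: inL2_ae (sym _ _ gg') Lg|].
exists u; split => //.
- apply: (aeq_cvg_sq2 _ Lf.1 mf' ff' uf) => k; exact: (uk k).2.1.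
- by apply: (aeq_cvg_sq2 _ Lg.1 mg' gg' ug) => k; apply: cmeas_fourier1; exact: (uk k).1.
Qed.

Lemma is_fourier_L1 f : cintegrable mu f -> inL2 mu f -> is_fourier f (fourier1 f).
Proof.
move=> fi Lf; apply/is_fourierP; split => //; first exact: inL2_fourier1.
have z h : sq2 mu (fun x : X => h x - h x) @[k --> \oo] --> 0%E.
  rewrite /sq2; under eq_integral do rewrite subrr normc0 expr0n.
  by rewrite integral0; exact: cvg_cst.
by exists (fun=> f); split.
Qed.

(** Cutting [f] off to sets of finite measure gives integrability, because [|f| <= 1 + |f|^2]. *)
Lemma truncationP f : inL2 mu f -> exists u : nat -> X -> R[i],
  (forall k, cintegrable mu (u k) /\ inL2 mu (u k)) /\
  sq2 mu (fun x => u k x - f x) @[k --> \oo] --> 0%E.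
Proof.
move=> Lf; have [mf f2] := Lf.
have /sigma_finiteP[F [TF ndF Foo]] := sigma_finiteT mu.
pose u k x := f x * (\1_(F k) x)%:C.
have mu_ k : cmeas (u k).
  by apply: cmeasM => //; apply/cmeas_real/measurable_indic; have [] := Foo k.
have uf k x : normc (u k x) <= normc (f x).
  rewrite /u normcM normc_real.
  by have [->|->] := indic01 R (F k) x; rewrite ?normr0 ?mulr0 ?normc_ge0 ?normr1 ?mulr1.
exists u; split.
- move=> k; split; last exact: inL2_le (mu_ k) (uf k) Lf.
  have [mFk Fk] := Foo k.
  have i1 : mu.-integrable setT (EFin \o (\1_(F k) : X -> R)).
    apply/integrableP; split; first exact/measurable_EFinP/measurable_indic.
    under eq_integral do rewrite /= ger0_norm//.
    by rewrite integral_indic// setIT.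
  apply: (@cintegrable_le _ _ _ _ _ (fun x => \1_(F k) x + normc (f x) ^+ 2)) => //.
  + move=> x; rewrite /u normcM normc_real.
    have [->|->] := indic01 R (F k) x; first by rewrite normr0 mulr0 add0r sqr_ge0.
    rewrite normr1 mulr1; have := sqr_ge0 (normc (f x) - 2^-1); rewrite sqrrB; lra.
  + exact: (integrableD measurableT i1 (inL2_integrable Lf)).
- apply: (sq2_dominated (g := f)) => //.
  + apply: aeW => x; have [k0 _ Fx] : (\bigcup_k F k) x by rewrite -TF.
    apply: cvg_near_cst; exists k0 => // k /= k0k; rewrite /u indicE mem_set ?mulr1 ?subrr ?normc0//.
    by move: x Fx; exact/subsetPset/ndF.
  + move=> k x; rewrite /u.
    by have [->|->] := indic01 R (F k) x; rewrite ?mulr0 ?sub0r ?normcN// mulr1 subrr normc0 normc_ge0.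
Qed.

Lemma is_fourier_exists f : inL2 mu f -> exists g, is_fourier f g.
Proof.
move=> Lf; have [u [uk uf]] := truncationP Lf.
have mu_ k : cmeas (u k) by exact: (uk k).2.1.
have [|e e0|g [Lg ug]] := @inL2_complete _ _ _ mu (fun k => fourier1 (u k)).
- by move=> k; exact: inL2_fourier1 (uk k).1 (uk k).2.
- have e4 : 0 < e / 4 by rewrite divr_gt0.
  have [N _ hN] := (ge0_cvge0P (fun k => sq2_ge0 mu _)).1 uf _ e4.
  exists N => i j Ni Nj.
  rewrite -(fourier1B (uk i).1 (uk j).1).
  apply: le_trans (sq2_fourier1_le _ _) _.
  + exact: cintegrableB (uk i).1 (uk j).1.
  + exact: cmeasB.
  apply: le_trans (sq2_triangle _ (mu_ i) Lf.1 (mu_ j)) _.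
  rewrite (sq2BC mu f).
  apply: (@le_trans _ _ (2%:E * (e / 4)%:E + 2%:E * (e / 4)%:E)%E).
    by apply: leeD; rewrite lee_pmul2l//; apply: hN.
  by rewrite -!EFinM -EFinD lee_fin; lra.
by exists g; apply/is_fourierP; split => //; exists u; split.
Qed.

Lemma is_fourier_cvg (f_ g_ : nat -> X -> R[i]) f g :
  (forall k, is_fourier (f_ k) (g_ k)) -> is_fourier f g ->
  sq2 mu (fun x => f_ k x - f x) @[k --> \oo] --> 0%E ->
  sq2 mu (fun x => g_ k x - g x) @[k --> \oo] --> 0%E.
Proof.
move=> fgk fg cf; apply: (squeeze_cvge0 (v := fun k =>
   (4%:E * sq2 mu (fun x => (f_ k x - f x)%R))%E)).
- by move=> k; exact: sq2_ge0.
- by move=> k; exact: is_fourier_sq2_le (is_fourierB (fgk k) fg).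
- exact: cvge0Z.
Qed.

Lemma is_fourier_closed (f_ g_ : nat -> X -> R[i]) f g :
  (forall k, is_fourier (f_ k) (g_ k)) -> inL2 mu f -> inL2 mu g ->
  sq2 mu (fun x => f_ k x - f x) @[k --> \oo] --> 0%E ->
  sq2 mu (fun x => g_ k x - g x) @[k --> \oo] --> 0%E ->
  is_fourier f g.
Proof.
move=> fgk Lf Lg cf cg; have [g0 fg0] := is_fourier_exists Lf.
have cg0 := is_fourier_cvg fgk fg0 cf.
apply: (is_fourier_aeq fg0 Lf.1 Lg.1); first by apply: aeW.
apply: (sq2_lim_unique _ _ Lg.1 cg0 cg).
- by move=> k; exact: (is_fourier_L2r (fgk k)).1.
- exact: (is_fourier_L2r fg0).1.
Qed.

(** The inverse transform is the conjugate of the transform of the conjugate, so the one relation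
    [is_fourier] expresses both directions. The property is linear and closed in [L^2], which
    reduces it to indicators of boxes. *)
Definition invertible f := exists g, is_fourier f g /\
  is_fourier (fun x => (g x)^*) (fun x => (f x)^*).

Lemma invertible_lin (c : R[i]) f f' : invertible f -> invertible f' ->
  invertible (fun x => c * f x + f' x).
Proof.
move=> [g [fg gf]] [g' [fg' gf']]; exists (fun x => c * g x + g' x).
split; first exact: is_fourier_lin.
have := is_fourier_lin (c^*) gf gf'.
by congr is_fourier; apply/funext => x; rewrite conjcD conjcM.
Qed.

Lemma invertible_closed (f_ : nat -> X -> R[i]) f : (forall k, invertible (f_ k)) ->
  inL2 mu f -> sq2 mu (fun x => f_ k x - f x) @[k --> \oo] --> 0%E -> invertible f.
Proof.
move=> /choice[g_ fg] Lf cf; have [g fg0] := is_fourier_exists Lf.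
exists g; split => //.
have Lg := is_fourier_L2r fg0.
have cg := is_fourier_cvg (fun k => (fg k).1) fg0 cf.
apply: (is_fourier_closed (fun k => (fg k).2)).
- exact: inL2J.
- exact: inL2J.
- by under eq_fun do rewrite sq2BJ.
- by under eq_fun do rewrite sq2BJ.
Qed.

End fourier_L2.

Section hyperplanes.
Context {R : realType}.

(** The faces of a box lie in such hyperplanes. They must be discarded because the Poisson averages
    of the indicator need not converge to it there. *)
Lemma hyperplane_null n (i : 'I_n) (c : R) :
  {ae @lebesgue_Rn R n, forall x, (tnth x i : R) <> c}.
Proof.
pose H n (i : 'I_n) := (fun x : Rn R n => tnth x i) @^-1` [set c].
have mH m (j : 'I_m) : measurable (H m j).
  by rewrite -[H m j]setTI; apply: (measurable_tnth j) => //; exact: measurable_set1.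
suff H0 : lebesgue_Rn (H n i) = 0%E.
  by exists (H n i); split => //; [exact: mH|move=> x /= /contrapT].
elim: n i => [[]//|n ih] i.
rewrite -[X in lebesgue_Rn X]setIT -(integral_indic _ measurableT (mH n.+1 i)).
rewrite ge0_integral_RnS//; last first.
  by apply/measurable_EFinP; exact: measurable_indic (mH n.+1 i).
(* For a later coordinate every slice is null by induction. For the first one the slice is the whole
   space at [t = c] and empty elsewhere, and a single point carries no mass even against an infinite
   value. *)
have [j ->|->] := unliftP ord0 i.
  rewrite integral0_eq// => t _.
  rewrite (eq_integral (fun x => (\1_(H n j) x)%:E)).
    rewrite (integral_indic _ measurableT (mH n j)) setIT; exact: ih.
  move=> x _; rewrite !indicE; congr (nat_of_bool _)%:R%:E.
  by apply/idP/idP; rewrite !inE /H /= tnthS.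
transitivity (\int[@lebesgue_measure R]_(t in [set c]) cst (lebesgue_Rn [set: Rn R n]) t)%E;
  last exact: integral_set1.
rewrite [RHS]integral_mkcond; apply: eq_integral => t _.
rewrite patchE; case: ifPn => tc.
  rewrite (eq_integral (fun=> 1%E)); first by rewrite integral_cst// mul1e.
  move=> x _; rewrite indicE mem_set//.
  by move: tc; rewrite inE.
rewrite integral0_eq// => x _; rewrite indicE memNset//.
by move: tc; rewrite notin_setE.
Qed.

End hyperplanes.

(** * Inversion for indicators of boxes *)

Section boxes.
Context {R : realType} {n : nat}.
Local Notation X := (Rn R n).
Local Notation mu := (@lebesgue_Rn R n).
Local Notation leb := (@lebesgue_measure R).
Implicit Types (f g u : X -> R[i]) (x y : X) (a b : 'I_n -> R).

(** The conjugate of [gam e u^] is integrable, and by [fourier1_gam_inv] its transform is the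
    conjugate Poisson average of [u]. As [e] tends to 0 this converges pointwise to the conjugate of
    [u], and in [L^2] to the transform of the conjugate of [u^]. The two limits agree. *)
Lemma invertible_pointwise u : cintegrable mu u -> inL2 mu u ->
  {ae mu, forall y, normc (cint mu (fun x => u x * (pois k.+1%:R^-1 x y)%:C) - u y)
     @[k --> \oo] --> (0 : R)} ->
  invertible u.
Proof.
move=> iu Lu cu; have LF := inL2_fourier1 iu Lu.
have mF := LF.1.
exists (fourier1 u); split; first exact: is_fourier_L1.
have [t Ft] := is_fourier_exists (inL2J LF).
apply: (is_fourier_aeq Ft (cmeasJ mF) (cmeasJ Lu.1)); first exact: aeW.
pose e k : R := k.+1%:R^-1.
have e0 k : 0 < e k by rewrite invr_gt0.
pose h k xi := ((gam (e k) xi)%:C * fourier1 u xi)^*.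
have ih k : cintegrable mu (h k) by exact/cintegrableJ/cintegrable_gamM.
have hle k xi : normc (h k xi) <= normc (fourier1 u xi).
  rewrite /h normc_conj normcM normc_real gtr0_norm ?gam_gt0//.
  by rewrite ler_piMl ?normc_ge0// gam_le1.
have Lh k : inL2 mu (h k).
  exact: inL2_le (cintegrable_meas (ih k)) (hle k) LF.
have Fh k y : fourier1 (h k) y = (cint mu (fun x => u x * (pois (e k) x y)%:C))^*.
  rewrite fourier1E -(fourier1_gam_inv _ (e0 k) iu) -cintJ.
    congr cint; apply/funext => xi; rewrite conjcM conjcK waveC; congr (_ * _).
  apply: cintegrable_le (integrable_normc (ih k)).
    exact: cmeasM (cintegrable_meas (cintegrable_gamM (e0 k) iu)) (cmeasJ (cmeas_waver y)).
  by move=> xi; rewrite /h normcM !normc_conj normc_wave mulr1.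
have ch : sq2 mu (fun x => h k x - (fourier1 u x)^*) @[k --> \oo] --> 0%E.
  apply: (sq2_dominated (g := fourier1 u)) => //.
  - by move=> k; exact: (Lh k).1.
  - exact: cmeasJ.
  - apply: aeW => xi.
    have hE k : normc (h k xi - (fourier1 u xi)^*) =
        normc (fourier1 u xi) * (1 - gam (e k) xi).
      rewrite /h -conjcB normc_conj -{2}[fourier1 u xi]mul1r -mulrBl normcM mulrC.
      congr (_ * _); rewrite -[1]/(1%:C) -realcB.
      by rewrite normc_real distrC ger0_norm// subr_ge0 gam_le1.
    under eq_fun do rewrite hE.
    suff : (normc (fourier1 u xi) * (1 - gam (e k) xi) : R) @[k --> \oo] -->
        (normc (fourier1 u xi) * (1 - 1) : R) by rewrite subrr mulr0.
    apply: cvgM; first exact: cvg_cst.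
    by apply: cvgB; [exact: cvg_cst|exact: cvg_gam].
  - move=> k xi.
    rewrite /h -conjcB normc_conj -{2}[fourier1 u xi]mul1r -mulrBl normcM.
    rewrite ler_piMl ?normc_ge0// -[1]/(1%:C) -realcB.
    rewrite normc_real distrC ger0_norm ?subr_ge0 ?gam_le1// gerBl.
    by rewrite ltW// gam_gt0.
have cF := is_fourier_cvg (fun k => is_fourier_L1 (ih k) (Lh k)) Ft ch.
have mFh k : cmeas (fourier1 (h k)) by exact: cmeas_fourier1.
have mt := (is_fourier_L2r Ft).1.
have : aeq (fun x => (u x)^*) t.
  apply: (sq2_ae_lim_unique mFh (cmeasJ Lu.1) mt _ cF).
  apply: filterS cu => y; under [X in _ -> X @ _ --> _]eq_fun do rewrite Fh -conjcB normc_conj.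
  exact.
by apply: filterS => x /= E Tx; rewrite E.
Qed.

Definition box a b : set X := [set x | forall i, a i < (tnth x i : R) < b i].

Definition itvind (p q t : R) : R := \1_(`]p, q[%classic : set R) t.

Lemma itvind01 p q t : itvind p q t = 0 \/ itvind p q t = 1.
Proof. by rewrite /itvind indicE; case: (_ \in _); [right|left]. Qed.

Lemma box_indicE a b x : (\1_(box a b) x : R) = \prod_(i < n) itvind (a i) (b i) (tnth x i).
Proof.
rewrite indicE; have [xb|xb] := boolP (x \in box a b).
  rewrite big1// => i _; rewrite /itvind indicE mem_set//=.
  by move: xb; rewrite inE => /(_ i); rewrite in_itv.
apply/esym/eqP; rewrite prodf_seq_eq0; apply/hasP.
have [i hi] : exists i, ~~ (a i < (tnth x i : R) < b i).
  apply: contrapT => h; move: xb => /negP; apply; rewrite inE => i.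
  by apply: contrapT => hi; apply: h; exists i; apply/negP.
exists i; first by rewrite mem_index_enum.
rewrite /= /itvind indicE memNset//= in_itv/=; exact/negP.
Qed.

Lemma measurable_itvind p q : measurable_fun [set: measurableTypeR R] (itvind p q).
Proof. by apply: measurable_indic; exact: measurable_itv. Qed.

Lemma cintegrable_itvind p q : cintegrable leb (fun t => (itvind p q t)%:C).
Proof.
by apply: cintegrable_real; exact: (@integrable_indic_itv R p q false true).
Qed.

Lemma box_cintegrable a b : cintegrable mu (fun x => (\1_(box a b) x : R)%:C).
Proof.
have [h _] := cint_prod_tnth (fun i => cintegrable_itvind (a i) (b i)).
rewrite (_ : (fun x => _) = (fun x : X => \prod_(i < n) (itvind (a i) (b i) (tnth x i))%:C))//.
by apply/funext => x; rewrite box_indicE (rmorph_prod (real_complex R)).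
Qed.

Lemma measurable_box a b : measurable (box a b).
Proof.
apply/(measurable_indicP R).
have -> : (\1_(box a b) : X -> R) = (fun x : X => \prod_(i < n) itvind (a i) (b i) (tnth x i)).
  by apply/funext => x; rewrite box_indicE.
exact: (measurable_prod_tnth (fun i => measurable_itvind (a i) (b i))).
Qed.

Lemma box_inL2 a b : inL2 mu (fun x => (\1_(box a b) x : R)%:C).
Proof.
have ib := box_cintegrable a b; split; first exact: cintegrable_meas ib.
rewrite /sq2; under eq_integral do rewrite normc_indic sqr_indic.
by have := cintegrable_normc_lty ib; under eq_integral do rewrite normc_indic.
Qed.

Lemma cvgy_atanM (c : R) : 0 < c ->
  atan (2 * pi / k.+1%:R^-1 * c) @[k --> \oo] --> (pi / 2 : R).
Proof.
move=> c0; apply: (@cvg_comp _ _ _ (fun k : nat => 2 * pi / k.+1%:R^-1 * c) atan);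
  last exact: cvgy_atan.
rewrite (_ : (fun k : nat => _) = (fun k : nat => (2 * pi * c) * k.+1%:R)).
  have h : (k.+1%:R : R) @[k --> \oo] --> +oo.
    by rewrite (cvg_shiftS (fun k => k%:R : R)); exact: cvgr_idn.
  apply: (cvg_comp _ _ h); apply: gt0_cvgMry; last exact: cvg_id.
  by rewrite mulr_gt0// mulr_gt0// pi_gt0.
by apply/funext => k; rewrite invrK; ring.
Qed.

Lemma cvgNy_atanM (c : R) : c < 0 ->
  atan (2 * pi / k.+1%:R^-1 * c) @[k --> \oo] --> (- (pi / 2) : R).
Proof.
move=> c0; have h : 0 < - c by rewrite oppr_gt0.
rewrite (_ : (fun k : nat => _) = (fun k : nat => - atan (2 * pi / k.+1%:R^-1 * (- c)))).
  by apply: cvgN; exact: cvgy_atanM.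
by apply/funext => k; rewrite -atanN mulrN opprK.
Qed.

Lemma Rintegral_itvind_pois1 p q t e : 0 < e -> p < q ->
  \int[leb]_s (itvind p q s * pois1 e (s - t)) =
  pi^-1 * (atan (2 * pi / e * (q - t)) - atan (2 * pi / e * (p - t))).
Proof.
move=> e0 pq; rewrite /Rintegral.
rewrite (_ : (\int[leb]_s (itvind p q s * pois1 e (s - t))%:E =
    \int[leb]_(s in `[p, q]) (pois1 e (t - s))%:E)%E).
  by rewrite integral_pois1_itv.
rewrite integral_itv_bndoo; last first.
  by apply/measurable_EFinP/measurable_funTS; exact: (measurable_pois1 t e0).
rewrite [RHS]integral_mkcond; apply: eq_integral => s _.
rewrite patchE /itvind indicE -pois1N opprB.
by case: (s \in _); rewrite ?mul1r// mul0r.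
Qed.

(** Each of the two arctangents tends to plus or minus [pi / 2], according to the side of [t] on
    which its endpoint lies. The signs are opposite exactly when [t] is inside the interval. *)
Lemma cvg_pois1_itv p q t : t <> p -> t <> q ->
  \int[leb]_s (itvind p q s * pois1 k.+1%:R^-1 (s - t)) @[k --> \oo] --> itvind p q t.
Proof.
move=> /eqP tp /eqP tq; have [pq|qp] := ltP p q; last first.
  have z s : itvind p q s = 0.
    rewrite /itvind indicE memNset//= in_itv/= => /andP[h1 h2].
    by have := lt_trans h1 h2; rewrite ltNge qp.
  rewrite z; apply: cvg_near_cst; apply: nearW => k.
  under eq_Rintegral do rewrite z mul0r.
  by rewrite Rintegral_cst// mul0r.
rewrite (_ : (fun k => _) = (fun k => pi^-1 * (atan (2 * pi / k.+1%:R^-1 * (q - t))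
    - atan (2 * pi / k.+1%:R^-1 * (p - t))))); last first.
  by apply/funext => k; rewrite Rintegral_itvind_pois1.
have pi0 : pi != 0 :> R by rewrite gt_eqF// pi_gt0.
have [tltp|pltt] : t < p \/ p < t by apply/orP; rewrite -neq_lt.
  have -> : itvind p q t = pi^-1 * (pi / 2 - pi / 2).
    rewrite subrr mulr0 /itvind indicE memNset//= in_itv/= => /andP[h1 _].
    by have := lt_trans h1 tltp; rewrite ltxx.
  apply: cvgM; first exact: cvg_cst.
  by apply: cvgB; apply: cvgy_atanM; rewrite subr_gt0// (lt_trans tltp).
have [tltq|qltt] : t < q \/ q < t by apply/orP; rewrite -neq_lt.
  have -> : itvind p q t = pi^-1 * (pi / 2 - - (pi / 2)).
    rewrite opprK -splitr mulVf// /itvind indicE mem_set//=.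
    by rewrite in_itv/= pltt.
  apply: cvgM; first exact: cvg_cst.
  by apply: cvgB; [apply: cvgy_atanM; rewrite subr_gt0|apply: cvgNy_atanM; rewrite subr_lt0].
have -> : itvind p q t = pi^-1 * (- (pi / 2) - - (pi / 2)).
  rewrite subrr mulr0 /itvind indicE memNset//= in_itv/= => /andP[_ h1].
  by have := lt_trans h1 qltt; rewrite ltxx.
apply: cvgM; first exact: cvg_cst.
by apply: cvgB; apply: cvgNy_atanM; rewrite subr_lt0.
Qed.

Lemma cvg_prodr (I : Type) (s : seq I) (u : I -> nat -> R) (l : I -> R) :
  (forall i, u i k @[k --> \oo] --> l i) ->
  \prod_(i <- s) u i k @[k --> \oo] --> \prod_(i <- s) l i.
Proof.
move=> ul; elim: s => [|i s ih].
  by under eq_fun do rewrite big_nil; rewrite big_nil; exact: cvg_cst.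
by under eq_fun do rewrite big_cons; rewrite big_cons; apply: cvgM.
Qed.

Lemma invertible_box a b : invertible (fun x : X => (\1_(box a b) x : R)%:C).
Proof.
apply: invertible_pointwise; [exact: box_cintegrable|exact: box_inL2|].
have ae_a : {ae mu, forall y : X, forall i, (tnth y i : R) <> a i}.
  by apply: filter_forall => i; exact: hyperplane_null.
have ae_b : {ae mu, forall y : X, forall i, (tnth y i : R) <> b i}.
  by apply: filter_forall => i; exact: hyperplane_null.
apply: filterS2 ae_a ae_b => y ya yb.
pose r k (i : 'I_n) := \int[leb]_s (itvind (a i) (b i) s * pois1 k.+1%:R^-1 (s - tnth y i)).
have rE k : cint mu (fun x => (\1_(box a b) x : R)%:C * (pois k.+1%:R^-1 x y)%:C) =
    (\prod_(i < n) r k i)%:C.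
  have e0 : 0 < k.+1%:R^-1 :> R by rewrite invr_gt0.
  have ii (i : 'I_n) : cintegrable leb
      (fun s => (itvind (a i) (b i) s * pois1 k.+1%:R^-1 (s - tnth y i))%:C).
    have [h _] := cintegrableZ (2 / k.+1%:R^-1)%:C (cintegrable_itvind (a i) (b i)).
    apply: (@cintegrable_le _ _ _ _ _ (fun s : measurableTypeR R => (2 / k.+1%:R^-1) * itvind (a i) (b i) s)).
    - apply: cmeas_real; apply: measurable_funM; first exact: measurable_itvind.
      have := measurable_pois1 (tnth y i) e0.
      by under eq_fun do rewrite -pois1N opprB.
    - move=> s; rewrite normc_real normrM mulrC.
      have i0 : 0 <= itvind (a i) (b i) s by have [->|->] := itvind01 (a i) (b i) s.
      rewrite (ger0_norm i0) ler_wpM2r// ger0_norm ?pois1_ge0//.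
      (* In dimension one [pois_le] is the bound of [pois1 e] by [2 / e]. *)
      by have := @pois_le R 1 k.+1%:R^-1 [tuple s] [tuple (tnth y i)] e0;
        rewrite /pois big_ord1 expr1.
    - by apply: eq_integrable h => // s _; rewrite /= mul0r subr0.
  have := (cint_prod_tnth ii).2; under [in RHS]eq_bigr do rewrite cint_real.
  rewrite -(rmorph_prod (real_complex R)) => <-; congr cint; apply/funext => x.
  rewrite box_indicE /pois -realcM -big_split /=.
  by rewrite (rmorph_prod (real_complex R)).
have cr : \prod_(i < n) r k i @[k --> \oo] --> (\1_(box a b) y : R).
  by rewrite box_indicE; apply: cvg_prodr => i; apply: cvg_pois1_itv.
under eq_fun do rewrite rE -realcB normc_real.
by apply/norm_cvg0P; apply/subr_cvg0.
Qed.

End boxes.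

(** * From boxes to all square-integrable functions *)

Section density.
Context {R : realType} {n : nat}.
Local Notation X := (Rn R n).
Local Notation mu := (@lebesgue_Rn R n).
Implicit Types (f g u : X -> R[i]).

Definition boxes : set (set X) := [set box a b | a in setT & b in setT].

Lemma boxesI : setI_closed boxes.
Proof.
move=> _ _ [a _ [b _ <-]] [a' _ [b' _ <-]].
exists (fun i => Num.max (a i) (a' i)) => //.
exists (fun i => Num.min (b i) (b' i)) => //.
apply/seteqP; split => x; rewrite /box /=.
  move=> h; split=> i; have := h i; rewrite gt_max lt_min.
    by move=> /andP[/andP[-> _] /andP[-> _]].
  by move=> /andP[/andP[_ ->] /andP[_ ->]].
by move=> [h h'] i; rewrite gt_max lt_min; move: (h i) (h' i) => /andP[-> ->] /andP[-> ->].
Qed.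

(** It is enough that the coordinates are measurable for the sigma-algebra of boxes, that is, that a
    half-space is a countable union of boxes exhausting it. *)
Lemma measurable_boxes (A : set X) : measurable A -> <<s boxes >> A.
Proof.
move=> mA; pose T1 := g_sigma_algebraType boxes.
have : measurable_fun [set: T1] (id : T1 -> X).
  apply/measurable_fun_tnthP => i.
  apply: (measurability _ (RGenOInfty.measurableE R)) => _ [_ [c ->] <-].
  rewrite setTI (_ : _ @^-1` _ = \bigcup_N box (fun j => if j == i then c else - N%:R) (fun=> N%:R)).
    apply: bigcupT_measurable => N; apply: sub_sigma_algebra.
    by eexists => //; eexists => //.
  apply/seteqP; split=> x /=; rewrite in_itv/= andbT.
    move=> cx; pose M := (\sum_j `|tnth x j : R|).
    have Mj j : `|tnth x j : R| <= M by rewrite /M (bigD1 j)//= lerDl sumr_ge0.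
    have [N hN] : exists N : nat, M < N%:R.
      by exists (Num.bound M); rewrite archi_boundP// sumr_ge0.
    exists N => // j /=; have := le_lt_trans (Mj j) hN; rewrite ltr_norml => /andP[h1 h2].
    by rewrite h2 andbT; case: eqP => [->|].
  by move=> [N _ /(_ i)]; rewrite eqxx => /andP[].
by move=> /(_ measurableT A mA); rewrite setTI.
Qed.

Definition cube (N : nat) : set X := box (fun=> - N%:R) (fun=> N%:R).

Lemma invertible0 : invertible (fun _ : X => 0).
Proof.
have := @invertible_box R n (fun=> 0) (fun=> 0); have := @invertible_box R n (fun=> 0) (fun=> 0).
move=> /(invertible_lin (- 1)) /[apply].
by congr invertible; apply/funext => x; rewrite mulN1r addNr.
Qed.

Lemma invertibleB f g : invertible f -> invertible g -> invertible (fun x => f x - g x).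
Proof.
move=> iF iG; have := invertible_lin (- 1) iG iF.
by congr invertible; apply/funext => x; rewrite mulN1r addrC.
Qed.

Lemma inL2_indicI (A : set X) N : measurable A ->
  inL2 mu (fun x => (\1_(A `&` cube N) x : R)%:C).
Proof.
move=> mA; apply: inL2_le (box_inL2 (fun=> - N%:R) (fun=> N%:R)).
  by apply/cmeas_real/measurable_indic; apply: measurableI => //; exact: measurable_box.
move=> x; rewrite !normc_indic indicI /=.
by have [->|->] := indic01 R A x; rewrite ?mul0r ?mul1r// ?mul0rn.
Qed.

(** Dynkin's argument: the good sets form a lambda-system containing the boxes, which are closed
    under intersection. The intersection with a cube keeps all indicators in [L^2] and dominates the
    increasing unions. *)
Lemma invertible_indic (A : set X) N : measurable A ->
  invertible (fun x => (\1_(A `&` cube N) x : R)%:C).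
Proof.
move=> mA; pose H := [set B : set X | measurable B /\
  invertible (fun x => (\1_(B `&` cube N) x : R)%:C)].
suff : <<s boxes >> `<=` H by move=> /(_ A (measurable_boxes mA))[].
have mC : measurable (cube N) by exact: measurable_box.
apply: lambda_system_subset; [exact: boxesI| | |by []].
- split => //.
  + by split => //; rewrite setTI; exact: invertible_box.
  + move=> B C CB [mB iB] [mC' iC]; split; first exact: measurableD.
    have := invertibleB iB iC; congr invertible; apply/funext => x.
    rewrite -realcB; congr (_%:C); have [Cx|nCx] := pselect (C x).
      rewrite (indicF (A := (B `\` C) `&` cube N)); last by move=> [[]].
      have [Kx|nKx] := pselect (cube N x).
        by rewrite !indicT ?subrr//; split => //; exact: CB.
      by rewrite !indicF ?subrr// => -[].
    rewrite (indicF (A := C `&` cube N)) ?subr0; last by move=> [].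
    have [[Bx Kx]|nBKx] := pselect ((B `&` cube N) x); first by rewrite !indicT.
    by rewrite !indicF// => -[[Bx _] Kx]; apply: nBKx.
  + move=> F ndF FH; have mF k := (FH k).1.
    have mU : measurable (\bigcup_k F k) by exact: bigcupT_measurable.
    split => //; apply: (invertible_closed (fun k => (FH k).2)).
      exact: inL2_indicI.
    apply: (sq2_dominated (g := fun x => (\1_(cube N) x : R)%:C)).
    * by move=> k; exact: (inL2_indicI N (mF k)).1.
    * exact: (inL2_indicI N mU).1.
    * apply: aeW => x; apply: cvg_near_cst.
      have [[k0 _ Fx]|Ux] := pselect ((\bigcup_k F k) x).
        exists k0 => // k /= k0k.
        have Fkx : F k x by move: x Fx; exact/subsetPset/ndF.
        rewrite !indicIE (indicT Fkx) (indicT (A := \bigcup_k F k)); last by exists k.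
        by rewrite subrr normc0.
      apply: nearW => k; rewrite !indicIE (indicF Ux) (indicF (A := F k)).
        by rewrite !mul0r subrr normc0.
      by move=> Fkx; apply: Ux; exists k.
    * exact: (@box_inL2 R n (fun=> - N%:R) (fun=> N%:R)).
    * move=> k x; rewrite -realcB normc_real.
      rewrite normc_indic !indicIE -mulrBl normrM [X in _ * X]ger0_norm// ler_piMl//.
      by have [->|->] := indic01 R (F k) x; have [->|->] := indic01 R (\bigcup_k F k) x;
        rewrite ?subrr ?subr0 ?sub0r ?normrN ?normr0 ?normr1.
- move=> _ [a _ [b _ <-]]; split; first exact: measurable_box.
  have [c [d ->]] : exists c d, box a b `&` cube N = box c d.
    have [||c _ [d _ <-]] := @boxesI (box a b) (cube N); last by exists c, d.
      by exists a => //; exists b.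
    by exists (fun=> - N%:R) => //; exists (fun=> N%:R).
  exact: invertible_box.
Qed.

(* Cutting a level set of g to a cube makes it integrable. *)
Lemma invertible_nnsfun (g : {nnsfun X >-> R}) N :
  invertible (fun x : X => (g x * \1_(cube N) x : R)%:C).
Proof.
have E : (fun x : X => (g x * \1_(cube N) x : R)%:C) = (fun x =>
    \sum_(r <- finmap.enum_fset (fset_set (range g))) r%:C * (\1_(g @^-1` [set r] `&` cube N) x : R)%:C).
  apply/funext => x; rewrite {1}fimfunE fsbig_finite//= mulr_suml.
  rewrite (rmorph_sum (real_complex R)); apply: eq_bigr => r _.
  by rewrite /= indicIE -realcM mulrA.
rewrite E; elim: (finmap.enum_fset _) => [|r s ih].
  by under eq_fun do rewrite big_nil; exact: invertible0.
under eq_fun do rewrite big_cons; apply: invertible_lin => //.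
exact: invertible_indic.
Qed.

Lemma inL2_cubeM (g : X -> R) N (M : R) : measurable_fun setT g ->
  (forall x, `|g x| <= M) -> inL2 mu (fun x : X => (g x * \1_(cube N) x : R)%:C).
Proof.
move=> mg gM; have := inL2Z M%:C (@box_inL2 R n (fun=> - N%:R) (fun=> N%:R)).
apply: inL2_le.
  apply: cmeas_indicM => //; exact: measurable_box.
move=> x; rewrite normcM normc_indic !normc_real normrM [`|\1_ _ _|]ger0_norm//.
by apply: ler_wpM2r => //; rewrite (le_trans (gM x))// ler_norm.
Qed.

Lemma invertible_bounded (g : X -> R) N (M : R) : measurable_fun setT g ->
  (forall x, 0 <= g x) -> (forall x, g x <= M) ->
  invertible (fun x : X => (g x * \1_(cube N) x : R)%:C).
Proof.
move=> mg g0 gM; have mge : measurable_fun setT (EFin \o g) by exact/measurable_EFinP.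
pose s := nnsfun_approx measurableT mge.
have sg k x : s k x <= g x.
  by rewrite -lee_fin /s nnsfun_approxE; apply: (le_approx (f := EFin \o g)) => //= y _; rewrite lee_fin.
have s0 k x : 0 <= s k x by [].
have gM' x : `|g x| <= M by rewrite ger0_norm.
apply: (invertible_closed (f_ := fun k x => (s k x * \1_(cube N) x : R)%:C)).
- by move=> k; exact: invertible_nnsfun.
- exact: inL2_cubeM mg gM'.
have hE k x : normc ((s k x * \1_(cube N) x : R)%:C - (g x * \1_(cube N) x : R)%:C) =
    (g x - s k x) * \1_(cube N) x.
  by rewrite -realcB normc_real -mulrBl normrM [`|\1_ _ _|]ger0_norm// distrC ger0_norm// subr_ge0.
apply: (sq2_dominated (g := fun x => (g x * \1_(cube N) x : R)%:C)).
- move=> k; apply: cmeas_indicM => //; exact: measurable_box.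
- exact: (inL2_cubeM N mg gM').1.
- apply: aeW => x; under eq_fun do rewrite hE.
  have sx : s k x @[k --> \oo] --> g x.
    by have := cvg_nnsfun_approx measurableT mge (fun x _ => g0 x) (x := x) I => /fine_cvg.
  suff : (g x - s k x) * \1_(cube N) x @[k --> \oo] --> (g x - g x) * \1_(cube N) x.
    by rewrite subrr mul0r.
  by apply: cvgM; [apply: cvgB => //; exact: cvg_cst|exact: cvg_cst].
- exact: inL2_cubeM mg gM'.
- move=> k x; rewrite hE normc_real ger0_norm ?mulr_ge0//.
  by rewrite ler_wpM2r// gerBl.
Qed.

Lemma invertible_real (g : X -> R) : inL2 mu (fun x => (g x)%:C) ->
  (forall x, 0 <= g x) -> invertible (fun x => (g x)%:C).
Proof.
move=> Lg g0; have mg : measurable_fun setT g by case: Lg => -[].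
pose t (k : nat) x := Num.min (g x) k%:R.
have mt k : measurable_fun setT (t k) by apply: measurable_minr => //; exact: measurable_cst.
have t0 k x : 0 <= t k x by rewrite /t le_min g0 /= ler0n.
have tg k x : t k x <= g x by rewrite /t ge_min lexx.
apply: (invertible_closed (f_ := fun k x => (t k x * \1_(cube k) x : R)%:C)) => //.
  move=> k; apply: (@invertible_bounded _ _ k%:R) => // x.
  by rewrite /t ge_min lexx orbT.
have iB k x : 0 <= g x - t k x * \1_(cube k) x <= g x.
  have [->|->] := indic01 R (cube k) x; first by rewrite mulr0 subr0 g0 lexx.
  by rewrite mulr1 subr_ge0 tg gerBl t0.
apply: (sq2_dominated (g := fun x => (g x)%:C)) => //.
- move=> k; apply: cmeas_indicM => //; exact: measurable_box.
- exact: Lg.1.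
- apply: aeW => x; apply: cvg_near_cst.
  (* [M] dominates both the value at [x] and all coordinates of [x]. Beyond it neither the
     truncation in height nor the one in space acts, so the sequence is eventually constant. *)
  pose M := g x + \sum_j `|tnth x j : R|.
  have Mj j : `|tnth x j : R| <= M.
    by rewrite /M (bigD1 j)//= addrCA lerDl addr_ge0// sumr_ge0.
  have gM : g x <= M by rewrite lerDl sumr_ge0.
  have M0 : 0 <= M by apply: le_trans gM.
  exists (Num.bound M) => // k /= Mk.
  have Mk' : M < k%:R by apply: lt_le_trans (archi_boundP M0) _; rewrite ler_nat.
  rewrite indicT.
    rewrite /t min_l ?mulr1 ?subrr ?normc0//.
    by rewrite (le_trans gM)// ltW.
  by move=> j; have := le_lt_trans (Mj j) Mk'; rewrite ltr_norml.
- move=> k x; rewrite -realcB !normc_real distrC.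
  have /andP[h1 h2] := iB k x; rewrite !ger0_norm//.
Qed.

Lemma inL2_invertible f : inL2 mu f -> invertible f.
Proof.
move=> Lf; have [[mr mi] _] := Lf.
have part (h : X -> R) : measurable_fun setT h -> (forall x, `|h x| <= normc (f x)) ->
    invertible (fun x => (h x)%:C).
  move=> mh hf.
  have P (h' : X -> R) : measurable_fun setT h' -> (forall x, 0 <= h' x <= `|h x|) ->
      invertible (fun x => (h' x)%:C).
    move=> mh' h'0; apply: invertible_real => [|x]; last by case/andP: (h'0 x).
    apply: inL2_le Lf; first exact: cmeas_real.
    move=> x; case/andP: (h'0 x) => h1 h2.
    by rewrite normc_real ger0_norm// (le_trans h2).
  have h1 := P (fun x => Num.max (h x) 0) _ _; have h2 := P (fun x => Num.max (- h x) 0) _ _.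
  have := invertibleB (h1 _ _) (h2 _ _).
  rewrite (_ : (fun x => _) = (fun x => (h x)%:C)).
    apply.
    - exact: measurable_maxr.
    - by move=> x; rewrite le_max lexx orbT ge_max ler_norm normr_ge0.
    - by apply: measurable_maxr => //; exact: measurable_funN.
    - by move=> x; rewrite le_max lexx orbT ge_max -normrN ler_norm normr_ge0.
  apply/funext => x; rewrite -realcB; congr (_%:C).
  have [h0|h0] := leP 0 (h x).
    by have [|] := leP (- h x) 0; lra.
  by have [|] := leP (- h x) 0; lra.
have := invertible_lin 'i (part _ mi (fun x => normr_Im_le (f x)))
  (part _ mr (fun x => normr_Re_le (f x))).
congr invertible; apply/funext => x.
by apply: complex_eqP; rewrite ?ReD ?ImD ?ReM ?ImM /=; ring.
Qed.

End density.

(** * Inversion and surjectivity on [L^2] *)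

Section fourier_inversion.
Context {R : realType} {n : nat}.
Local Notation X := (Rn R n).
Local Notation mu := (@lebesgue_Rn R n).
Implicit Types (f g u : X -> R[i]) (x y xi : X).

Lemma aeq_sym f g : aeq f g -> aeq g f.
Proof. by apply: filterS => x /= h /h. Qed.

Lemma aeq_trans f g u : aeq f g -> aeq g u -> aeq f u.
Proof. by apply: filterS2 => x /= h1 h2 T; rewrite h1// h2. Qed.

Lemma is_fourier_fourier f : inL2 mu f -> is_fourier f (fourier f).
Proof.
move=> /is_fourier_exists[g fg].
exact: (@xgetPex _ (cst 0) [set g | is_fourier f g] (ex_intro _ g fg)).
Qed.

Lemma inL2_fourier f : inL2 mu f -> inL2 mu (fourier f).
Proof. by move=> /is_fourier_fourier/is_fourier_L2r. Qed.

Lemma fourier_is_fourier f g : is_fourier f g -> aeq (fourier f) g.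
Proof.
move=> fg; apply: (is_fourier_unique (is_fourier_fourier (is_fourier_L2l fg)) fg).
exact: aeW.
Qed.

Lemma is_fourier_inv f g : is_fourier f g ->
  is_fourier (fun x => (g x)^*) (fun x => (f x)^*).
Proof.
move=> fg; have [g' [fg' gf']] := inL2_invertible (is_fourier_L2l fg).
have gg' : aeq g' g by apply: (is_fourier_unique fg' fg); exact: aeW.
apply: (is_fourier_aeq gf').
- exact/cmeasJ/(is_fourier_L2r fg).1.
- exact/cmeasJ/(is_fourier_L2l fg).1.
- by apply: filterS gg' => x /= h /h ->.
- exact: aeW.
Qed.

Lemma is_fourier_surj g : inL2 mu g -> exists f, is_fourier f g.
Proof.
move=> Lg; have h := is_fourier_inv (is_fourier_fourier (inL2J Lg)).
exists (fun x => (fourier (fun y => (g y)^*) x)^*).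
by move: h; congr is_fourier; apply/funext => x; rewrite conjcK.
Qed.

Definition ifourier1 g x : R[i] := (fourier1 (fun xi => (g xi)^*) x)^*.

Lemma ifourier1E g x : cintegrable mu g ->
  ifourier1 g x = cint mu (fun xi => g xi * (wave x xi)^*).
Proof.
move=> ig; rewrite /ifourier1 fourier1E -cintJ; last by apply: cintegrable_waveM; exact: cintegrableJ.
by congr cint; apply/funext => xi; rewrite conjcM conjcK waveC.
Qed.

Lemma ifourier1_origin g : cintegrable mu g -> ifourier1 g (@origin R n) = cint mu g.
Proof.
move=> ig; rewrite ifourier1E//; congr cint; apply/funext => xi.
rewrite /wave (_ : dot _ _ = 0) ?mulr0 ?expNi0 ?conjc1 ?mulr1//.
by apply: big1 => i _; rewrite tnth_mktuple mul0r.
Qed.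

Lemma is_fourier_ifourier1 f g : is_fourier f g -> cintegrable mu g -> aeq f (ifourier1 g).
Proof.
move=> fg ig; have gf := is_fourier_inv fg.
have := is_fourier_L1 (cintegrableJ ig) (is_fourier_L2l gf).
move=> /(is_fourier_unique gf)/(_ (aeW _ (fun x _ => erefl))).
by apply: filterS => x /= e /e /(congr1 (@conjc R)); rewrite conjcK.
Qed.

End fourier_inversion.

(** * Continuous representatives and point values *)

Section continuity.
Context {R : realType}.

Lemma lipschitz1 (F f : R -> R) : (forall x : R, is_derive x (1 : R) F (f x)) ->
  (forall x, `|f x| <= 1) -> forall a b, `|F a - F b| <= `|a - b|.
Proof.
move=> dF f1 a b; wlog ab : a b / a <= b.
  by move=> h; have [/h//|/ltW/h] := leP a b; rewrite distrC (distrC b).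
have [|c _] := @MVT_segment R F f a b ab (fun x _ => dF x).
  exact/continuous_subspaceT/(is_derive_continuous dF).
by rewrite distrC (distrC a) => ->; rewrite normrM ler_piMl.
Qed.

Lemma normc_expNiB (a b : R) : normc (expNi a - expNi b) <= 2 * `|a - b|.
Proof.
apply: le_trans (normc_le_ReIm _) _; rewrite mulr2n mulrDl mul1r ReD ImD ReN ImN.
apply: lerD; last rewrite /= -opprD normrN.
  by apply: (@lipschitz1 cos (fun x => - sin x)) => x; rewrite normrN ler_norml sin_geN1 sin_le1.
by apply: (@lipschitz1 sin cos) => x; rewrite ler_norml cos_geN1 cos_le1.
Qed.

Context {n : nat}.
Local Notation X := (Rn R n).
Local Notation mu := (@lebesgue_Rn R n).
Implicit Types (f g u : X -> R[i]) (x y xi : X).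

Lemma continuousC_ed f : (forall x (e : R), 0 < e -> exists2 d : R, 0 < d &
    forall y, (forall i, `|tnth x i - tnth y i : R| < d) -> normc (f x - f y) < e) ->
  continuousC f.
Proof.
move=> h.
suff H (p : R[i] -> R) : (forall z w, p (z - w) = p z - p w) -> (forall z, `|p z| <= normc z) ->
    continuous (p \o (fun v : 'rV[R]_n => f [tuple v ord0 i | i < n])).
  by split; apply: H; [exact: raddfB|exact: normr_Re_le|exact: raddfB|exact: normr_Im_le].
move=> pB pn v; apply/(@cvgrPdist_lt _ _ _ (nbhs v)) => e e0.
have [d d0 hd] := h [tuple v ord0 i | i < n] e e0.
apply/nbhs_ballP; exists d => //= w [_ vw].
rewrite -pB (le_lt_trans (pn _))//; apply: hd => i; rewrite !tnth_mktuple.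
exact: vw.
Qed.

Lemma continuousC_ifourier1 g : cintegrable mu g -> continuousC (ifourier1 g).
Proof.
move=> ig; have mg := cintegrable_meas ig; apply: continuousC_ed => x e e0.
pose S xi : R := \sum_(i < n) `|tnth xi i : R|.
have S0 xi : 0 <= S xi by exact: sumr_ge0.
(* [w k] bounds the difference of the integrands at [x] and [y] when all coordinates differ by less
   than [1/(k+1)]: 2 is the trivial bound for two waves, the other term is their Lipschitz bound.
   Dominated convergence makes its integral small, and [1/(k+1)] serves as the radius. *)
pose w k xi : R := normc (g xi) * Num.min 2 (4 * pi * S xi * k.+1%:R^-1).
have w0 k xi : 0 <= w k xi.
  by rewrite mulr_ge0 ?normc_ge0// le_min ler0n !mulr_ge0 ?pi_ge0 ?invr_ge0.
have mS : measurable_fun setT S.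
  apply: measurable_sum => i; apply: measurableT_comp => //; exact: measurable_tnth.
have mw k : measurable_fun setT (w k).
  apply: measurable_funM; first exact: measurable_normc.
  by apply: measurable_minr => //; do 2 (apply: measurable_funM => //).
have iw2 : mu.-integrable setT (EFin \o (fun xi => 2 * normc (g xi))).
  by have := integrable_normc (cintegrableZ 2%:C ig);
    apply: eq_integrable => // xi _; rewrite /= normcM normc_real ger0_norm.
have w2 k xi : w k xi <= 2 * normc (g xi).
  by rewrite /w mulrC ler_wpM2r ?normc_ge0// ge_min lexx.
have cw : (\int[mu]_xi (w k xi)%:E @[k --> \oo] --> 0)%E.
  have := @dominated_convergence _ _ R mu setT measurableT (fun k xi => (w k xi)%:E) (fun=> 0%E)
    (EFin \o (fun xi => 2 * normc (g xi))) _ _ _ iw2 _.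
  case.
  - by move=> k; exact/measurable_EFinP.
  - exact: measurable_cst.
  - apply: aeW => xi _; apply/fine_cvgP; split; first exact: nearW.
    have h : 4 * pi * S xi * k.+1%:R^-1 @[k --> \oo] --> (4 * pi * S xi * 0 : R).
      apply: cvgM; first exact: cvg_cst.
      exact: (@cvg_harmonic R).
    have h2 : normc (g xi) * (4 * pi * S xi * k.+1%:R^-1) @[k --> \oo] --> (0 : R).
      rewrite -[X in _ --> X](mulr0 (normc (g xi))); apply: cvgM; first exact: cvg_cst.
      by move: h; rewrite mulr0.
    apply: (squeeze_cvgr _ (cvg_cst (0 : R)) h2).
    by apply: nearW => k; rewrite /= w0/= ler_wpM2l ?normc_ge0// ge_min lexx orbT.
  - by apply: aeW => xi k _; rewrite /= ger0_norm ?w0// lee_fin.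
  by move=> _ _; rewrite integral0.
have wi k : (0 <= \int[mu]_xi (w k xi)%:E)%E.
  by apply: integral_ge0 => xi _; rewrite lee_fin.
have := (ge0_cvge0P wi).1 cw (e / 2).
case; first by rewrite divr_gt0.
move=> k _ /(_ k (leqnn k)) hk; exists k.+1%:R^-1; first by rewrite invr_gt0 ltr0n.
move=> y xy; rewrite !ifourier1E//.
have iW z : cintegrable mu (fun xi => g xi * (wave z xi)^*).
  have := cintegrableJ (cintegrable_waveM z (cintegrableJ ig)).
  by congr cintegrable; apply/funext => xi; rewrite conjcM conjcK waveC.
rewrite -cintB// -lte_fin; apply: le_lt_trans (le_normc_cint (cintegrableB (iW x) (iW y))) _.
apply: (@le_lt_trans _ _ (e / 2)%:E); last by rewrite lte_fin ltr_pdivrMr//; lra.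
apply: le_trans hk; apply: ge0_le_integral => //.
- by move=> xi _; rewrite lee_fin normc_ge0.
- exact/measurable_EFinP/measurable_normc/(cintegrable_meas (cintegrableB (iW x) (iW y))).
- exact/measurable_EFinP.
move=> xi _; rewrite lee_fin -mulrBr normcM -conjcB normc_conj ler_wpM2l ?normc_ge0//.
rewrite le_min; apply/andP; split.
  by rewrite (le_trans (le_normcD _ _))// normcN !normc_wave.
apply: le_trans (normc_expNiB _ _) _; rewrite -mulrBr normrM ger0_norm ?mulr_ge0 ?pi_ge0//.
rewrite (_ : 4 * pi * S xi * _ = 2 * (2 * pi * (S xi * k.+1%:R^-1))); last by ring.
apply: ler_wpM2l => //; apply: ler_wpM2l; first by rewrite mulr_ge0 ?pi_ge0.
have -> : dot x xi - dot y xi = \sum_(i < n) (tnth x i * tnth xi i - tnth y i * tnth xi i).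
  by rewrite /dot -sumrN -big_split.
rewrite mulr_suml; apply: le_trans (ler_norm_sum _ _ _) _; apply: ler_sum => i _.
by rewrite -mulrBl normrM mulrC ler_wpM2l// ltW.
Qed.

Lemma box_measure_gt0 (a b : 'I_n -> R) : (forall i, a i < b i) -> (0 < mu (box a b))%E.
Proof.
move=> ab.
have := cint_prod_tnth (fun i => cintegrable_itvind (a i) (b i)) => -[_].
have -> : (fun x : X => \prod_(i < n) (itvind (a i) (b i) (tnth x i))%:C) =
    (fun x => (\1_(box a b) x : R)%:C).
  by apply/funext => x; rewrite box_indicE (rmorph_prod (real_complex R)).
under eq_bigr do rewrite cint_real.
rewrite cint_real -(rmorph_prod (real_complex R)) => /(congr1 (@complex.Re R))/= E.
have : 0 < \prod_(i < n) \int[lebesgue_measure]_t (itvind (a i) (b i) t : R).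
  apply: prodr_gt0 => i _; rewrite /Rintegral /itvind integral_indic//= ?setIT//.
  by rewrite lebesgue_measure_itv/= lte_fin ab -EFinB/= subr_gt0.
rewrite -E /Rintegral integral_indic ?setIT//; last exact: measurable_box.
rewrite lt0e measure_ge0 andbT lt_neqAle => /andP[/eqP h _].
by apply/eqP => /(congr1 fine)/esym/h.
Qed.

(** If the values differed at [x] they would differ on a box around [x], which has positive measure.
    This makes the choice in [cont_rep] unique. *)
Lemma continuousC_aeq f g : continuousC f -> continuousC g -> aeq f g -> f = g.
Proof.
move=> [cf1 cf2] [cg1 cg2] [N [mN N0 fN]].
suff H (p : R[i] -> R) :
    continuous (p \o (fun v : 'rV[R]_n => f [tuple v ord0 i | i < n])) ->
    continuous (p \o (fun v : 'rV[R]_n => g [tuple v ord0 i | i < n])) ->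
    forall x, p (f x) = p (g x).
  by apply/funext => x; apply: complex_eqP; apply: H.
move=> cf cg x; apply: contrapT => /eqP pfg.
pose v : 'rV[R]_n := \row_i tnth x i.
have vE : [tuple v ord0 i | i < n] = x.
  by apply: eq_from_tnth => i; rewrite tnth_mktuple mxE.
have fv : Filter (nbhs v) by exact: nbhs_filter.
have := (@cvgrPdist_lt _ _ _ (nbhs v) fv _ _).1 (@cvgB _ _ _ (nbhs v) fv _ _ _ _ (cf v) (cg v)) `|p (f x) - p (g x)|.
rewrite /= vE normr_gt0 subr_eq0 => /(_ pfg)/nbhs_ballP[d /= d0 hd].
have bN : box (fun i => tnth x i - d) (fun i => tnth x i + d) `<=` N.
  move=> y yb; apply: fN => /= /(_ Logic.I) fgy.
  have := hd (\row_i tnth y i); rewrite /= !fctE /=.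
  have -> : [tuple (\row_j tnth y j) ord0 i | i < n] = y.
    by apply: eq_from_tnth => i; rewrite tnth_mktuple mxE.
  rewrite fgy subrr subr0 ltxx => hy.
  suff // : ball v d (\row_i tnth y i) by move=> /hy.
  split => // i j; rewrite !mxE /ball/= ltr_distlC.
  by have := yb j.
have := box_measure_gt0 (a := fun i => tnth x i - d) (b := fun i => tnth x i + d).
move=> /(_ _)/wrap[i|]; first by lra.
apply/negP; rewrite -leNgt -N0; apply: le_measure => //; rewrite ?inE//; exact: measurable_box.
Qed.

Lemma cont_rep_eq f g : continuousC g -> aeq f g -> cont_rep f = g.
Proof.
move=> cg fg; rewrite /cont_rep; case: xgetP => [g' _ [cg' fg']|/(_ g)].
  apply: continuousC_aeq => //; apply: aeq_trans fg; exact: aeq_sym.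
by case.
Qed.

(** This turns the delta interaction into a rank-one perturbation of a multiplication operator. *)
Lemma at0_is_fourier f g : is_fourier f g -> cintegrable mu g -> at0 f = cint mu g.
Proof.
move=> fg ig.
by rewrite /at0 (cont_rep_eq (continuousC_ifourier1 ig) (is_fourier_ifourier1 fg ig))
  ifourier1_origin.
Qed.

End continuity.

Lemma Rintegral_gt0 d (T : measurableType d) (R : realType) (mu : {measure set T -> \bar R})
  (f : T -> R) : (0 < mu setT)%E -> (forall x, 0 < f x) ->
  mu.-integrable setT (EFin \o f) -> 0 < \int[mu]_x f x.
Proof.
move=> mu0 f0 fi; rewrite lt_neqAle Rintegral_ge0 ?andbT; last by move=> x _; exact: ltW.
apply/eqP => /esym f10.
have : ae_eq mu setT (EFin \o f) (cst 0%E).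
  apply/(ae_eq_integral_abs mu measurableT); first exact: measurable_int fi.
  under eq_integral do rewrite /= ger0_norm ?(ltW (f0 _))//.
  by rewrite -[LHS]fineK; [congr EFin|exact: integrable_fin_num].
move=> [N [mN N0 fN]]; move: mu0; rewrite (_ : setT = N) ?N0 ?ltxx//.
apply/seteqP; split => // x _; apply: fN => /= /(_ Logic.I) [] fx.
by have := f0 x; rewrite fx ltxx.
Qed.

(** * The abstract spectral problem *)

Section spectral_problem.
Context d (T : measurableType d) {R : realType} (mu : {measure set T -> \bar R}).
Context (m : T -> R) (w : R) (mm : measurable_fun setT m) (w0 : 0 < w)
  (wm : forall x, w <= m x) (im1 : mu.-integrable setT (EFin \o (fun x => (m x)^-1))).
Implicit Types (p q : T -> R[i]) (c : R).

Let m0 x : 0 < m x. Proof. exact: lt_le_trans (wm x). Qed.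

(** The form domain. For [m = symb s w], [HsobE] identifies it with the transforms of functions in
    [H^s]. *)
Definition finE p := inL2 mu (fun x => (Num.sqrt (m x))%:C * p x).
Definition energy p q : R[i] := cint mu (fun x => (m x)%:C * p x * (q x)^*).
Definition ip p q : R[i] := cint mu (fun x => p x * (q x)^*).
(** The image of [delta_op] under the transform. Neither term need be square integrable by itself:
    the operator domain requires it of the difference. *)
Definition op c p x : R[i] := (m x)%:C * p x - c%:C * cint mu p.
Definition form c p q : R[i] := energy p q - c%:C * cint mu p * (cint mu q)^*.

Let sqrtm x : (Num.sqrt (m x))%:C * (Num.sqrt (m x))%:C = (m x)%:C.
Proof. by rewrite -realcM -expr2 sqr_sqrtr// ltW. Qed.

Let msqrtm : measurable_fun setT (fun x => Num.sqrt (m x)).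
Proof. by apply: (measurableT_comp (continuous_measurable_fun (@sqrt_continuous R))). Qed.

Let inv_mx_ge0 x : 0 <= (m x)^-1. Proof. by rewrite invr_ge0 ltW. Qed.

Let measurable_inv (f : T -> R) : (forall x, 0 < f x) -> measurable_fun setT f ->
  measurable_fun setT (fun x => (f x)^-1).
Proof.
move=> f0 mf; rewrite (_ : (fun x => _) = (fun x => f x `^ (-1))).
  exact: (measurableT_comp (measurable_powR (-1)) mf).
by apply/funext => x; rewrite powR_inv1// ltW.
Qed.

Let inL2_invsqrtm : inL2 mu (fun x => ((Num.sqrt (m x))^-1)%:C).
Proof.
split; first by apply: cmeas_real; apply: measurable_inv => // x; rewrite sqrtr_gt0.
rewrite /sq2; under eq_integral do rewrite normc_real real_normK ?num_real// exprVn sqr_sqrtr ?ltW//.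
exact: integrable_lty im1.
Qed.

Lemma finE_meas p : finE p -> cmeas p.
Proof.
move=> [mp _]; have := cmeasM inL2_invsqrtm.1 mp; congr cmeas; apply/funext => x.
by rewrite mulrA -realcM mulVf ?mul1r// gt_eqF// sqrtr_gt0.
Qed.

(** [p] is the product of [m^(-1/2)] and [m^(1/2) p], both in [L^2]. Integrability of [1/m] thus
    gives a meaning to the value at the origin on the whole form domain. *)
Lemma finE_cint p : finE p -> cintegrable mu p.
Proof.
move=> fp; have := inL2M_cintegrable inL2_invsqrtm fp; congr cintegrable.
apply/funext => x; by rewrite mulrA -realcM mulVf ?mul1r// gt_eqF// sqrtr_gt0.
Qed.

Lemma finE_inL2 p : finE p -> inL2 mu p.
Proof.
move=> fp; apply: inL2_le (finE_meas fp) _ (inL2Z ((Num.sqrt w)^-1)%:C fp) => x.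
rewrite mulrA -realcM normcM normc_real ler_peMl ?normc_ge0//.
rewrite ger0_norm ?mulr_ge0 ?invr_ge0 ?sqrtr_ge0// mulrC ler_pdivlMr ?sqrtr_gt0// mul1r.
by rewrite ler_sqrt// ltW.
Qed.

Lemma finE_lin (z : R[i]) p q : finE p -> finE q -> finE (fun x => z * p x + q x).
Proof.
move=> fp fq; have := inL2D (inL2Z z fp) fq; congr inL2; apply/funext => x; ring.
Qed.

Lemma finEZ (z : R[i]) p : finE p -> finE (fun x => z * p x).
Proof. move=> fp; have := inL2Z z fp; congr inL2; apply/funext => x; ring. Qed.

Lemma finE_le p C : cmeas p -> (forall x, normc (p x) <= C * (m x)^-1) -> finE p.
Proof.
move=> mp pC; apply: inL2_le (inL2Z C%:C inL2_invsqrtm).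
  by apply/cmeasM/mp/cmeas_real.
move=> x; rewrite !normcM !normc_real [`|Num.sqrt _|]ger0_norm ?sqrtr_ge0//.
rewrite [`|_^-1|]ger0_norm ?invr_ge0 ?sqrtr_ge0//.
have s0 : 0 < Num.sqrt (m x) by rewrite sqrtr_gt0.
apply: (@le_trans _ _ (Num.sqrt (m x) * (C * (m x)^-1))); first by rewrite ler_wpM2l// ltW.
rewrite -[in (m x)^-1](sqr_sqrtr (ltW (m0 x))).
rewrite (_ : Num.sqrt (m x) * _ = C * (Num.sqrt (m x))^-1); last by field; rewrite gt_eqF.
by apply: ler_wpM2r; [rewrite invr_ge0 ltW|exact: ler_norm].
Qed.

Lemma cintegrable_energy p q : finE p -> finE q ->
  cintegrable mu (fun x => (m x)%:C * p x * (q x)^*).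
Proof.
move=> fp fq; have := inL2M_cintegrable fp (inL2J fq); congr cintegrable.
apply/funext => x; rewrite conjcM -sqrtm (_ : (_%:C)^* = (Num.sqrt (m x))%:C); first by ring.
by apply: complex_eqP; rewrite /= ?oppr0.
Qed.

Lemma cintegrable_ip p q : finE p -> finE q -> cintegrable mu (fun x => p x * (q x)^*).
Proof. by move=> /finE_inL2 Lp /finE_inL2 Lq; apply: inL2M_cintegrable => //; exact: inL2J. Qed.

Lemma cint_lin (z : R[i]) p q : cintegrable mu p -> cintegrable mu q ->
  cint mu (fun x => z * p x + q x) = z * cint mu p + cint mu q.
Proof. by move=> ip iq; rewrite cintD ?cintZ//; exact: cintegrableZ. Qed.

Lemma energy_lin (z : R[i]) p p' q : finE p -> finE p' -> finE q ->
  energy (fun x => z * p x + p' x) q = z * energy p q + energy p' q.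
Proof.
move=> fp fp' fq; rewrite -cint_lin; [|exact: cintegrable_energy..].
by congr cint; apply/funext => x; ring.
Qed.

Let conjc_real c : (c%:C)^* = c%:C :> R[i].
Proof. by apply: complex_eqP; rewrite /= ?oppr0. Qed.

Let conjcN (z : R[i]) : (- z)^* = - z^*.
Proof. exact: (raddfN (@conjc R)). Qed.

Lemma energyC p q : finE p -> finE q -> energy q p = (energy p q)^*.
Proof.
move=> fp fq; rewrite -cintJ; last exact: cintegrable_energy.
by congr cint; apply/funext => x; rewrite !conjcM conjcK conjc_real; ring.
Qed.

Lemma ipC p q : finE p -> finE q -> ip q p = (ip p q)^*.
Proof.
move=> fp fq; rewrite -cintJ; last exact: cintegrable_ip.
by congr cint; apply/funext => x; rewrite conjcM conjcK mulrC.
Qed.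

Lemma ip_aeq p p' q : cmeas p -> cmeas p' -> cmeas q -> p = p' %[ae mu] -> ip p q = ip p' q.
Proof.
move=> mp mp' mq pp'; apply: aeq_cint; [exact/cmeasM/cmeasJ|exact/cmeasM/cmeasJ|].
by apply: filterS pp' => x /= h /h ->.
Qed.

Lemma energyE p : energy p p =
  (\int[mu]_x (normc ((Num.sqrt (m x))%:C * p x) ^+ 2))%:C.
Proof.
rewrite -cint_real; congr cint; apply/funext => x.
by rewrite normcM exprMn normc_real real_normK ?num_real// sqr_sqrtr ?ltW// realcM
  -mulrA mulc_conj.
Qed.

Lemma energy_ge0 p : 0 <= complex.Re (energy p p).
Proof. by rewrite energyE; apply: Rintegral_ge0 => x _; exact: sqr_ge0. Qed.

Lemma energy_eq0 p : finE p -> complex.Re (energy p p) = 0 -> p = (fun=> 0) %[ae mu].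
Proof.
rewrite energyE => -[mp p2] /= h.
have : sq2 mu (fun x => (Num.sqrt (m x))%:C * p x) = 0%E.
  by rewrite -[LHS]fineK ?ge0_fin_numE ?sq2_ge0//; congr EFin; exact: h.
move=> /(sq2_eq0 mp); apply: filterS => x /= e /e /eqP.
by rewrite mulf_eq0 realc_eq0 gt_eqF ?sqrtr_gt0//= => /eqP.
Qed.

Lemma form_lin c (z : R[i]) p p' q : finE p -> finE p' -> finE q ->
  form c (fun x => z * p x + p' x) q = z * form c p q + form c p' q.
Proof.
move=> fp fp' fq; rewrite /form energy_lin// cint_lin; [ring|exact: finE_cint..].
Qed.

Lemma formC c p q : finE p -> finE q -> form c q p = (form c p q)^*.
Proof.
move=> fp fq; rewrite /form conjcB (energyC fp fq) !conjcM conjcK conjc_real; ring.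
Qed.

Lemma ip_op c p q : finE p -> finE q -> ip (op c p) q = form c p q.
Proof.
move=> fp fq; rewrite /form /energy -cintJ; last exact: finE_cint.
rewrite -cintZ; last exact/cintegrableJ/finE_cint.
rewrite -cintB; [|exact: cintegrable_energy|exact/cintegrableZ/cintegrableJ/finE_cint].
by congr cint; apply/funext => x; rewrite /op; ring.
Qed.

Lemma cmeas_op c p : cmeas p -> cmeas (op c p).
Proof.
move=> mp; apply: cmeasB; last exact: (@cmeas_cst _ _ _ (c%:C * cint mu p)).
by apply: cmeasM => //; exact: cmeas_real.
Qed.

Lemma form_eq c p r q (z : R[i]) : finE p -> finE q -> finE r ->
  op c p = (fun x => z * r x) %[ae mu] -> form c p q = z * ip r q.
Proof.
move=> fp fq fr h; rewrite -ip_op// (ip_aeq _ _ _ h).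
- rewrite /ip -cintZ; last exact: cintegrable_ip.
  by congr cint; apply/funext => x; ring.
- exact/cmeas_op/finE_meas.
- by have := finE_meas (finEZ z fr).
- exact: finE_meas.
Qed.

(* The form is positive where the integral vanishes, a subspace of codimension one. *)
Lemma form_negative_codim1 c p q : finE p -> finE q -> form c p q = 0 ->
  complex.Re (form c p p) <= 0 -> complex.Re (form c q q) < 0 -> cint mu p != 0 -> False.
Proof.
(* [r] has integral 0, so its form equals its energy and is nonnegative. By orthogonality the form
   is also [|int q|^2 form p p + |int p|^2 form q q], which is negative. *)
move=> fp fq pq0 pp qq p0; pose r x := cint mu q * p x + (- cint mu p * q x).
have fNq : finE (fun x => - cint mu p * q x) by exact: finEZ.
have fr : finE r by exact: finE_lin.
have r0 : cint mu r = 0.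
  by rewrite /r cint_lin ?cintZ; [ring|exact: finE_cint..].
have qp0 : form c q p = 0 by rewrite (formC c fp fq) pq0 conjc0.
have form0 u : finE u -> form c (fun x => - cint mu p * q x) u = - cint mu p * form c q u.
  move=> fu; rewrite /form cintZ; last exact: finE_cint.
  rewrite /energy (_ : (fun x => _) = (fun x => - cint mu p * ((m x)%:C * q x * (u x)^*))).
    by rewrite cintZ; [ring|exact: cintegrable_energy].
  by apply/funext => x; ring.
have rp : form c r p = cint mu q * form c p p by rewrite form_lin// form0// qp0 mulr0 addr0.
have rq : form c r q = - cint mu p * form c q q by rewrite form_lin// form0// pq0 mulr0 add0r.
have rr : form c r r = (normc (cint mu q) ^+ 2)%:C * form c p p +
    (normc (cint mu p) ^+ 2)%:C * form c q q.
  rewrite {2}/r (formC c fr) ?form_lin ?form0//; try exact: finE_lin.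
  have := formC c fr fp; have := formC c fr fq; rewrite rp rq.
  move=> -> ->; rewrite !conjcD !conjcM !conjcK -!mulc_conj.
  by rewrite conjcN; ring.
have := energy_ge0 r; have -> : energy r r = form c r r by rewrite /form r0; ring.
have ReMr (a : R) (z : R[i]) : complex.Re (a%:C * z) = a * complex.Re z.
  by rewrite ReM /= mul0r subr0.
rewrite rr leNgt ReD !ReMr => /negP; apply; rewrite -(addr0 (0 : R)) ler_ltD//; first by rewrite mulr_ge0_le0 ?sqr_ge0.
rewrite nmulr_llt0// exprn_gt0// lt_neqAle normc_ge0 andbT eq_sym.
by apply: contra_neq p0 => /normc_eq0P.
Qed.

Definition rm (k : nat) : T -> R[i] := fun x => ((m x)^-1 ^+ k)%:C.
Definition moment (k : nat) : R := \int[mu]_x ((m x)^-1 ^+ k).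

Lemma cmeas_rm k : cmeas (rm k).
Proof. by apply: cmeas_real; apply: measurable_funX; exact: measurable_inv. Qed.

Lemma inv_mx_le x : (m x)^-1 <= w^-1.
Proof. by rewrite lef_pV2 ?posrE. Qed.

Lemma finE_rm k : finE (rm k.+1).
Proof.
apply: (@finE_le _ (w^-1 ^+ k)); first exact: cmeas_rm.
move=> x; rewrite normc_real ger0_norm ?exprn_ge0// exprSr ler_wpM2r//.
by rewrite lerXn2r ?nnegrE ?inv_mx_le// invr_ge0 ltW.
Qed.

Lemma cint_rm k : cint mu (rm k) = (moment k)%:C.
Proof. exact: cint_real. Qed.

Lemma energy_rml k q : energy (rm k.+1) q = ip (rm k) q.
Proof.
congr cint; apply/funext => x; rewrite -realcM exprS mulrA mulfV ?mul1r//.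
by rewrite gt_eqF.
Qed.

Lemma ip_rm j k : ip (rm j) (rm k) = (moment (j + k))%:C.
Proof.
rewrite -cint_rm; congr cint; apply/funext => x.
by rewrite /rm conjc_real -realcM exprD.
Qed.

Lemma ip_rm0 q : finE q -> ip (rm 0) q = (cint mu q)^*.
Proof.
move=> fq; rewrite -cintJ; last exact: finE_cint.
by congr cint; apply/funext => x; rewrite /rm expr0 mul1r.
Qed.

Lemma integrable_pow_inv k : mu.-integrable setT (EFin \o (fun x => (m x)^-1 ^+ k.+1)).
Proof. by have [] := finE_cint (finE_rm k). Qed.

Context (mu0 : (0 < mu setT)%E).

Lemma moment_gt0 k : 0 < moment k.+1.
Proof.
by apply: Rintegral_gt0 (integrable_pow_inv k) => // x; rewrite exprn_gt0// invr_gt0.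
Qed.

Let M1 : 0 < moment 1 := moment_gt0 0.

Context (K : R) (K1 : 1 < K).
(** The couplings of [L_-] and [L_+]: [K] stands for [2 sigma + 1], and [coefmE] identifies [cm]
    with [|phi(0)|^(2 sigma)]. *)
Let cm : R := (moment 1)^-1.
Let cp : R := K * cm.

Let cm_gt0 : 0 < cm. Proof. by rewrite invr_gt0. Qed.
Let cmM1 : cm * moment 1 = 1. Proof. by rewrite mulVf// gt_eqF. Qed.

(* Cauchy-Schwarz: the defect is the energy of the projection off 1/m. *)
Lemma form_minus p : finE p ->
  form cm p p = energy (fun x => - (cm%:C * cint mu p) * rm 1 x + p x)
                       (fun x => - (cm%:C * cint mu p) * rm 1 x + p x).
Proof.
move=> fp; have f1 := finE_rm 0; set z := - _; set r := fun x => _.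
have fr : finE r by exact: finE_lin.
have e1 q : finE q -> energy (rm 1) q = (cint mu q)^* by move=> fq; rewrite energy_rml ip_rm0.
rewrite energy_lin// e1// {2}/r (energyC fr fp) energy_lin// e1//.
have -> : cint mu r = z * (moment 1)%:C + cint mu p.
  by rewrite /r cint_lin ?cint_rm//; exact: finE_cint.
rewrite !conjcD !conjcM conjcK -(energyC fp fp) conjc_real /form.
have -> : z^* = - (cm%:C * (cint mu p)^*).
  by rewrite /z conjcN conjcM conjc_real.
have := cmM1 => /(congr1 (real_complex R)); rewrite rmorphM rmorph1 /= => h.
rewrite /z; ring: h.
Qed.

(** As [J (a, b) = (-b, a)], the equation [J L (p, q) = lambda (p, q)] reads [L_- p = lambda q] and
    [L_+ q = - lambda p]. *)
Definition eig (lambda : R[i]) p q := [/\ finE p, finE q,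
  op cm p = (fun x => lambda * q x) %[ae mu] &
  op cp q = (fun x => - lambda * p x) %[ae mu]].

Definition nullp p q := p = (fun=> 0) %[ae mu] /\ q = (fun=> 0) %[ae mu].

Section eigenpairs.
Context (lambda : R[i]) (p q : T -> R[i]) (epq : eig lambda p q).

Let fp : finE p. Proof. by case: epq. Qed.
Let fq : finE q. Proof. by case: epq. Qed.

Lemma eig_form1 u : finE u -> form cm p u = lambda * ip q u.
Proof. by case: epq => _ _ h _ fu; exact: form_eq h. Qed.

Lemma eig_form2 u : finE u -> form cp q u = - lambda * ip p u.
Proof. by case: epq => _ _ _ h fu; exact: form_eq h. Qed.

Context (lambda0 : 0 < complex.Re lambda) (nz : ~ nullp p q).

Let lambda_neq0 : lambda != 0.
Proof. by apply: contraTneq lambda0 => ->; rewrite ltxx. Qed.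

(** Otherwise [<L_- p, p> = lambda <q, p>] vanishes, and by [form_minus] [p] is a multiple of [1/m],
    hence in the kernel of [L_-]. The first equation then gives [q = 0] and the second [p = 0]. *)
Lemma eig_ip_neq0 : ip q p != 0.
Proof.
apply/eqP => q0; apply: nz.
have := eig_form1 fp; rewrite q0 mulr0 (form_minus fp) => /(congr1 (@complex.Re R)).
move=> /(energy_eq0 (finE_lin _ (finE_rm 0) fp)) h.
have opp0 : op cm p = (fun=> 0) %[ae mu].
  apply: filterS h => x /= h /h /eqP; rewrite mulNr addrC subr_eq0 => /eqP px.
  rewrite /op px /rm expr1 mulrCA -realcM mulfV ?gt_eqF//.
  by rewrite mulr1 subrr.
have [_ _ h1 h2] := epq.
have qz : q = (fun=> 0) %[ae mu].
  apply: filterS2 opp0 h1 => x /= e1 e2 I; have := e2 I; rewrite e1// => /esym/eqP.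
  by rewrite mulf_eq0 (negPf lambda_neq0) => /eqP.
split => //; have cq0 : cint mu q = 0.
  rewrite (aeq_cint (finE_meas fq) _ qz) ?cint0//; exact: (@cmeas_cst _ _ _ 0).
apply: filterS2 qz h2 => x /= e1 e2 I; have := e2 I; rewrite /op e1// cq0 !mulr0 subrr.
by move/esym/eqP; rewrite mulf_eq0 oppr_eq0 (negPf lambda_neq0) => /eqP.
Qed.

(** Write [lambda = l + ik] and [<q, p> = u + iv]. Reality of the two quadratic forms gives
    [lv + ku = 0] and [-lv + ku = 0], hence [v = 0] since [l > 0], then [u <> 0] and [k = 0].
    Nonnegativity of [L_-] gives the sign of [u]. *)
Lemma eig_real : [/\ complex.Im lambda = 0, complex.Im (ip q p) = 0 &
  0 < complex.Re (ip q p)].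
Proof.
have e1 := eig_form1 fp; have e2 := eig_form2 fq.
have im0 c u : finE u -> complex.Im (form c u u) = 0.
  by move=> fu; have /(congr1 (@complex.Im R)) := formC c fu fu; rewrite ImJ; lra.
have i1 := im0 cm _ fp; have i2 := im0 cp _ fq.
have r1 : 0 <= complex.Re (form cm p p) by rewrite form_minus// energy_ge0.
move: i1 i2 r1; rewrite e1 e2 (ipC fq fp) !ImM ReM ReN ImN ReJ ImJ.
have := eig_ip_neq0; rewrite eq_complex negb_and.
move: (ip q p) => [u v]; move: lambda0; case: (lambda) => [l k] /= l0 nuv h1 h2 h3.
have v0 : v = 0.
  apply/eqP; suff : l * v == 0 by rewrite mulf_eq0 gt_eqF.
  by apply/eqP; lra.
move: nuv; rewrite v0 eqxx orbF => u0.
have k0 : k = 0.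
  apply/eqP; suff : k * u == 0 by rewrite mulf_eq0 (negPf u0) orbF.
  by apply/eqP; lra.
split => //; rewrite lt_neqAle eq_sym u0 /=.
by move: h3; rewrite k0 mul0r subr0 pmulr_rge0.
Qed.

Lemma eig_form2_lt0 : complex.Re (form cp q q) < 0.
Proof.
have [l0 v0 u0] := eig_real; rewrite (eig_form2 fq) (ipC fq fp) ReM ReN ImN ReJ ImJ.
by rewrite l0 v0 oppr0 mul0r subr0 mulNr oppr_lt0 mulr_gt0.
Qed.

Lemma eig_cint_neq0 : cint mu q != 0.
Proof.
apply/eqP => q0; have := eig_form2_lt0; rewrite ltNge => /negP; apply.
by rewrite /form q0 mulr0 mul0r subr0 energy_ge0.
Qed.

End eigenpairs.

Lemma op_lin c (z : R[i]) p p' : cintegrable mu p -> cintegrable mu p' ->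
  op c (fun x => z * p x + p' x) = (fun x => z * op c p x + op c p' x).
Proof. by move=> ip ip'; apply/funext => x; rewrite /op cint_lin//; ring. Qed.

Lemma eig_lin lambda (z : R[i]) p q p' q' : eig lambda p q -> eig lambda p' q' ->
  eig lambda (fun x => z * p x + p' x) (fun x => z * q x + q' x).
Proof.
move=> [fp fq h1 h2] [fp' fq' h1' h2']; split; [exact: finE_lin|exact: finE_lin|..].
- rewrite op_lin; [|exact: finE_cint..]; apply: filterS2 h1 h1' => x /= e e' I.
  by rewrite e// e'//; ring.
- rewrite op_lin; [|exact: finE_cint..]; apply: filterS2 h2 h2' => x /= e e' I.
  by rewrite e// e'//; ring.
Qed.

(** The combination whose second component has integral 0 again satisfies the eigenvalue equations,
    so it is null by [eig_cint_neq0]. *)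
Lemma eig_proportional (lambda : R[i]) p q p' q' : 0 < complex.Re lambda ->
  eig lambda p q -> ~ nullp p q -> eig lambda p' q' ->
  exists z : R[i], p' = (fun x => z * p x) %[ae mu] /\ q' = (fun x => z * q x) %[ae mu].
Proof.
move=> l0 e nz e'; have q0 := eig_cint_neq0 e l0 nz.
exists (cint mu q' / cint mu q); set z := _ / _.
have e2 := eig_lin (- z) e e'.
have : nullp (fun x => - z * p x + p' x) (fun x => - z * q x + q' x).
  apply: contrapT => /(eig_cint_neq0 e2 l0)/eqP; apply.
  have [_ fq _ _] := e; have [_ fq' _ _] := e'.
  by rewrite cint_lin; [rewrite mulNr divfK// addNr|exact: finE_cint..].
by case=> h1 h2; split; [apply: filterS h1|apply: filterS h2];
  move=> x /= h /h /eqP; rewrite mulNr addrC subr_eq0 => /eqP.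
Qed.

(** The last two hypotheses say [(J L - lambda) (p', q') = z (p, q)]. Pair the first with [p] and
    the second with [q]: by symmetry of [L_-] and [L_+] the terms in [lambda] cancel in the
    difference, leaving [2 z <q, p> = 0], where [<q, p>] is positive. *)
Lemma eig_no_jordan (lambda z : R[i]) p q p' q' : 0 < complex.Re lambda ->
  eig lambda p q -> ~ nullp p q -> finE p' -> finE q' ->
  op cm p' = (fun x => lambda * q' x + z * q x) %[ae mu] ->
  op cp q' = (fun x => - lambda * p' x + - z * p x) %[ae mu] -> z = 0.
Proof.
move=> l0 e nz fp' fq' h1 h2; have [fp fq _ _] := e.
have [li vi u0] := eig_real e l0 nz.
have lE : lambda^* = lambda by apply: complex_eqP; rewrite ?ReJ ?ImJ// li oppr0.
have qE : (ip q p)^* = ip q p by apply: complex_eqP; rewrite ?ReJ ?ImJ// vi oppr0.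
have [mp mq] := (finE_meas fp, finE_meas fq).
have ip_lin (a : R[i]) u v y : finE u -> finE v -> finE y ->
    ip (fun x => a * u x + v x) y = a * ip u y + ip v y.
  move=> fu fv fy; rewrite /ip -cint_lin; [|exact: cintegrable_ip..].
  by congr cint; apply/funext => x; ring.
have ipZ (a : R[i]) u y : finE u -> finE y -> ip (fun x => a * u x) y = a * ip u y.
  move=> fu fy; rewrite /ip -cintZ; last exact: cintegrable_ip.
  by congr cint; apply/funext => x; ring.
have f1 : form cm p' p = lambda * ip q' p + z * ip q p.
  rewrite -ip_op// (ip_aeq _ _ mp h1) ?ip_lin ?ipZ//; try exact: finEZ.
    exact/cmeas_op/finE_meas.
  by apply: finE_meas; apply: finE_lin => //; exact: finEZ.
have f2 : form cp q' q = - lambda * ip p' q + - z * ip p q.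
  rewrite -ip_op// (ip_aeq _ _ mq h2) ?ip_lin ?ipZ//; try exact: finEZ.
    exact/cmeas_op/finE_meas.
  by apply: finE_meas; apply: finE_lin => //; exact: finEZ.
have := formC cm fp fp'; rewrite (eig_form1 e fp') f1 conjcM lE -(ipC fq fp') => E1.
have := formC cp fq fq'; rewrite (eig_form2 e fq') f2 conjcM conjcN lE -(ipC fp fq').
rewrite (ipC fq fp) qE => E2.
have zz : z * ip q p + z * ip q p = 0.
  transitivity (lambda * ip q' p + z * ip q p - lambda * ip p' q -
    (- lambda * ip p' q + - z * ip q p - - lambda * ip q' p)); first by ring.
  by rewrite E1 E2; ring.
have : z * ip q p *+ 2 == 0 by rewrite mulr2n zz.
rewrite mulrn_eq0 mulf_eq0 /= => /orP[/eqP//|/eqP q0].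
by move: u0; rewrite q0 ltxx.
Qed.

Lemma eig_unique (l k : R[i]) p q p' q' : 0 < complex.Re l -> 0 < complex.Re k ->
  eig l p q -> ~ nullp p q -> eig k p' q' -> ~ nullp p' q' -> l = k.
Proof.
move=> l0 k0 e nz e' nz'; have [fp fq _ _] := e; have [fp' fq' _ _] := e'.
have [li _ _] := eig_real e l0 nz; have [ki _ _] := eig_real e' k0 nz'.
have lE : l^* = l by apply: complex_eqP; rewrite ?ReJ ?ImJ// li oppr0.
have kE : k^* = k by apply: complex_eqP; rewrite ?ReJ ?ImJ// ki oppr0.
apply/eqP/negPn/negP => lk.
(* Symmetry of [L_-] and of [L_+] gives two linear relations between [<q, p'>] and [<p, q'>] of
   determinant [l^2 - k^2] up to sign. Hence [<p, q'> = 0], so that [q] and [q'] are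
   [L_+]-orthogonal negative directions. *)
have a1 : l * ip q p' = k * ip p q'.
  by rewrite -(eig_form1 e fp') (formC _ fp' fp) (eig_form1 e' fp) conjcM kE -ipC.
have a2 : l * ip p q' = k * ip q p'.
  have := formC cp fq' fq; rewrite (eig_form2 e fq') (eig_form2 e' fq).
  rewrite conjcM conjcN kE -ipC// !mulNr => /eqP.
  by rewrite eqr_opp => /eqP.
have : (l - k) * (l + k) * ip p q' = 0.
  transitivity (l * (l * ip p q' - k * ip q p') + k * (l * ip q p' - k * ip p q')).
    by ring.
  by rewrite a1 a2 !subrr !mulr0 addr0.
move/eqP; rewrite !mulf_eq0 subr_eq0 (negPf lk)/=.
have -> : l + k == 0 = false.
  apply/negbTE; apply/eqP => /(congr1 (@complex.Re R)); rewrite ReD /= => h.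
  by move: l0 k0; lra.
move/eqP => x0.
apply: (@form_negative_codim1 cp q q') => //.
- by rewrite (eig_form2 e fq') x0 mulr0.
- exact: ltW (eig_form2_lt0 e l0 nz).
- exact: eig_form2_lt0 e' k0 nz'.
- exact: eig_cint_neq0 e l0 nz.
Qed.

(* The test function solves L_+ psi = 1/m, the range of which is orthogonal to q. *)
Lemma eig_stable lambda p q :
  (K - 1) * moment 1 * moment 3 <= K * moment 2 ^+ 2 ->
  0 < complex.Re lambda -> eig lambda p q -> nullp p q.
Proof.
have M2 := moment_gt0 1; move=> M123 l0 e; apply: contrapT => nz; have [fp fq _ _] := e.
have K10 : K - 1 != 0 by rewrite subr_eq0 gt_eqF.
(* [L_+ (b/m + 1/m^2) = 1/m + b - cp (b M_1 + M_2)]. As [cp M_1 = K], the constant vanishes for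
   exactly this [b]. *)
pose b : R := - (cp * moment 2) / (K - 1).
pose psi x := b%:C * rm 1 x + rm 2 x.
have [f1 f2] := (finE_rm 0, finE_rm 1).
have fpsi : finE psi by exact: finE_lin.
have cpsi : cint mu psi = (- (moment 2 / (K - 1)))%:C.
  rewrite cint_lin ?cint_rm; [|exact: finE_cint..].
  rewrite -realcM -realcD; congr (_%:C); rewrite /b /cp /cm; field.
  by rewrite K10 gt_eqF.
have psiu u : finE u -> form cp psi u = ip (rm 1) u.
  move=> fu; rewrite /form energy_lin// !energy_rml ip_rm0// cpsi.
  rewrite addrAC -mulrBl -realcM -realcB (_ : _ - _ = 0) ?mul0r ?add0r//.
  by rewrite /b; field.
apply: (@form_negative_codim1 cp psi q) => //.
- rewrite psiu// (ipC fq f1); suff -> : ip q (rm 1) = 0 by rewrite conjc0.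
  have := eig_form1 e f1; rewrite /form (energyC f1 fp) energy_rml ip_rm0// conjcK cint_rm.
  rewrite conjc_real mulrAC -realcM cmM1 mul1r subrr => /esym/eqP.
  rewrite mulf_eq0 => /orP[/eqP h|/eqP//].
  by move: l0; rewrite h ltxx.
- rewrite psiu// (ipC fpsi f1) /ip.
  have -> : cint mu (fun x => psi x * (rm 1 x)^*) = b%:C * ip (rm 1) (rm 1) + ip (rm 2) (rm 1).
    rewrite /ip -cint_lin; [|exact: cintegrable_ip..].
    by congr cint; apply/funext => x; rewrite /psi; ring.
  rewrite !ip_rm -realcM -realcD ReJ /= /b /cp /cm addrC.
  rewrite (_ : _ + _ = ((K - 1) * moment 1 * moment 3 - K * moment 2 ^+ 2) / ((K - 1) * moment 1)).
    by rewrite pmulr_lle0 ?subr_le0// invr_gt0 mulr_gt0// subr_gt0.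
  by field; rewrite K10 gt_eqF.
- exact: eig_form2_lt0 e l0 nz.
- rewrite cpsi realc_eq0 oppr_eq0 mulf_neq0 ?invr_eq0// gt_eqF//.
Qed.

(** The absolute value keeps the denominator positive for every real [t], so that continuity can be
    stated on the whole line. Only [t = lambda ^ 2 >= 0] matters. *)
Let D (t : R) x : R := m x ^+ 2 + `|t|.

Let D0 t x : 0 < D t x. Proof. by rewrite ltr_pwDl ?exprn_gt0. Qed.

Let mD t : measurable_fun setT (D t).
Proof. by apply: measurable_funD => //; apply: measurable_funX. Qed.

Let mVD t : measurable_fun setT (fun x => (D t x)^-1). Proof. exact: measurable_inv. Qed.

Let mV : measurable_fun setT (fun x => (m x)^-1). Proof. exact: measurable_inv. Qed.

Let VD_le t x : (D t x)^-1 <= w^-1 * (m x)^-1.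
Proof.
rewrite -invfM lef_pV2 ?posrE ?mulr_gt0// (le_trans _ (_ : m x ^+ 2 <= _)) ?lerDl//.
by rewrite expr2 ler_wpM2r// ltW.
Qed.

Let VD_ge0 t x : 0 <= (D t x)^-1. Proof. by rewrite invr_ge0 ltW. Qed.

Lemma integrable_le_inv (g : T -> R) C : measurable_fun setT g ->
  (forall x, `|g x| <= C * (m x)^-1) -> mu.-integrable setT (EFin \o g).
Proof.
move=> mg gC; apply: le_integrable (integrableZl measurableT C im1) => //.
  exact/measurable_EFinP.
by move=> x _; rewrite /= lee_fin (le_trans (gC x))// ler_norm.
Qed.

Definition resolvent (g : T -> R) (t : R) : R := \int[mu]_x (g x * (D t x)^-1).

Let integrable_resolvent (g : T -> R) B t : measurable_fun setT g ->
  (forall x, 0 <= g x <= B) -> mu.-integrable setT (EFin \o (fun x => g x * (D t x)^-1)).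
Proof.
move=> mg gB; apply: (@integrable_le_inv _ (B * w^-1)); first exact: measurable_funM.
move=> x; have /andP[g0 gb] := gB x; rewrite ger0_norm ?mulr_ge0// -mulrA.
by apply: ler_pM.
Qed.

Lemma lipschitz_continuous (f : R -> R) L : (forall t u, `|f t - f u| <= L * `|t - u|) ->
  continuous f.
Proof.
move=> fL t; apply/cvgrPdist_lt => e e0.
have L0 : 0 <= L by have := fL 1 0; rewrite subr0 normr1 mulr1; exact: le_trans.
have L1 : 0 < L + 1 by rewrite ltr_wpDl.
apply/nbhs_ballP; exists (e / (L + 1)); first by rewrite /= divr_gt0.
move=> u; rewrite /ball/= ltr_pdivlMr// => tu; apply: le_lt_trans (fL t u) _.
by apply: le_lt_trans tu; rewrite mulrC ler_wpM2l// lerDl.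
Qed.

(** The resolvent identity makes the function Lipschitz. In the constant, [B] bounds [g], one
    inverse denominator is at most [w^-2] and the other at most [w^-1 / m], whose integral gives
    [moment 1]. *)
Lemma continuous_resolvent (g : T -> R) B : measurable_fun setT g ->
  (forall x, 0 <= g x <= B) -> continuous (resolvent g).
Proof.
move=> mg gB; apply: (@lipschitz_continuous _ (B * w^-1 ^+ 3 * moment 1)) => t u.
have [it iu] := (integrable_resolvent t mg gB, integrable_resolvent u mg gB).
rewrite -RintegralB//; apply: le_trans (le_normr_integral _ _) _ => //.
  by have := integrableB measurableT it iu; apply: eq_integrable => // x _.
rewrite mulrAC /moment -RintegralZl//; apply: le_Rintegral => //.
- have := integrable_abse (integrableB measurableT it iu).
  by apply: eq_integrable => // x _.
- by have := integrableZl measurableT (B * w^-1 ^+ 3 * `|t - u|) im1; apply: eq_integrable.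
move=> x _; have /andP[g0 gb] := gB x.
have -> : g x * (D t x)^-1 - g x * (D u x)^-1 = g x * (D t x)^-1 * (D u x)^-1 * (`|u| - `|t|).
  by rewrite /D; field; rewrite !gt_eqF ?D0.
rewrite normrM ger0_norm ?mulr_ge0// expr1 [leRHS]mulrAC.
apply: ler_pM; rewrite ?mulr_ge0//; last by rewrite (distrC t) ler_dist_dist.
have mw3 y : (D y x)^-1 <= w^-1 * w^-1.
  by rewrite (le_trans (VD_le y x))// ler_wpM2l ?inv_mx_le// invr_ge0 ltW.
rewrite (_ : B * w^-1 ^+ 3 * _ = B * (w^-1 * w^-1) * (w^-1 * (m x)^-1)); last by ring.
by do 2 (apply: ler_pM; rewrite ?mulr_ge0//).
Qed.

Let kappa : R := (K - 1) / K.

Let bound1 (x : T) : 0 <= (1 : R) <= 1. Proof. by rewrite ler01 lexx. Qed.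

Let boundm x : 0 <= (m x)^-1 <= w^-1. Proof. by rewrite inv_mx_ge0 inv_mx_le. Qed.

Let iH t := @integrable_resolvent (fun=> 1) 1 t (measurable_cst _) bound1.
Let iC t := @integrable_resolvent _ w^-1 t mV boundm.

Local Notation H := (resolvent (fun=> 1)).
Local Notation C := (resolvent (fun x => (m x)^-1)).

(* With t = lambda ^ 2, this vanishes exactly at the eigenvalues. *)
Definition secular (t : R) : R := H t ^+ 2 + t * C t ^+ 2 - kappa * moment 1 * C t.

Lemma continuous_secular : continuous secular.
Proof.
have gen (a b : R -> R) (c : R) : continuous a -> continuous b ->
    continuous (fun t => a t ^+ 2 + t * b t ^+ 2 - c * b t).
  move=> ca cb t; apply: cvgB; last by apply: cvgM; [exact: cvg_cst|exact: cb].
  apply: cvgD; last apply: cvgM; first by rewrite expr2; apply: cvgM; exact: ca.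
    exact: cvg_id.
  by rewrite expr2; apply: cvgM; exact: cb.
apply: gen; first exact: (continuous_resolvent (measurable_cst _) bound1).
exact: (continuous_resolvent mV boundm).
Qed.

Let mD_le t x : `|m x * (D t x)^-1| <= 1 * (m x)^-1.
Proof.
rewrite ger0_norm ?mulr_ge0 ?(ltW (m0 x))// mul1r.
rewrite ler_pdivrMr ?D0// -ler_pdivrMl ?invr_gt0// invrK -expr2 lerDl//.
Qed.

Let iF t : mu.-integrable setT (EFin \o (fun x => m x * (D t x)^-1)).
Proof. by apply: (@integrable_le_inv _ 1); [exact: measurable_funM|exact: mD_le]. Qed.

(** From [m / (m^2 + t) = 1/m - t / (m (m^2 + t))]. *)
Let FE t : 0 <= t -> \int[mu]_x (m x * (D t x)^-1) = moment 1 - t * C t.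
Proof.
move=> t0; rewrite /resolvent -RintegralZl//.
rewrite /moment -RintegralB//; last first.
  by have := integrableZl measurableT t (iC t); apply: eq_integrable.
apply: eq_Rintegral => x _; have := D0 t x; rewrite /D ger0_norm// => d0.
by field; rewrite !gt_eqF.
Qed.

Let F_small e : 0 < e -> exists2 t, 0 <= t & \int[mu]_x (m x * (D t x)^-1) <= e.
Proof.
move=> e0.
have : (\int[mu]_x (m x * (D k.+1%:R x)^-1)%:E @[k --> \oo] --> 0)%E.
  have := @dominated_convergence _ _ R mu setT measurableT
    (fun k x => (m x * (D k.+1%:R x)^-1)%:E) (fun=> 0%E) (EFin \o (fun x => (m x)^-1)) _ _ _ im1 _.
  case.
  - by move=> k; apply/measurable_EFinP; exact: measurable_funM.
  - exact: measurable_cst.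
  - apply: aeW => x _; apply/fine_cvgP; split; first exact: nearW.
    have h : m x * k.+1%:R^-1 @[k --> \oo] --> (0 : R).
      have : m x * k.+1%:R^-1 @[k --> \oo] --> (m x * 0 : R).
        by apply: cvgM; [exact: cvg_cst|exact: (@cvg_harmonic R)].
      by rewrite mulr0.
    apply: (squeeze_cvgr _ (cvg_cst (0 : R)) h).
    apply: nearW => k; rewrite /= mulr_ge0 ?(ltW (m0 x))//=.
    rewrite ler_wpM2l ?(ltW (m0 x))// lef_pV2 ?posrE ?D0// ?ltr0n//.
    by rewrite /D ger0_norm// lerDr sqr_ge0.
  - by apply: aeW => x k _; rewrite /= lee_fin (le_trans (mD_le _ _))// mul1r.
  by move=> _ _; rewrite integral0.
have g0 k : (0 <= \int[mu]_x (m x * (D k.+1%:R x)^-1)%:E)%E.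
  by apply: integral_ge0 => x _; rewrite lee_fin mulr_ge0// ltW.
move=> /fine_cvgP[_ /cvgrPdist_le/(_ e e0)][k _ /(_ k (leqnn k))] /=.
rewrite sub0r normrN ger0_norm; last exact: fine_ge0.
by exists k.+1%:R.
Qed.

Lemma secular_root : K * moment 2 ^+ 2 < (K - 1) * moment 1 * moment 3 ->
  exists2 t, 0 < t & secular t = 0.
Proof.
move=> M123; have K0 : 0 < K by apply: lt_trans K1.
have h0 : secular 0 < 0.
  have H0 : H 0 = moment 2.
    by apply: eq_Rintegral => x _; rewrite /D normr0 addr0 mul1r exprVn.
  have C0 : C 0 = moment 3.
    by apply: eq_Rintegral => x _; rewrite /D normr0 addr0 -invfM -exprS exprVn.
  rewrite /secular H0 C0 mul0r addr0 subr_lt0 /kappa.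
  rewrite -(ltr_pM2l K0); apply: lt_le_trans M123 _.
  by rewrite le_eqVlt; apply/orP; left; apply/eqP; field; rewrite gt_eqF.
(* For large [t], [secular t] is at least [C t (t C t - kappa M_1)], and [t C t = M_1 - F] by [FE],
   where [F] is the integral of [m / (m^2 + t)]. It therefore suffices that [F <= (1 - kappa) M_1],
   and [F] tends to 0. *)
have kap1 : 0 < (1 - kappa) * moment 1.
  by rewrite mulr_gt0// /kappa mulrBl mul1r divff ?gt_eqF// subKr invr_gt0.
have [t t0 Ft] := F_small kap1.
have C0 : 0 <= C t by apply: Rintegral_ge0 => x _; rewrite mulr_ge0.
have ht : 0 <= secular t.
  rewrite /secular -addrA addr_ge0 ?sqr_ge0// expr2 mulrA -mulrBl mulr_ge0//.
  by move: Ft; rewrite FE//; lra.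
have [|c] := @IVT R secular 0 t 0 t0 (continuous_subspaceT continuous_secular).
  by rewrite ge_min le_max ht (ltW h0) orbT.
rewrite in_itv/= => /andP[c0 _] hc; exists c => //.
rewrite lt_neqAle c0 andbT; apply/eqP => c00.
by move: h0 hc; rewrite -c00 => + h; rewrite h ltxx.
Qed.

Lemma eig_exists : K * moment 2 ^+ 2 < (K - 1) * moment 1 * moment 3 ->
  exists l : R, 0 < l /\ exists p q, eig l%:C p q /\ ~ nullp p q.
Proof.
move=> /secular_root[t t0 ht]; pose l := Num.sqrt t.
have l0 : 0 < l by rewrite sqrtr_gt0.
have lt : l * l = t by rewrite -expr2 sqr_sqrtr// ltW.
have K0 : K != 0 by rewrite gt_eqF// (lt_trans _ K1).
(* Here [a] and [b] stand for [cm int p] and [cp int q]. The pointwise system [m p - l q = a],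
   [l p + m q = b] has the solution [(P, Q)] below. Integrating [P] requires [a l C = b H], hence
   this choice; integrating [Q] then requires [H^2 + t C^2 = kappa M_1 C], which is
   [secular t = 0]. *)
pose a := H t; pose b := l * C t.
have [a0 b0] : 0 <= a /\ 0 <= b.
  split; first by apply: Rintegral_ge0 => x _; rewrite mulr_ge0.
  by rewrite mulr_ge0 ?(ltW l0)//; apply: Rintegral_ge0 => x _; rewrite mulr_ge0.
pose P x : R := a * (m x * (D t x)^-1) + l * b * (1 * (D t x)^-1).
pose Q x : R := b * (m x * (D t x)^-1) + - l * a * (1 * (D t x)^-1).
have mul_int (c c' : R) : let f x := c * (m x * (D t x)^-1) + c' * (1 * (D t x)^-1) in
    finE (fun x => (f x)%:C) /\
    cint mu (fun x => (f x)%:C) = (c * (moment 1 - t * C t) + c' * H t)%:C.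
  move=> f; have if1 : mu.-integrable setT (EFin \o (fun x => c * (m x * (D t x)^-1))).
    by have := integrableZl measurableT c (iF t); apply: eq_integrable.
  have if2 : mu.-integrable setT (EFin \o (fun x => c' * (1 * (D t x)^-1))).
    by have := integrableZl measurableT c' (iH t); apply: eq_integrable.
  split; last first.
    rewrite cint_real RintegralD//; congr ((_ + _)%:C); last by rewrite RintegralZl.
    by rewrite RintegralZl// FE// ltW.
  apply: (@finE_le _ (`|c| * 1 + `|c'| * w^-1)).
    apply: cmeas_real; apply: measurable_funD; apply: measurable_funM => //;
    exact: measurable_funM.
  move=> x; rewrite normc_real (le_trans (ler_normD _ _))// mulrDl; apply: lerD.
    by rewrite normrM -mulrA ler_wpM2l// mD_le.
  by rewrite normrM -mulrA ler_wpM2l// mul1r ger0_norm// VD_le.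
have [fP iP] := mul_int a (l * b); have [fQ iQ] := mul_int b (- l * a).
have DE x : D t x = m x ^+ 2 + l * l by rewrite /D ger0_norm ?lt// ltW.
have Dn x : m x ^+ 2 + l * l != 0 by rewrite -DE gt_eqF.
exists l; split => //; exists (fun x => (P x)%:C), (fun x => (Q x)%:C); split.
  split => //.
  - apply: aeW => x _; rewrite /op iP -!realcM -realcB; congr (_%:C).
    have -> : cm * (a * (moment 1 - t * C t) + l * b * H t) = a.
      rewrite /a /b.
      transitivity (H t * (cm * moment 1) + H t * cm * C t * (l * l - t)); first by ring.
      by rewrite cmM1 lt subrr mulr0 addr0 mulr1.
    by rewrite /P /Q DE; field.
  - apply: aeW => x _; rewrite /op iQ -(rmorphN (real_complex R)) -!realcM -realcB; congr (_%:C).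
    have -> : cp * (b * (moment 1 - t * C t) + - l * a * H t) = b.
      have E : H t ^+ 2 + t * C t ^+ 2 = kappa * moment 1 * C t by apply/eqP; rewrite -subr_eq0 -/(secular t) ht.
      rewrite /a /b /cp.
      transitivity (K * cm * (l * (moment 1 * C t - (H t ^+ 2 + t * C t ^+ 2)))); first by ring.
      rewrite E; transitivity (K * (1 - kappa) * (cm * moment 1) * (l * C t)); first by ring.
      by rewrite cmM1 /kappa; field.
    by rewrite /P /Q DE; field.
have a_gt0 : 0 < a by apply: Rintegral_gt0 (iH t) => // y; rewrite mulr_gt0 ?invr_gt0.
have P_gt0 x : 0 < P x.
  rewrite ltr_wpDr//; first by rewrite mul1r mulr_ge0// mulr_ge0// ltW.
  by rewrite mulr_gt0// mulr_gt0 ?invr_gt0.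
move=> [[N [mN N0 PN]] _]; move: mu0; rewrite (_ : setT = N) ?N0 ?ltxx//.
apply/seteqP; split => // x _; apply: PN => /= /(_ Logic.I)/(congr1 (@complex.Re R)) /=.
by apply/eqP; rewrite gt_eqF// P_gt0.
Qed.

End spectral_problem.

(** * Moments of the symbol *)

Section real_line.
Context {R : realType}.
Local Notation leb := (@lebesgue_measure R).

Lemma continuous_powR (a x : R) : 0 < x -> {for x, continuous (fun y : R => y `^ a)}.
Proof.
move=> x0; apply: differentiable_continuous; apply/derivable1_diffP.
by have [] := is_derive1_powR a x0.
Qed.

Lemma cvgy_powRN (c : R) : 0 < c -> (x + 1) `^ (- c) @[x --> +oo%R] --> (0 : R).
Proof.
move=> c0; apply/cvgrPdist_le => e e0; near=> x.
have x0 : 0 <= x by near: x; exact: nbhs_pinfty_ge.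
have xe : e^-1 `^ c^-1 <= x by near: x; exact: nbhs_pinfty_ge.
rewrite sub0r normrN ger0_norm ?powR_ge0// powRN -[leRHS]invrK lef_pV2 ?posrE ?invr_gt0//; last first.
  by rewrite powR_gt0// ltr_wpDl.
have -> : e^-1 = (e^-1 `^ c^-1) `^ c.
  by rewrite -powRrM mulVf ?gt_eqF// powRr1// invr_ge0 ltW.
rewrite ge0_ler_powR ?nnegrE ?(ltW c0) ?powR_ge0 ?addr_ge0//.
by rewrite (le_trans xe)// lerDl.
Unshelve. all: by end_near. Qed.

(** The one-dimensional factor of the product that dominates [1 / symb] in [integrable_inv_symb]. *)
Definition bracket (b t : R) : R := (1 + `|t|) `^ (- b).

Lemma continuous_bracket b : continuous (bracket b).
Proof.
move=> t; apply: (@cvg_comp _ _ _ (fun t => 1 + `|t|) (fun y : R => y `^ (- b))).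
  by apply: cvgD; [exact: cvg_cst|apply: cvg_norm; exact: cvg_id].
by apply: continuous_powR; rewrite ltr_pwDl.
Qed.

Lemma integrable_bracket b : 1 < b -> leb.-integrable setT (EFin \o bracket b).
Proof.
move=> b1; have cb := @continuous_bracket b.
apply/integrableP; split.
  by apply/measurable_EFinP; exact: (continuous_measurable_fun cb).
under eq_integral do rewrite /= ger0_norm ?powR_ge0//.
rewrite ge0_symfun_integralT//; last 2 first.
- by move=> t; exact: powR_ge0.
- by move=> t; rewrite /bracket /= normrN.
have b10 : 0 < b - 1 by rewrite subr_gt0.
have c0 : 1 - b != 0 by rewrite subr_eq0 lt_eqF.
rewrite (_ : [set x | (0 <= x)%R] = `[0%R, +oo[%classic); last first.
  by apply/seteqP; split => x /=; rewrite in_itv/= andbT.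
pose F (t : R) : R := (1 - b)^-1 * (t + 1) `^ (1 - b).
have dF (t : R) : 0 <= t -> is_derive t (1 : R) F (bracket b t).
  move=> t0; have t1 : 0 < t + 1 by rewrite ltr_wpDl.
  have d1 : is_derive t (1 : R) (fun u : R => u + 1) 1.
    by apply: is_derive_eq; rewrite addr0.
  have d2 := is_derive1_powR (1 - b) t1.
  have d3 := @is_derive1_comp _ (fun y : R => y `^ (1 - b)) (fun u : R => u + 1) t _ _ d2 d1.
  apply: is_derive_eq (is_deriveZ (1 - b)^-1 d3) _.
  rewrite /bracket ger0_norm// /GRing.scale/= mulr1 mulrA mulVf// mul1r addrC.
  by congr (_ `^ _); ring.
rewrite (@ge0_continuous_FTC2y _ _ F 0 0)//.
- by rewrite -EFinB -EFinM ltry.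
- by move=> t _; exact: powR_ge0.
- exact: continuous_subspaceT.
- rewrite -[X in _ --> X](mulr0 (1 - b)^-1); apply: cvgM; first exact: cvg_cst.
  by have := cvgy_powRN b10; rewrite opprB.
- by move=> t t0; have [] := dF t (ltW t0).
- apply: cvg_at_right_filter; apply: differentiable_continuous; apply/derivable1_diffP.
  by have [] := dF 0 (lexx 0).
- move=> t; rewrite in_itv/= andbT => t0.
  by rewrite derive1E; have [_] := dF t (ltW t0).
Qed.

(** The image of Lebesgue measure under multiplication by [c], times [c], agrees with Lebesgue
    measure on intervals, hence everywhere by uniqueness. *)
Lemma ge0_integral_scale1 (c : R) (f : R -> \bar R) : 0 < c ->
  measurable_fun [set: measurableTypeR R] f -> (forall t, 0 <= f t)%E ->
  (\int[leb]_t f t = c%:E * \int[leb]_t f (c * t)%R)%E.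
Proof.
move=> c0 mf f0.
have mc : measurable_fun [set: measurableTypeR R] ( *%R c : measurableTypeR R -> measurableTypeR R).
  exact: mulrl_measurable.
pose pf : {measure set (measurableTypeR R) -> \bar R} :=
  measure_function_pushforward__canonical__measure_function_Measure leb mc.
pose nu : {measure set (measurableTypeR R) -> \bar R} := mscale (NngNum (ltW c0)) pf.
have -> : (\int[leb]_t f t = \int[nu]_t f t)%E.
  apply: eq_measure_integral => A mA _.
  apply: (lebesgue_measure_unique (mu := nu)) => // _ [[a b]] _ <-.
  rewrite /nu /= /mscale /= /pushforward.
  rewrite (_ : *%R c @^-1` _ = `]a / c, b / c]%classic); last first.
    apply/seteqP; split => t /=; rewrite !in_itv/= ltr_pdivrMr// ler_pdivlMr//;
      by rewrite mulrC.
  rewrite !lebesgue_measure_itv/= !lte_fin ltr_pM2r ?invr_gt0//.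
  case: ifP => _; last by rewrite mule0.
  by rewrite -!EFinB -EFinM -mulrBl mulrC divfK// gt_eqF.
rewrite /nu ge0_integral_mscale//; congr (_ * _)%E.
exact: (@ge0_integral_pushforward _ _ _ _ _ _ mc _ setT f).
Qed.

End real_line.

Section euclidean_space.
Context {R : realType}.
Local Notation leb := (@lebesgue_measure R).

Definition scaleT n (c : R) (x : Rn R n) : Rn R n := [tuple c * tnth x i | i < n].

Lemma measurable_scaleT n c : measurable_fun setT (@scaleT n c).
Proof.
apply/measurable_fun_tnthP => i.
rewrite (_ : _ \o _ = fun x : Rn R n => c * tnth x i); last first.
  by apply/funext => x /=; rewrite tnth_mktuple.
by apply: measurable_funM => //; exact: measurable_tnth.
Qed.

Lemma measurable_integral_Rn n (f : Rn R n.+1 -> \bar R) :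
  measurable_fun setT f -> (forall x, 0 <= f x)%E ->
  measurable_fun [set: measurableTypeR R]
    (fun t => \int[@lebesgue_Rn R n]_x f [tuple of t :: x])%E.
Proof.
move=> mf f0.
apply: (@measurable_fun_fubini_tonelli_F _ _ _ _ _ (@lebesgue_Rn R n) (f \o @tuple_consp R n)) => [|z].
  by apply: measurableT_comp => //; exact: measurable_tuple_consp.
exact: f0.
Qed.

Lemma ge0_integral_scale n (c : R) (f : Rn R n -> \bar R) : 0 < c ->
  measurable_fun setT f -> (forall x, 0 <= f x)%E ->
  (\int[lebesgue_Rn]_x f x = (c ^+ n)%:E * \int[lebesgue_Rn]_x f (scaleT c x))%E.
Proof.
move=> c0; elim: n f => [|n ih] f mf f0.
  rewrite expr0 mul1e !ge0_integral_Rn0//; last exact: measurableT_comp mf (@measurable_scaleT 0 c).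
  by congr f; apply/esym; exact: tuple0.
have mfs : measurable_fun setT (f \o @scaleT n.+1 c).
  exact: measurableT_comp mf (@measurable_scaleT n.+1 c).
have mt t : measurable_fun setT (fun x : Rn R n => f [tuple of t :: x]).
  by apply: (measurableT_comp mf); apply: measurable_cons.
rewrite (ge0_integral_RnS mf f0) (ge0_integral_RnS mfs)//=.
pose G t := (\int[@lebesgue_Rn R n]_x f [tuple of t :: x])%E.
have G0 t : (0 <= G t)%E by exact: integral_ge0.
have mG := measurable_integral_Rn mf f0.
rewrite -[LHS]/(\int[leb]_t G t)%E (ge0_integral_scale1 c0 mG G0) exprS EFinM -muleA.
congr (_ * _)%E; rewrite -ge0_integralZl//; last 2 first.
- by move=> t _; apply: integral_ge0.
- by rewrite lee_fin exprn_ge0// ltW.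
apply: eq_integral => t _; rewrite /G ih//; congr (_ * _)%E.
apply: eq_integral => x _; congr f; apply: eq_from_tnth => i.
rewrite tnth_mktuple; case: (unliftP ord0 i) => [j|] ->; last by rewrite !tnth0.
by rewrite !tnthS tnth_mktuple.
exact: (measurable_integral_Rn mfs (fun x => f0 _)).
Qed.

End euclidean_space.

(** * The symbol compared with the Sobolev weight *)

Section symbol.
Context {R : realType} {n : nat}.
Local Notation X := (Rn R n).
Local Notation mu := (@lebesgue_Rn R n).
Implicit Types (x xi : X) (s w : R).

Lemma dot_ge0 xi : 0 <= dot xi xi.
Proof. by apply: sumr_ge0 => i _; rewrite -expr2 sqr_ge0. Qed.

Lemma sqr_enorm xi : enorm xi ^+ 2 = dot xi xi.
Proof. by rewrite sqr_sqrtr// dot_ge0. Qed.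

Lemma enorm_ge0 xi : 0 <= enorm xi. Proof. exact: sqrtr_ge0. Qed.

Lemma fsymb_ge0 s xi : 0 <= fsymb s xi. Proof. exact: powR_ge0. Qed.

Lemma fsymbE s xi : fsymb s xi = ((2 * pi) ^+ 2 * enorm xi ^+ 2) `^ s.
Proof. by rewrite -exprMn /fsymb powRrM -(powR_mulrn 2) ?mulr_ge0 ?pi_ge0 ?enorm_ge0. Qed.

Lemma measurable_fsymb s : measurable_fun setT (@fsymb R n s).
Proof.
apply: (measurableT_comp (measurable_powR (2 * s))).
by apply: measurable_funM => //; exact: measurable_enorm.
Qed.

Lemma fsymb_scaleT s (c : R) xi : 0 <= c -> fsymb s (scaleT c xi) = c `^ (2 * s) * fsymb s xi.
Proof.
move=> c0; have -> : fsymb s (scaleT c xi) = (c * (2 * pi * enorm xi)) `^ (2 * s).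
  rewrite /fsymb /enorm (_ : dot _ _ = c ^+ 2 * dot xi xi).
    by rewrite sqrtrM ?sqr_ge0// sqrtr_sqr ger0_norm//; congr (_ `^ _); ring.
  by rewrite /dot mulr_sumr; apply: eq_bigr => i _; rewrite tnth_mktuple; ring.
by rewrite powRM// !mulr_ge0// ?pi_ge0 ?enorm_ge0.
Qed.

Context (s w : R) (s0 : 0 < s) (w0 : 0 < w).

Definition symb w' xi := fsymb s xi + w'.

Let le_powR (a x y : R) : 0 <= a -> 0 <= x -> x <= y -> x `^ a <= y `^ a.
Proof. by move=> a0 x0 xy; rewrite ge0_ler_powR ?nnegrE// (le_trans x0). Qed.

Let weight_ge1 xi : 1 <= (1 + enorm xi ^+ 2) `^ s.
Proof.
have := @le_powR s 1 (1 + enorm xi ^+ 2) (ltW s0) ler01.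
by rewrite powR1; apply; rewrite lerDl sqr_ge0.
Qed.

Lemma symb_le : exists2 C : R, 0 < C & forall xi, symb w xi <= C * (1 + enorm xi ^+ 2) `^ s.
Proof.
exists (((2 * pi) ^+ 2) `^ s + w); first by rewrite ltr_wpDl ?powR_ge0.
move=> xi; rewrite mulrDl /symb; apply: lerD; last by rewrite ler_peMr// ltW.
have [r0 p0] := (sqr_ge0 (enorm xi), sqr_ge0 (2 * pi : R)).
rewrite fsymbE -powRM//; last exact: addr_ge0.
apply: le_powR; [exact: ltW|exact: mulr_ge0|].
by rewrite ler_wpM2l// lerDr.
Qed.

(** For [|xi| <= 1] the weight is bounded and [w] alone suffices. Beyond, [1 + |xi|^2 <= 2 |xi|^2],
    and the factor [2 pi >= 1] is on the right side. *)
Lemma weight_le : exists2 C : R, 0 < C & forall xi, (1 + enorm xi ^+ 2) `^ s <= C * symb w xi.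
Proof.
exists (2 `^ s * (w^-1 + 1)); first by rewrite mulr_gt0 ?powR_gt0// addr_gt0 ?invr_gt0.
move=> xi; have r0 := sqr_ge0 (enorm xi); rewrite -mulrA.
have [r1|r1] := leP (enorm xi ^+ 2) 1.
  apply: (@le_trans _ _ (2 `^ s * 1)).
    by rewrite mulr1; apply: le_powR; [exact: ltW|exact: addr_ge0|lra].
  rewrite ler_wpM2l ?powR_ge0// mulrDl mul1r ler_wpDr ?addr_ge0 ?fsymb_ge0 ?(ltW w0)//.
  by rewrite mulrDr mulVf ?gt_eqF// lerDr mulr_ge0 ?fsymb_ge0// invr_ge0 ltW.
apply: (@le_trans _ _ (2 `^ s * (enorm xi ^+ 2) `^ s)).
  have r2 : 1 + enorm xi ^+ 2 <= 2 * enorm xi ^+ 2 by lra.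
  by rewrite -powRM//; apply: le_powR; [exact: ltW|exact: addr_ge0|].
rewrite ler_wpM2l ?powR_ge0// mulrDl mul1r ler_wpDl//.
  by rewrite mulr_ge0 ?invr_ge0 ?(ltW w0)// addr_ge0 ?fsymb_ge0 ?(ltW w0).
apply: (@le_trans _ _ (fsymb s xi)); last by rewrite lerDl ltW.
rewrite fsymbE; apply: le_powR => //; first exact: ltW.
rewrite ler_peMl// -(expr1n R 2) lerXn2r ?nnegrE ?mulr_ge0 ?pi_ge0//.
by have := @pi_ge2 R; lra.
Qed.

Lemma measurable_symb : measurable_fun setT (symb w).
Proof. by apply: measurable_funD => //; exact: measurable_fsymb. Qed.

Lemma symb_ge xi : w <= symb w xi. Proof. by rewrite lerDr fsymb_ge0. Qed.

Lemma symb_gt0 xi : 0 < symb w xi. Proof. exact: lt_le_trans (symb_ge xi). Qed.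

Context (n_ge1 : (1 <= n)%N) (s_gt : n%:R / 2 < s).

(** Every coordinate satisfies [(1 + |xi_i|)^2 <= 2 (1 + |xi|^2)]. Raised to the power [s/n] and
    multiplied over the [n] coordinates, these inequalities bound the weight from below by a product
    of one-dimensional factors with exponent [2s/n > 1]. *)
Lemma integrable_inv_symb : mu.-integrable setT (EFin \o (fun xi => (symb w xi)^-1)).
Proof.
have n0 : 0 < n%:R :> R by rewrite ltr0n.
pose b : R := 2 * (s / n%:R).
have b1 : 1 < b.
  by move: s_gt; rewrite /b mulrA ltr_pdivlMr// mul1r ltr_pdivrMr// mulrC.
pose h (t : R) : R[i] := (bracket b t)%:C.
have [ih _] := cint_prod_tnth (fun _ : 'I_n => cintegrable_real (integrable_bracket b1)).
have [C C0 hC] := weight_le.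
have := integrable_normc (cintegrableZ (2 `^ s * C)%:C ih).
apply: le_integrable => //.
  apply/measurable_EFinP; rewrite (_ : (fun x => _) = (fun xi => symb w xi `^ (-1))).
    exact: (measurableT_comp (measurable_powR (-1)) measurable_symb).
  by apply/funext => xi; rewrite powR_inv1// ltW// symb_gt0.
move=> xi _; rewrite /= lee_fin -(rmorph_prod (real_complex R)) -realcM normc_real.
rewrite normr_id ger0_norm ?invr_ge0 ?(ltW (symb_gt0 _))//.
have P0 : 0 < \prod_(i < n) (1 + `|tnth xi i : R|) `^ b.
  by apply: prodr_gt0 => i _; rewrite powR_gt0// ltr_pwDl.
have -> : \prod_(i < n) bracket b (tnth xi i) = (\prod_(i < n) (1 + `|tnth xi i : R|) `^ b)^-1.
  by rewrite -prodfV; apply: eq_bigr => i _; rewrite /bracket powRN.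
rewrite ger0_norm ?mulr_ge0 ?powR_ge0 ?invr_ge0 ?(ltW C0) ?(ltW P0)//.
rewrite ler_pdivlMr// mulrC ler_pdivrMr ?symb_gt0//.
apply: (@le_trans _ _ (2 `^ s * (1 + enorm xi ^+ 2) `^ s)); last first.
  by rewrite -mulrA ler_wpM2l ?powR_ge0.
rewrite -powRM ?addr_ge0 ?sqr_ge0//.
have -> : (2 * (1 + enorm xi ^+ 2)) `^ s = \prod_(i < n) (2 * (1 + enorm xi ^+ 2)) `^ (s / n%:R).
  rewrite prodr_const card_ord -[_ ^+ n]powR_mulrn ?powR_ge0// -powRrM divfK//.
  by rewrite gt_eqF.
apply: ler_prod => i _; rewrite powR_ge0/= /b powRrM.
have t0 : 0 <= 1 + `|tnth xi i : R| by rewrite addr_ge0.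
rewrite (powR_mulrn 2)//; apply: le_powR; [by rewrite divr_ge0// ltW|exact: sqr_ge0|].
rewrite sqr_enorm /dot (bigD1 i)//= -expr2 -(real_normK (num_real (tnth xi i : R))).
have key (a S : R) : 0 <= S -> (1 + a) ^+ 2 <= 2 * (1 + (a ^+ 2 + S)).
  by move=> S0; have := sqr_ge0 (1 - a); rewrite !expr2; lra.
by apply: key; apply: sumr_ge0 => j _; rewrite -expr2 sqr_ge0.
Qed.

Lemma lebesgue_Rn_setT : (0 < mu setT)%E.
Proof.
have := @box_measure_gt0 R n (fun=> 0) (fun=> 1) (fun _ => ltr01).
by move=> /lt_le_trans; apply; apply: le_measure; rewrite ?inE//; exact: measurable_box.
Qed.

End symbol.

Section moments.
Context {R : realType} {n : nat} (s : R) (n_ge1 : (1 <= n)%N) (s_gt : n%:R / 2 < s).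
Local Notation X := (Rn R n).
Local Notation mu := (@lebesgue_Rn R n).
Local Notation M w k := (moment mu (@symb R n s w) k).

Let n0 : 0 < n%:R :> R. Proof. by rewrite ltr0n. Qed.
Let s0 : 0 < s. Proof. by apply: lt_trans s_gt; rewrite divr_gt0. Qed.

Let iM w k : 0 < w -> mu.-integrable setT (EFin \o (fun xi => (symb s w xi)^-1 ^+ k.+1)).
Proof.
move=> w0; apply: (integrable_pow_inv (measurable_symb _ _) w0) => [xi|].
  exact: symb_ge.
exact: integrable_inv_symb.
Qed.

(** With [c = t^(1/(2s))] the substitution of [c xi] turns the symbol with parameter [t w] into [t]
    times the one with [w]. The Jacobian [c^n] contributes the exponent [n/(2s)]. *)
Lemma moment_scale (w t : R) k : 0 < w -> 0 < t ->
  M (t * w) k.+1 = t `^ (n%:R / (2 * s) - k.+1%:R) * M w k.+1.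
Proof.
move=> w0 t0; pose c := t `^ (2 * s)^-1; have c0 : 0 < c by rewrite powR_gt0.
have ct : c `^ (2 * s) = t.
  by rewrite -powRrM mulVf ?powRr1 ?(ltW t0)// mulf_neq0// gt_eqF.
have cn : c ^+ n = t `^ (n%:R / (2 * s)).
  by rewrite -powR_mulrn ?powR_ge0// -powRrM mulrC.
have tw0 : 0 < t * w by exact: mulr_gt0.
have mI (u : R) : 0 < u -> measurable_fun setT (fun xi : X => ((symb s u xi)^-1 ^+ k.+1)%:E).
  by move=> u0; have /integrableP[] := iM k u0.
have I0 (u : R) (xi : X) : 0 < u -> 0 <= (symb s u xi)^-1 ^+ k.+1.
  by move=> u0; rewrite exprn_ge0// invr_ge0 ltW// symb_gt0.
rewrite /moment /Rintegral (ge0_integral_scale c0 (mI _ tw0)); last first.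
  by move=> xi; rewrite lee_fin I0.
have E (xi : X) : (symb s (t * w) (scaleT c xi))^-1 ^+ k.+1 =
    t^-1 ^+ k.+1 * (symb s w xi)^-1 ^+ k.+1.
  by rewrite /symb fsymb_scaleT ?(ltW c0)// ct -mulrDr invfM exprMn.
have -> : (\int[mu]_x ((symb s (t * w) (scaleT c x))^-1 ^+ k.+1)%:E =
    \int[mu]_x ((t^-1 ^+ k.+1)%:E * ((symb s w x)^-1 ^+ k.+1)%:E))%E.
  by apply: eq_integral => x _; rewrite E EFinM.
rewrite ge0_integralZl//; last 3 first.
- exact: mI.
- by move=> xi _; rewrite lee_fin I0.
- by rewrite lee_fin exprn_ge0// invr_ge0 ltW.
have If := integrable_fin_num measurableT (iM k w0).
rewrite -(fineK If) -!EFinM /= mulrA cn powRB; last by rewrite (gt_eqF t0) implybT.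
by rewrite powR_mulrn ?(ltW t0)// exprVn.
Qed.

(** Equality holds at [t = 1], so the difference of the two sides has a minimum and a vanishing
    derivative there. An inequality between moments thus replaces differentiation under the
    integral. *)
Lemma tangent_power (K p c : R) : (forall t, 0 < t -> K - c * (t - 1) <= K * t `^ (- p)) ->
  c = p * K.
Proof.
move=> h; pose f (t : R) := K * t `^ (- p) + c * t.
have df (t : R) : 0 < t -> is_derive t (1 : R) f (K * (- p * t `^ (- p - 1)) + c).
  move=> t0; have d1 := is_deriveZ K (is_derive1_powR (- p) t0).
  have d2 := is_deriveZ c (is_derive_id t (1 : R)).
  by apply: is_derive_eq (is_deriveD d1 d2) _; rewrite /GRing.scale/= mulr1.
have : is_derive (1 : R) (1 : R) f 0.
  apply: (@derive1_at_min _ _ 0 2) => //.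
  - by move=> t; rewrite in_itv/= => /andP[t0 _]; have [] := df t t0.
  - by rewrite in_itv/=; lra.
  - move=> t; rewrite in_itv/= => /andP[t0 _]; rewrite /f powR1 mulr1.
    by have := h t t0; lra.
have [_ E1] := df 1 ltr01; move=> [_]; rewrite E1 powR1 mulr1; lra.
Qed.

(** The functions [x^-1] and [x^-2] lie above their tangents. Integrated at [x = symb s w] with
    increment [w (t - 1)] and combined with [moment_scale], this is the hypothesis of
    [tangent_power]. *)
Lemma moment_relations w : 0 < w -> let p := 1 - n%:R / (2 * s) in
  w * M w 2 = p * M w 1 /\ 2 * w * M w 3 = (p + 1) * M w 2.
Proof.
move=> w0 p; split.
- apply: tangent_power => t t0; have tw0 := mulr_gt0 t0 w0.
  have -> : - p = n%:R / (2 * s) - 1%:R by rewrite /p opprB.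
  rewrite [M w 1 * _]mulrC -(moment_scale 0 w0 t0).
  have i1 := iM 0 w0; have i2 := integrableZl measurableT (- (w * (t - 1))) (iM 1 w0).
  rewrite (_ : _ - _ = M w 1 + - (w * (t - 1)) * M w 2); last by ring.
  rewrite -RintegralZl; [|exact: measurableT|exact: iM]; rewrite -RintegralD//.
  apply: le_Rintegral => //; [|exact: iM|].
    by have := integrableD measurableT i1 i2; apply: eq_integrable.
  move=> xi _; have [a0 b0] := (symb_gt0 s w0 xi, symb_gt0 s tw0 xi).
  rewrite -subr_ge0 !expr1.
  have -> : symb s (t * w) xi = symb s w xi + w * (t - 1) by rewrite /symb; ring.
  have : 0 < symb s w xi + w * (t - 1) by move: b0; rewrite /symb; lra.
  move: a0; generalize (symb s w xi) (w * (t - 1)) => x d x0 xd0.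
  (* The explicit gap between [1/(x + d)] and the tangent of [1/x] at [x], visibly nonnegative. *)
  rewrite (_ : _ - _ = d ^+ 2 * (x^-1 ^+ 2 * (x + d)^-1)); last by field; rewrite !gt_eqF.
  by rewrite mulr_ge0 ?sqr_ge0// mulr_ge0 ?sqr_ge0// invr_ge0 ltW.
- apply: tangent_power => t t0; have tw0 := mulr_gt0 t0 w0.
  have -> : - (p + 1) = n%:R / (2 * s) - 2%:R by rewrite /p; ring.
  rewrite [M w 2 * _]mulrC -(moment_scale 1 w0 t0).
  have i1 := iM 1 w0; have i2 := integrableZl measurableT (- (2 * w * (t - 1))) (iM 2 w0).
  rewrite (_ : _ - _ = M w 2 + - (2 * w * (t - 1)) * M w 3); last by ring.
  rewrite -RintegralZl; [|exact: measurableT|exact: iM]; rewrite -RintegralD//.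
  apply: le_Rintegral => //; [|exact: iM|].
    by have := integrableD measurableT i1 i2; apply: eq_integrable.
  move=> xi _; have [a0 b0] := (symb_gt0 s w0 xi, symb_gt0 s tw0 xi).
  rewrite -subr_ge0.
  have -> : symb s (t * w) xi = symb s w xi + w * (t - 1) by rewrite /symb; ring.
  have : 0 < symb s w xi + w * (t - 1) by move: b0; rewrite /symb; lra.
  rewrite -[2 * w * _]mulrA.
  move: a0; generalize (symb s w xi) (w * (t - 1)) => x d x0 xd0.
  rewrite (_ : _ - _ = d ^+ 2 * ((2 * (x + d) + x) * (x^-1 ^+ 3 * (x + d)^-1 ^+ 2))); last first.
    by field; rewrite !gt_eqF.
  rewrite mulr_ge0 ?sqr_ge0// mulr_ge0//; first by lra.
  by rewrite mulr_ge0// exprn_ge0// invr_ge0 ltW.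
Qed.

End moments.

(** * The standing wave *)

Section fourier_side.
Context {R : realType} {n : nat} (s w : R).
Context (n_ge1 : (1 <= n)%N) (s_gt : n%:R / 2 < s) (w0 : 0 < w).
Local Notation X := (Rn R n).
Local Notation mu := (@lebesgue_Rn R n).
Local Notation m := (@symb R n s w).
Local Notation green := (@green R n s w).
Implicit Types (f g h p psi : X -> R[i]) (c : R).

Let s0 : 0 < s.
Proof. by apply: lt_trans s_gt; rewrite divr_gt0// ltr0n. Qed.

Let mm : measurable_fun setT m := measurable_symb s w.
Let wm : forall xi, w <= m xi := symb_ge s w.
Let m0 : forall xi, 0 < m xi := symb_gt0 s w0.
Let im1 := integrable_inv_symb s0 w0 n_ge1 s_gt.

Lemma is_fourier_aeqP f g p q : is_fourier f p -> is_fourier g q -> (aeq f g <-> aeq p q).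
Proof.
move=> fp gq; split; first exact: is_fourier_unique.
move=> pq; have := is_fourier_unique (is_fourier_inv fp) (is_fourier_inv gq).
move=> /(_ _)/wrap[|]; first by apply: filterS pq => x /= h /h ->.
by apply: filterS => x /= e /e /(congr1 (@conjc R)); rewrite !conjcK.
Qed.

Lemma weighted_lty (V W : X -> R) (C : R) p : measurable_fun setT V -> measurable_fun setT W ->
  0 <= C -> (forall xi, 0 <= V xi) -> (forall xi, 0 <= W xi) ->
  (forall xi, V xi <= C * W xi) -> cmeas p ->
  (\int[mu]_xi (W xi * normc (p xi) ^+ 2)%:E < +oo)%E ->
  (\int[mu]_xi (V xi * normc (p xi) ^+ 2)%:E < +oo)%E.
Proof.
move=> mV mW C0 V0 W0 VW mp Wp; have mp2 := measurable_sqr_normc mp.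
have mWp : measurable_fun setT (fun xi => (W xi * normc (p xi) ^+ 2)%:E).
  by apply/measurable_EFinP; exact: measurable_funM.
have E : (\int[mu]_xi (V xi * normc (p xi) ^+ 2)%:E <=
    \int[mu]_xi (C%:E * (W xi * normc (p xi) ^+ 2)%:E))%E.
  apply: ge0_le_integral => //.
  - by move=> xi _; rewrite lee_fin mulr_ge0 ?sqr_ge0.
  - by apply/measurable_EFinP; exact: measurable_funM.
  - exact: measurable_funeM.
  - move=> xi _; rewrite -EFinM lee_fin [leRHS]mulrA.
    by apply: ler_wpM2r; [exact: sqr_ge0|exact: VW].
apply: le_lt_trans E _; rewrite ge0_integralZl//.
- exact: lte_mul_pinfty.
- by move=> xi _; rewrite lee_fin mulr_ge0 ?sqr_ge0.
Qed.

Let weight (a : R) (xi : X) := (1 + enorm xi ^+ 2) `^ a.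

Let mweight a : measurable_fun setT (weight a).
Proof.
apply: (measurableT_comp (measurable_powR a)).
by apply: measurable_funD => //; apply: measurable_funX; exact: measurable_enorm.
Qed.

Let weight_ge0 a xi : 0 <= weight a xi. Proof. exact: powR_ge0. Qed.

Let weight2 xi : weight (2 * s) xi = weight s xi ^+ 2.
Proof. by rewrite /weight mulrC powRrM (powR_mulrn 2)// powR_ge0. Qed.

Lemma HsobP (a : R) f p : is_fourier f p ->
  (Hsob a f <-> (\int[mu]_xi (weight a xi * normc (p xi) ^+ 2)%:E < +oo)%E).
Proof.
move=> fp; have Lf := is_fourier_L2l fp; have [mp _] := is_fourier_L2r fp.
have [mf _] := inL2_fourier Lf.
suff -> : (\int[mu]_xi (weight a xi * normc (p xi) ^+ 2)%:E =
    \int[mu]_xi (weight a xi * normc (fourier f xi) ^+ 2)%:E)%E.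
  by split=> [[]//|h]; split => //; apply/LpC2P.
apply: ae_eq_integral => //.
- by apply/measurable_EFinP; apply: measurable_funM => //; exact: measurable_sqr_normc.
- by apply/measurable_EFinP; apply: measurable_funM => //; exact: measurable_sqr_normc.
- by apply: filterS (fourier_is_fourier fp) => x /= h /h ->.
Qed.

Lemma HsobE f p : is_fourier f p -> (Hsob s f <-> finE mu m p).
Proof.
move=> fp; have [mp _] := is_fourier_L2r fp.
have E : finE mu m p <-> (\int[mu]_xi (m xi * normc (p xi) ^+ 2)%:E < +oo)%E.
  have -> : (\int[mu]_xi (m xi * normc (p xi) ^+ 2)%:E)%E =
      sq2 mu (fun xi => (Num.sqrt (m xi))%:C * p xi).
    apply: eq_integral => xi _; rewrite normcM normc_real exprMn real_normK ?num_real//.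
    by rewrite sqr_sqrtr// ltW.
  split=> [[]//|h]; split => //; apply: cmeasM => //; apply: cmeas_real.
  exact: (measurableT_comp (continuous_measurable_fun (@sqrt_continuous R))).
have [C C0 hC] := @symb_le R n s w s0 w0; have [D D0 hD] := @weight_le R n s w s0 w0.
split=> [/(HsobP s fp) h|/E h]; first (apply/E; move: h); last (apply/(HsobP s fp); move: h).
- by apply: (weighted_lty (C := C)) => //; [exact: ltW|move=> xi; exact: ltW].
- by apply: (weighted_lty (C := D)) => //; [exact: ltW|move=> xi; exact: ltW].
Qed.

Lemma Hsob2E f p : is_fourier f p ->
  (Hsob (2 * s) f <-> inL2 mu (fun xi => (m xi)%:C * p xi)).
Proof.
move=> fp; have [mp _] := is_fourier_L2r fp.
have E : inL2 mu (fun xi => (m xi)%:C * p xi) <->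
    (\int[mu]_xi (m xi ^+ 2 * normc (p xi) ^+ 2)%:E < +oo)%E.
  have -> : (\int[mu]_xi (m xi ^+ 2 * normc (p xi) ^+ 2)%:E)%E =
      sq2 mu (fun xi => (m xi)%:C * p xi).
    by apply: eq_integral => xi _; rewrite normcM normc_real exprMn real_normK ?num_real.
  by split=> [[]//|h]; split => //; apply: cmeasM => //; exact: cmeas_real.
have [C C0 hC] := @symb_le R n s w s0 w0; have [D D0 hD] := @weight_le R n s w s0 w0.
have mm2 : measurable_fun setT (fun xi => m xi ^+ 2) by exact: measurable_funX.
have m_ge0 xi : 0 <= m xi by exact: ltW.
split=> [/(HsobP _ fp) h|/E h]; first (apply/E; move: h); last (apply/(HsobP _ fp); move: h).
- apply: (weighted_lty (C := C ^+ 2)) => //; [exact: sqr_ge0|by move=> xi; exact: sqr_ge0|].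
  by move=> xi; rewrite weight2 -exprMn !expr2; apply: ler_pM; rewrite ?m_ge0// hC.
- apply: (weighted_lty (C := D ^+ 2)) => //; [exact: sqr_ge0|by move=> xi; exact: sqr_ge0|].
  by move=> xi; rewrite weight2 -exprMn !expr2; apply: ler_pM; rewrite ?weight_ge0// hD.
Qed.

(** The specification in [green] is inhabited by the inverse Fourier integral of [1/m], so the
    choice is not the default 0. *)
Lemma green_spec : continuousC green /\ is_fourier green (rm m 1).
Proof.
have frm := finE_rm mm w0 wm im1 0; have Lrm := finE_inL2 mm w0 wm im1 frm.
have irm := finE_cint mm w0 wm im1 frm.
have [f fF] := is_fourier_surj Lrm.
have fG := is_fourier_ifourier1 fF irm.
have mG : cmeas (ifourier1 (rm m 1)).
  have := cmeasJ (cmeas_fourier1 (cintegrableJ irm)).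
  by congr cmeas.
have GF : is_fourier (ifourier1 (rm m 1)) (rm m 1).
  by apply: (is_fourier_aeq fF mG Lrm.1 fG); exact: aeW.
have [cg /LpC2P Lg Fg] := @xgetPex _ (cst 0) [set G | [/\ continuousC G, LpC 2%:E G &
   aeq (fourier G) (fun xi => ((fsymb s xi + w)^-1)%:C)]] (ex_intro _ (ifourier1 (rm m 1))
   (And3 (continuousC_ifourier1 irm) ((LpC2P _).2 (is_fourier_L2l GF)) (fourier_is_fourier GF))).
split => //; apply: (is_fourier_aeq (is_fourier_fourier Lg) Lg.1 Lrm.1); first exact: aeW.
by apply: filterS Fg => xi /= h /h ->; rewrite /rm expr1.
Qed.

Lemma green_origin : green (@origin R n) = (moment mu m 1)%:C.
Proof.
have [cG FG] := green_spec; have irm := finE_cint mm w0 wm im1 (finE_rm mm w0 wm im1 0).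
rewrite -cint_rm -(at0_is_fourier FG irm) /at0 (cont_rep_eq cG)//; exact: aeW.
Qed.

Section operator.
Context (c : R) (psi p : X -> R[i]) (psip : is_fourier psi p).

Let at0E : finE mu m p -> at0 psi = cint mu p.
Proof. by move=> fp; exact: at0_is_fourier psip (finE_cint mm w0 wm im1 fp). Qed.

Let reg x := psi x - c%:C * at0 psi * green x.

Let reg_is_fourier : finE mu m p ->
  is_fourier reg (fun xi => ((m xi)^-1)%:C * op mu m c p xi).
Proof.
move=> fp; have [_ FG] := green_spec.
have := is_fourier_lin (- (c%:C * cint mu p)) FG psip.
rewrite (_ : (fun x => _) = reg); last first.
  by apply/funext => x; rewrite /reg (at0E fp); ring.
congr is_fourier; apply/funext => xi; rewrite /rm expr1 /op mulrBr mulrA -realcM mulVf ?gt_eqF//.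
by ring.
Qed.

(** The regular part of [psi] has transform [op c p / m]. It lies in [H^(2s)] exactly when [m] times
    this, namely [op c p], is square integrable. *)
Lemma delta_domP : delta_dom s w c psi <-> finE mu m p /\ inL2 mu (op mu m c p).
Proof.
have [_ FG] := green_spec; split.
  move=> [/(HsobE psip) fp [g [Hg psig]]]; split => //.
  have Lg : inL2 mu g by case: Hg => /LpC2P.
  have gF := is_fourier_fourier Lg; have hg := (Hsob2E gF).1 Hg.
  have sF := is_fourier_lin (c%:C * at0 psi) FG gF.
  have pE : aeq p (fun xi => c%:C * at0 psi * rm m 1 xi + fourier g xi).
    apply: (is_fourier_unique psip sF); apply: filterS psig => x /= h /h ->.
    by rewrite addrC.
  apply: inL2_ae hg; first by apply: cmeas_op => //; exact: (is_fourier_L2r psip).1.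
  apply: filterS pE => xi /= h /h e; rewrite /op e (at0E fp) /rm expr1 mulrDr mulrCA -realcM.
  by rewrite mulfV ?gt_eqF// mulr1 addrC addKr.
move=> [fp hop]; split; first exact/(HsobE psip).
exists reg; split; last by apply: aeW => x; rewrite /reg subrK.
apply/(Hsob2E (reg_is_fourier fp)); apply: inL2_ae hop.
  apply: cmeasM; first exact: cmeas_real.
  exact: (is_fourier_L2r (reg_is_fourier fp)).1.
by apply: aeW => xi; rewrite mulrA -realcM mulfV ?mul1r// gt_eqF.
Qed.

(** Since [fsymb <= m], the function [fsymb q] is dominated by [m q = op c p], so by surjectivity
    [fraclap] has a genuine value. Adding [w q] gives [m q = op c p]. *)
Lemma delta_op_is_fourier : delta_dom s w c psi -> is_fourier (delta_op s w c psi) (op mu m c p).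
Proof.
move=> /delta_domP[fp hop]; have rF := reg_is_fourier fp.
set q := fun xi => _ in rF.
have mq : cmeas q by exact: (is_fourier_L2r rF).1.
have mf : cmeas (fun xi => (fsymb s xi)%:C * q xi).
  by apply: cmeasM => //; apply: cmeas_real; exact: measurable_fsymb.
have Lf : inL2 mu (fun xi => (fsymb s xi)%:C * q xi).
  apply: inL2_le mf _ hop => xi; rewrite /q mulrA -realcM normcM normc_real.
  rewrite ler_piMl ?normc_ge0// ger0_norm ?divr_ge0 ?fsymb_ge0 ?(ltW (m0 xi))//.
  by rewrite ler_pdivrMr// mul1r lerDl ltW.
have [h hF] := is_fourier_surj Lf.
have rq : aeq (fourier reg) q by exact: fourier_is_fourier.
have [|/LpC2P Lr Fr] := @xgetPex _ (cst 0) [set h | LpC 2%:E h /\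
    aeq (fourier h) (fun xi => (fsymb s xi)%:C * fourier reg xi)].
  exists h; split; first exact/LpC2P/(is_fourier_L2l hF).
  by apply: filterS2 (fourier_is_fourier hF) rq => xi /= e e' I; rewrite e// e'.
have rF2 : is_fourier (fraclap s reg) (fun xi => (fsymb s xi)%:C * q xi).
  apply: (is_fourier_aeq (is_fourier_fourier Lr) Lr.1 mf); first exact: aeW.
  by apply: filterS2 Fr rq => xi /= e e' I; rewrite e// e'.
have := is_fourier_lin w%:C rF rF2; congr is_fourier; apply/funext => x.
  by rewrite /delta_op addrC.
by rewrite -mulrDl -realcD addrC -[fsymb s x + w]/(m x) /q mulrA -realcM mulfV ?mul1r// gt_eqF.
Qed.

End operator.

End fourier_side.

(** * The linearization about the standing wave *)

Section standing_wave.
Context {R : realType} {n : nat} (s omega sigma : R).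
Context (n_ge1 : (1 <= n)%N) (s_gt : n%:R / 2 < s) (omega0 : 0 < omega) (sigma0 : 0 < sigma).
Local Notation X := (Rn R n).
Local Notation mu := (@lebesgue_Rn R n).
Local Notation m := (@symb R n s omega).
Local Notation K := (2 * sigma + 1).
Local Notation M k := (moment mu m k).
Implicit Types (v u : (X -> R[i]) * (X -> R[i])) (p q : X -> R[i]) (lambda : R[i]).

Let s0 : 0 < s.
Proof. by apply: lt_trans s_gt; rewrite divr_gt0// ltr0n. Qed.

Let mm : measurable_fun setT m := measurable_symb s omega.
Let wm : forall xi, omega <= m xi := symb_ge s omega.
Let im1 := integrable_inv_symb s0 omega0 n_ge1 s_gt.
Let mu0 := @lebesgue_Rn_setT R n.
Let K1 : 1 < K. Proof. by rewrite ltrDr mulr_gt0. Qed.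
Let M_gt0 k : 0 < M k.+1 := moment_gt0 mm omega0 wm im1 mu0 k.

(** The value of the Green function at the origin is [M_1], so [phi(0) = M_1^(-1/(2 sigma))] and the
    power [2 sigma] cancels the exponent. *)
Lemma coefmE : coefm n s omega sigma = (M 1)^-1.
Proof.
rewrite /coefm /phi (green_origin n_ge1 s_gt omega0) /=.
have M1 := M_gt0 0.
have -> : (M 1)%:C / (M 1 `^ (1 + (2 * sigma)^-1))%:C = (M 1 `^ (- (2 * sigma)^-1))%:C.
  rewrite powRD; last by rewrite (gt_eqF M1) implybT.
  rewrite powRr1 ?(ltW M1)// realcM powRN.
  have h : M 1 `^ (2 * sigma)^-1 != 0 by rewrite gt_eqF// powR_gt0.
  rewrite (fmorphV (real_complex R)); field.
  by rewrite !realc_eq0 h gt_eqF.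
rewrite normc_real ger0_norm ?powR_ge0// -powRrM mulNr mulVf ?powR_inv1 ?(ltW M1)//.
by rewrite mulf_neq0// gt_eqF.
Qed.

Lemma coefpE : Defs.coefp n s omega sigma = K * (M 1)^-1.
Proof. by rewrite /Defs.coefp coefmE. Qed.

Local Notation cm := (M 1)^-1.
Local Notation cp := (K * (M 1)^-1).

(* By [delta_domP], the last four conditions say that v lies in the domain of L. *)
Let transform v p q := [/\ is_fourier v.1 p, is_fourier v.2 q &
  [/\ finE mu m p, finE mu m q, inL2 mu (op mu m cm p) & inL2 mu (op mu m cp q)]].

Let domLP v p q : is_fourier v.1 p -> is_fourier v.2 q ->
  (domL s omega sigma v <-> transform v p q).
Proof.
move=> vp vq; rewrite /domL coefmE coefpE.
have [a1 a2] := delta_domP n_ge1 s_gt omega0 cm vp.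
have [b1 b2] := delta_domP n_ge1 s_gt omega0 cp vq.
by split=> [[/a1[? ?] /b1[? ?]]|[_ _ [? ? ? ?]]]; [split|split; [exact: a2|exact: b2]].
Qed.

Let domL_transform v : domL s omega sigma v -> transform v (fourier v.1) (fourier v.2).
Proof.
move=> dv; have [[[/LpC2P L1 _] _] [[/LpC2P L2 _] _]] := dv.
by apply: (domLP _ _).1 => //; exact: is_fourier_fourier.
Qed.

Let JL_fourier lambda v p q : transform v p q ->
  let r := vsub (opJ (opL s omega sigma v)) (vscale lambda v) in
  is_fourier r.1 (fun xi => - op mu m cp q xi - lambda * p xi) /\
  is_fourier r.2 (fun xi => op mu m cm p xi - lambda * q xi).
Proof.
move=> tv r; have [vp vq [fp fq hp hq]] := tv.
have Lp := delta_op_is_fourier n_ge1 s_gt omega0 vp ((delta_domP n_ge1 s_gt omega0 cm vp).2 (conj fp hp)).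
have Lq := delta_op_is_fourier n_ge1 s_gt omega0 vq ((delta_domP n_ge1 s_gt omega0 cp vq).2 (conj fq hq)).
have zF (f g : X -> R[i]) : is_fourier f g -> is_fourier (fun x => lambda * f x) (fun x => lambda * g x).
  (* A multiple is a combination [c f + f'] with [f' = f]. *)
  move=> fg; have := is_fourier_lin (lambda - 1) fg fg.
  by congr is_fourier; apply/funext => x; ring.
rewrite /r /vsub /vscale /opJ /opL /= coefmE coefpE; split.
  have := is_fourier_lin (- 1) Lq (is_fourier_lin (- 1) (zF _ _ vp) (is_fourierB (zF _ _ vp) (zF _ _ vp))).
  by congr is_fourier; apply/funext => x; ring.
exact: is_fourierB Lp (zF _ _ vq).
Qed.

Let is_fourierZ (z : R[i]) f g : is_fourier f g ->
  is_fourier (fun x : X => z * f x) (fun x : X => z * g x).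
Proof.
move=> fg; have := is_fourier_lin (z - 1) fg fg.
by congr is_fourier; apply/funext => x; ring.
Qed.

(** For [z = 0] this is the eigenvalue equation. General [z] serves the Jordan chains in
    [eigenpair_simple]. *)
Let JL_aeqP lambda z u p' q' v p q : transform u p' q' ->
  is_fourier v.1 p -> is_fourier v.2 q ->
  vaeq (vsub (opJ (opL s omega sigma u)) (vscale lambda u)) (vscale z v) <->
  op mu m cm p' = (fun xi => lambda * q' xi + z * q xi) %[ae mu] /\
  op mu m cp q' = (fun xi => - lambda * p' xi + - z * p xi) %[ae mu].
Proof.
move=> tu vp vq; have [r1 r2] := JL_fourier lambda tu.
have [a1 a2] := is_fourier_aeqP r1 (is_fourierZ z vp).
have [b1 b2] := is_fourier_aeqP r2 (is_fourierZ z vq).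
split=> [[/a1 h1 /b1 h2]|[h1 h2]].
  split; [apply: filterS h2|apply: filterS h1] => xi /= h /h e.
    by rewrite -e; ring.
  by rewrite (mulNr z) -e; ring.
split; [apply: a2; apply: filterS h2|apply: b2; apply: filterS h1] => xi /= h /h ->; ring.
Qed.

Let eigP lambda v p q : transform v p q ->
  vaeq (opJ (opL s omega sigma v)) (vscale lambda v) <-> eig mu m K lambda p q.
Proof.
move=> tv; have [vp vq [fp fq hp hq]] := tv.
have [h1 h2] := JL_aeqP lambda 0 tv vp vq.
split=> [[e1 e2]|[_ _ e1 e2]].
  have [|d1 d2] := h1.
    by split; [apply: filterS e1|apply: filterS e2] => x /= h /h ->; rewrite mul0r subrr.
  split => //; [apply: filterS d1|apply: filterS d2] => xi /= h /h ->;
    by rewrite ?oppr0 mul0r addr0.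
have [|d1 d2] := h2.
  by split; [apply: filterS e1|apply: filterS e2] => xi /= h /h ->; rewrite ?oppr0 mul0r addr0.
by split; [apply: filterS d1|apply: filterS d2] => x /= h /h /eqP;
  rewrite mul0r subr_eq0 => /eqP.
Qed.

Let is_fourier0 : is_fourier (fun _ : X => 0) (fun _ : X => 0).
Proof.
have := is_fourierB (is_fourier_fourier (inL2_0 mu)) (is_fourier_fourier (inL2_0 mu)).
by congr is_fourier; apply/funext => x; rewrite subrr.
Qed.

Let vzeroP v p q : is_fourier v.1 p -> is_fourier v.2 q -> vaeq v (@vzero R n) <-> nullp mu p q.
Proof.
move=> vp vq; have h1 := is_fourier_aeqP vp is_fourier0; have h2 := is_fourier_aeqP vq is_fourier0.
by split=> -[/h1 ? /h2 ?].
Qed.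

Let eigenpair_eig lambda v : eigenpair s omega sigma lambda v ->
  exists p q, [/\ transform v p q, eig mu m K lambda p q & ~ nullp mu p q].
Proof.
move=> [dv nz ev]; have tv := domL_transform dv; have [vp vq _] := tv.
by exists (fourier v.1), (fourier v.2); split => //; [exact: (eigP lambda tv).1|move/(vzeroP vp vq)].
Qed.

Let eig_eigenpair lambda p q : eig mu m K lambda p q -> ~ nullp mu p q ->
  exists v, eigenpair s omega sigma lambda v.
Proof.
move=> e nz; have [fp fq e1 e2] := e.
have [Lp Lq] := (finE_inL2 mm omega0 wm im1 fp, finE_inL2 mm omega0 wm im1 fq).
have [f fF] := is_fourier_surj Lp; have [g gF] := is_fourier_surj Lq.
have tv : transform (f, g) p q.
  split => //; split => //.
    by apply: inL2_ae e1 (inL2Z lambda Lq); apply: cmeas_op => //; exact: Lp.1.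
  by apply: inL2_ae e2 (inL2Z (- lambda) Lp); apply: cmeas_op => //; exact: Lq.1.
exists (f, g); split; first exact: (@domLP (f, g) _ _ fF gF).2.
  by move/(@vzeroP (f, g) _ _ fF gF).
exact: (eigP lambda tv).2.
Qed.

(** Induction on the order: [(J L - lambda) u] belongs to the kernel of lower order, hence is [z v].
    Then [z = 0] by [eig_no_jordan], so [u] satisfies the eigenvalue equation and is a multiple of
    [v]. *)
Let eigenpair_simple lambda v : 0 < complex.Re lambda ->
  eigenpair s omega sigma lambda v -> simple_eigenvalue n s omega sigma lambda.
Proof.
move=> l0 ev; have [p [q [tv e nz]]] := eigenpair_eig ev; have [vp vq _] := tv.
exists v; split => //; elim=> [|k ih] u /=.
  move=> u0; exists 0; split; [apply: filterS u0.1|apply: filterS u0.2] => x /= h /h ->;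
    by rewrite mul0r.
move=> [du /ih[z uz]]; have tu := domL_transform du.
have [h1 h2] := (JL_aeqP lambda z tu vp vq).1 uz.
have [up uq [fp' fq' _ _]] := tu.
have z0 : z = 0.
  exact: (eig_no_jordan mm omega0 wm im1 mu0 l0 e nz fp' fq' h1 h2).
have e' : eig mu m K lambda (fourier u.1) (fourier u.2).
  split => //; [apply: filterS h1|apply: filterS h2] => xi /= h /h ->;
    by rewrite z0 ?oppr0 mul0r addr0.
have [y [y1 y2]] := eig_proportional mm omega0 wm im1 mu0 l0 e nz e'.
exists y; split.
  exact: (is_fourier_aeqP up (is_fourierZ y vp)).2.
exact: (is_fourier_aeqP uq (is_fourierZ y vq)).2.
Qed.

Lemma unstable_single_mode : spectrally_unstable n s omega sigma ->
  single_simple_real_mode n s omega sigma.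
Proof.
move=> [lambda [v [l0 ev]]]; have [p [q [_ e nz]]] := eigenpair_eig ev.
have [li _ _] := eig_real mm omega0 wm im1 mu0 e l0 nz.
have lE : lambda = (complex.Re lambda)%:C by apply: complex_eqP.
exists (complex.Re lambda); split => //.
  by rewrite -lE; exact: eigenpair_simple ev.
move=> k u k0 /eigenpair_eig[p' [q' [_ e' nz']]]; rewrite -lE.
exact: (eig_unique mm omega0 wm im1 mu0 k0 l0 e' nz' e nz).
Qed.

(** The factor [2 omega^2] is what the moment relations absorb: both sides become multiples of
    [p M_1^2], leaving [2 K p < (K - 1) (p + 1)]. *)
Let threshold : (K * M 2 ^+ 2 < (K - 1) * M 1 * M 3) = (2 * s / n%:R - 1 < sigma).
Proof.
have n0 : 0 < n%:R :> R by rewrite ltr0n.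
have [E1 E2] := moment_relations n_ge1 s_gt omega0.
set p := 1 - n%:R / (2 * s) in E1 E2.
have p0 : 0 < p.
  by rewrite subr_gt0 ltr_pdivrMr ?mulr_gt0// mul1r; move: s_gt; rewrite ltr_pdivrMr// mulrC.
have c0 : 0 < 2 * omega ^+ 2 by rewrite mulr_gt0// exprn_gt0.
rewrite -(ltr_pM2l c0).
have -> : 2 * omega ^+ 2 * (K * M 2 ^+ 2) = 2 * K * p * (p * M 1 ^+ 2).
  transitivity (2 * K * (omega * M 2) ^+ 2); first by ring.
  by rewrite E1; ring.
have -> : 2 * omega ^+ 2 * ((K - 1) * M 1 * M 3) = (K - 1) * (p + 1) * (p * M 1 ^+ 2).
  transitivity ((K - 1) * M 1 * (omega * (2 * omega * M 3))); first by ring.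
  rewrite E2; transitivity ((K - 1) * M 1 * ((p + 1) * (omega * M 2))); first by ring.
  by rewrite E1; ring.
rewrite ltr_pM2r; last by rewrite mulr_gt0// exprn_gt0// M_gt0.
have -> : (2 * K * p < (K - 1) * (p + 1)) = (1 < (sigma + 1) * (n%:R / (2 * s))).
  by rewrite /p; apply/idP/idP => h; lra.
by rewrite mulrA ltr_pdivlMr ?mulr_gt0// mul1r ltrBlDr ltr_pdivrMr.
Qed.

Lemma unstableP : spectrally_unstable n s omega sigma <-> 2 * s / n%:R - 1 < sigma.
Proof.
rewrite -threshold; split.
  move=> [lambda [v [l0 /eigenpair_eig[p [q [_ e nz]]]]]]; rewrite ltNge; apply/negP => h.
  by apply: nz; exact: (eig_stable mm omega0 wm im1 mu0 K1 h l0 e).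
move=> /(eig_exists mm omega0 wm im1 mu0 K1)[l [l0 [p [q [e nz]]]]].
have [v ev] := eig_eigenpair e nz.
by exists l%:C, v.
Qed.

End standing_wave.

(** At [sigma = 2s/n - 1] the criterion [unstableP] gives stability although the strict inequality
    fails, which is why the equivalence is stated away from this value. *)
Theorem theorem2 (R : realType) (n : nat) (s omega sigma : R)
    (n_ge1 : (1 <= n)%N) (s_gt : n%:R / 2 < s)
    (omega_gt0 : 0 < omega) (sigma_gt0 : 0 < sigma) :
  (sigma <> 2 * s / n%:R - 1 ->
     (spectrally_stable n s omega sigma <-> 0 < sigma < 2 * s / n%:R - 1)) /\
  (spectrally_unstable n s omega sigma ->
     single_simple_real_mode n s omega sigma).
Proof.
split; last exact: unstable_single_mode.
have uP := unstableP n_ge1 s_gt omega_gt0 sigma_gt0.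
move=> /eqP ne; rewrite sigma_gt0 /= lt_neqAle ne leNgt.
by split=> [h|/negP h /uP//]; apply/negP => /uP.
Qed.
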